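(* Suppose that Assumptions (A1) and (A2) (stated in the context) hold for the initial data $(T_{\rm l,0},T_{\rm s,0},s_0)$, and that the setpoint $s_{\rm r}$ is chosen to satisfy $s_{\rm r}<L$ and $q_{\rm c}(0)>0$, where $q_{\rm c}$ is given by the control law below. Consider the closed-loop system consisting of the two-phase Stefan problem $$\partial_t T_{\rm l}(x,t)=\alpha_{\rm l}\,\partial_{xx}T_{\rm l}(x,t)\ \ (0<x<s(t)),\qquad \partial_t T_{\rm s}(x,t)=\alpha_{\rm s}\,\partial_{xx}T_{\rm s}(x,t)\ \ (s(t)<x<L),$$ $$\partial_x T_{\rm l}(0,t)=-\frac{q_{\rm c}(t)}{k_{\rm l}},\quad \partial_x T_{\rm s}(L,t)=0,\quad T_{\rm l}(s(t),t)=T_{\rm m},\quad T_{\rm s}(s(t),t)=T_{\rm m},$$ $$\gamma\,\dot s(t)=-k_{\rm l}\,\partial_xT_{\rm l}(s(t),t)+k_{\rm s}\,\partial_xT_{\rm s}(s(t),t),$$ with initial data $T_{\rm l}(\cdot,0)=T_{\rm l,0}$, $T_{\rm s}(\cdot,0)=T_{\rm s,0}$, $s(0)=s_0$, and the control law $$q_{\rm c}(t)=-c\left(\frac{k_{\rm l}}{\alpha_{\rm l}}(1+\varepsilon_{\rm l})\int_0^{s(t)}(T_{\rm l}(x,t)-T_{\rm m})\,dx+\frac{k_{\rm s}}{\alpha_{\rm s}}(1+\varepsilon_{\rm s})\int_{s(t)}^{L}(T_{\rm s}(x,t)-T_{\rm m})\,dx+\gamma(1+\varepsilon_{\rm f})(s(t)-s_{\rm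 r})\right).$$ Then, for any perturbations $(\varepsilon_{\rm l},\varepsilon_{\rm s},\varepsilon_{\rm f})$ satisfying $$\varepsilon_{\rm l}\ge\varepsilon_{\rm f}\ge\varepsilon_{\rm s},$$ there exists $R>0$ such that if $$\left|\frac{\varepsilon_{\rm f}-\varepsilon_{\rm l}}{1+\varepsilon_{\rm l}}\right|<R,$$ then the closed-loop system maintains the model validity conditions $$T_{\rm l}(x,t)\ge T_{\rm m}\ \ \forall x\in(0,s(t)),\qquad T_{\rm s}(x,t)\le T_{\rm m}\ \ \forall x\in(s(t),L),\qquad 0<s(t)<L,\qquad \forall t>0,$$ and exponential stability at the origin (that is, at $T_{\rm l}-T_{\rm m}=0$, $T_{\rm s}-T_{\rm m}=0$, $s-s_{\rm r}=0$) holds for the norm $$\Psi(t)=\int_0^{s(t)}(T_{\rm l}(x,t)-T_{\rm m})^2\,dx+\int_{s(t)}^{L}(T_{\rm s}(x,t)-T_{\rm m})^2\,dx+(s(t)-s_{\rm r})^2,$$ i.e. there exist constants $M>0$ and $d>0$ such that $\Psi(t)\le M\,\Psi(0)\,e^{-dt}$ for all $t\ge0$.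
   Context: The unknowns are the liquid temperature $T_{\rm l}(x,t)$ on $0\le x\le s(t)$, the solid temperature $T_{\rm s}(x,t)$ on $s(t)\le x\le L$, and the position $s(t)$ of the liquid-solid interface; $q_{\rm c}(t)$ is the boundary heat input. $L>0$ is the length of the material and $T_{\rm m}$ is the melting temperature. For $i\in\{{\rm l},{\rm s}\}$ (liquid, solid), $\alpha_i=k_i/(\rho_ic_i)$, where $\rho_i$, $c_i$, $k_i$ are the (positive) density, heat capacity and thermal conductivity, and $\gamma=\rho_{\rm l}\Delta H^*$, where $\Delta H^*>0$ is the latent heat of fusion. $c>0$ is the controller gain, and $s_{\rm r}$ is the desired setpoint of the interface position. The numbers $\varepsilon_{\rm l},\varepsilon_{\rm s},\varepsilon_{\rm f}$ are the uncertainties of the physical parameters in the control law, and they satisfy $\varepsilon_{\rm l}>-1$, $\varepsilon_{\rm s}\ge-1$, $\varepsilon_{\rm f}\ge-1$. Solutions are classical solutions. Assumption (A1): $0<s_0<L$; $T_{\rm l,0}(x)$ and $T_{\rm s,0}(x)$ are piecewise continuous functions, and there exist constants $H_{\rm l}>0$ and $H_{\rm s}>0$ such that $T_{\rm m}\le T_{\rm l,0}(x)\le T_{\rm m}+H_{\rm l}(s_0-x)$ for all $x\in[0,s_0]$, and $T_{\rm m}\ge T_{\rm s,0}(x)\ge T_{\rm m}+H_{\rm s}(s_0-x)$ for all $x\in[s_0,L]$. Assumption (A2): $0<s_\infty<L$, where $$s_\infty:=s_0+\frac{k_{\rm l}}{\alpha_{\rm l}\gamma}\int_0^{s_0}(T_{\rm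 l,0}(x)-T_{\rm m})\,dx+\frac{k_{\rm s}}{\alpha_{\rm s}\gamma}\int_{s_0}^{L}(T_{\rm s,0}(x)-T_{\rm m})\,dx .$$ *)

(* Defs.v *)
(* Stdlib reals with Coquelicot. *)
From Stdlib Require Import Reals List.
From Coquelicot Require Import Coquelicot.
Open Scope R_scope.

Record plant := Plant {
  rho_l : R; heat_l : R; k_l : R;
  rho_s : R; heat_s : R; k_s : R;
  latent : R;
  len : R;
  T_m : R;
  rho_l_pos : 0 < rho_l; heat_l_pos : 0 < heat_l; k_l_pos : 0 < k_l;
  rho_s_pos : 0 < rho_s; heat_s_pos : 0 < heat_s; k_s_pos : 0 < k_s;
  latent_pos : 0 < latent;
  len_pos : 0 < len
}.

Definition alpha_l (P : plant) : R := k_l P / (rho_l P * heat_l P).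
Definition alpha_s (P : plant) : R := k_s P / (rho_s P * heat_s P).
Definition gamma (P : plant) : R := rho_l P * latent P.

(* Finitely many exceptional points, finite one-sided limits everywhere. *)
Definition piecewise_continuous (f : R -> R) (a b : R) : Prop :=
  (exists l : list R, forall x, a < x < b -> ~ In x l -> continuous f x) /\
  (forall x, a < x <= b -> exists y : R, filterlim f (at_left x) (locally y)) /\
  (forall x, a <= x < b -> exists y : R, filterlim f (at_right x) (locally y)).

Definition assumption_A1 (P : plant) (Tl0 Ts0 : R -> R) (s0 : R) : Prop :=
  0 < s0 < len P /\
  piecewise_continuous Tl0 0 s0 /\
  piecewise_continuous Ts0 s0 (len P) /\
  exists H_l H_s : R, 0 < H_l /\ 0 < H_s /\
    (forall x, 0 <= x <= s0 -> T_m P <= Tl0 x <= T_m P + H_l * (s0 - x)) /\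
    (forall x, s0 <= x <= len P -> T_m P + H_s * (s0 - x) <= Ts0 x <= T_m P).

Definition s_infty (P : plant) (Tl0 Ts0 : R -> R) (s0 : R) : R :=
  s0 + k_l P / (alpha_l P * gamma P) * RInt (fun x => Tl0 x - T_m P) 0 s0
     + k_s P / (alpha_s P * gamma P) * RInt (fun x => Ts0 x - T_m P) s0 (len P).

Definition assumption_A2 (P : plant) (Tl0 Ts0 : R -> R) (s0 : R) : Prop :=
  0 < s_infty P Tl0 Ts0 s0 < len P.

(* The control law as a function of the current profiles and interface. *)
Definition control (P : plant) (c s_r eps_l eps_s eps_f : R)
    (Tl Ts : R -> R) (s : R) : R :=
  - c * (k_l P / alpha_l P * (1 + eps_l) * RInt (fun x => Tl x - T_m P) 0 s
         + k_s P / alpha_s P * (1 + eps_s) * RInt (fun x => Ts x - T_m P) s (len P)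
         + gamma P * (1 + eps_f) * (s - s_r)).

Definition Psi (P : plant) (s_r : R) (Tl Ts : R -> R) (s : R) : R :=
  RInt (fun x => (Tl x - T_m P) ^ 2) 0 s
  + RInt (fun x => (Ts x - T_m P) ^ 2) s (len P)
  + (s - s_r) ^ 2.

(* [l] is the derivative at [x] of [f] restricted to [a, b]: two-sided inside,
   one-sided at the end points, no condition when [a, b] is empty or a point. *)
Definition is_derive_on (a b : R) (f : R -> R) (x l : R) : Prop :=
  filterlim (fun y => (f y - f x) / (y - x))
    (within (fun y => a <= y <= b) (locally' x)) (locally l).

Definition region (J : R -> Prop) (a b : R -> R) (p : R * R) : Prop :=
  J (snd p) /\ a (snd p) <= fst p <= b (snd p).

Definition open_region (J : R -> Prop) (a b : R -> R) (p : R * R) : Prop :=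
  J (snd p) /\ a (snd p) < fst p < b (snd p).

(* The time horizon [tau] is allowed to be [p_infty]. *)
Definition nonneg_times (tau : Rbar) (t : R) : Prop := 0 <= t /\ Rbar_lt t tau.
Definition pos_times (tau : Rbar) (t : R) : Prop := 0 < t /\ Rbar_lt t tau.

(* Classical solution [T], with gradient [Tx], of the heat equation with
   diffusivity [alpha] on a(t) <= x <= b(t), 0 <= t < tau.  As the initial
   datum may jump, it is attained at its points of continuity, and [T] is
   bounded on bounded time intervals. *)
Record classical_heat (alpha : R) (tau : Rbar) (a b : R -> R) (T0 : R -> R)
    (T Tx : R -> R -> R) : Prop := {
  heat_eq : forall x t, open_region (pos_times tau) a b (x, t) ->
    ex_derive (fun r => T x r) t /\
    ex_derive_n (fun y => T y t) 2 x /\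
    Derive (fun r => T x r) t = alpha * Derive_n (fun y => T y t) 2 x;
  heat_cont_t : continuous_on (open_region (pos_times tau) a b)
    (fun p => Derive (fun r => T (fst p) r) (snd p));
  heat_cont_xx : continuous_on (open_region (pos_times tau) a b)
    (fun p => Derive_n (fun y => T y (snd p)) 2 (fst p));
  heat_cont : continuous_on (region (pos_times tau) a b)
    (fun p => T (fst p) (snd p));
  heat_grad : forall x t, region (pos_times tau) a b (x, t) ->
    is_derive_on (a t) (b t) (fun y => T y t) x (Tx x t);
  heat_cont_grad : continuous_on (region (pos_times tau) a b)
    (fun p => Tx (fst p) (snd p));
  heat_init : forall x, a 0 <= x <= b 0 -> T x 0 = T0 x;
  heat_init_cont : forall x, a 0 <= x <= b 0 ->
    filterlim T0 (within (fun y => a 0 <= y <= b 0) (locally x)) (locally (T0 x)) ->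
    filterlim (fun p => T (fst p) (snd p))
      (within (region (nonneg_times tau) a b) (locally (x, 0))) (locally (T0 x));
  heat_bounded : forall t1, nonneg_times tau t1 ->
    exists K : R, forall x t, 0 <= t <= t1 -> a t <= x <= b t -> Rabs (T x t) <= K
}.

(* Classical solution on [0, tau) of the closed loop.  The bounds
   0 < s t < len P are not part of the definition. *)
Record closed_loop_solution (P : plant) (c s_r eps_l eps_s eps_f : R)
    (Tl0 Ts0 : R -> R) (s0 : R) (tau : Rbar)
    (Tl Tlx Ts Tsx : R -> R -> R) (s : R -> R) : Prop := {
  cl_liquid : classical_heat (alpha_l P) tau (fun _ => 0) s Tl0 Tl Tlx;
  cl_solid : classical_heat (alpha_s P) tau s (fun _ => len P) Ts0 Ts Tsx;
  cl_init : s 0 = s0;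
  cl_cont : continuous_on (nonneg_times tau) s;
  cl_heat_input : forall t, pos_times tau t ->
    Tlx 0 t = - (control P c s_r eps_l eps_s eps_f
                   (fun x => Tl x t) (fun x => Ts x t) (s t)) / k_l P;
  cl_insulated : forall t, pos_times tau t -> Tsx (len P) t = 0;
  cl_melt_l : forall t, pos_times tau t -> Tl (s t) t = T_m P;
  cl_melt_s : forall t, pos_times tau t -> Ts (s t) t = T_m P;
  cl_stefan : forall t, pos_times tau t ->
    ex_derive s t /\
    gamma P * Derive s t = - k_l P * Tlx (s t) t + k_s P * Tsx (s t) t
}.

(* Main.v *)
Require Import Defs.
From Stdlib Require Import Reals List Lra Classical.
From Coquelicot Require Import Coquelicot.
Open Scope R_scope.

(** Energy identities: for a C^2 function phi with phi(T_m) = 0, the integral of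
    phi(T) over a phase is differentiable in time, its derivative consisting of
    boundary fluxes and of minus alpha times the integral of phi''(T) T_x^2; it is
    continuous up to t = 0 by dominated convergence on moving intervals.  The cubed
    negative (positive) part of T - T_m gives the signs of the two profiles, hence
    the signs of the gradients at the interface, and with eps_l >= eps_f >= eps_s
    this yields q' >= - c (1 + eps_l) q.  Since the total energy E satisfies E' = q,
    the bounds q > 0 and 0 < s < L propagate in time: s = 0 would contradict
    E >= E(0), and s = L would contradict q > 0.  Finally
      W = int (T_l - T_m)^2 + int (T_s - T_m)^2 + beta E^2
    decays exponentially: with Z = - E > 0, kap = 1 + eps_f > 0 and q = c (kap Z - Y),
    Y >= 0, either Y <= kap Z / 2 and the term - beta Z q controls Z^2, or Z is
    dominated by Y, that is, by the two integrals, and Poincare's inequality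
    suffices. *)

(** * Integrals over moving intervals *)

(** The heat equation holds only in the open region, and [T_t], [T_xx] are not controlled up to its
    boundary; so differentiation under the integral is legitimate only on intervals shortened by a
    margin at both ends. The mean value theorem in time gives an estimate uniform in the margin, and
    only then does the margin tend to 0. At [t = 0] the data may jump, so there is continuity but no
    derivative, and every monotonicity argument starts from a one-sided limit. The bounds on [s] are
    a conclusion: they are bootstrapped together with [q > 0], so continuity is needed even at a
    time where one phase has shrunk to a point. [W] contains [E] rather than [s - s_r] because the
    interface fluxes cancel in [E' = q]: the interface speed disappears from [W'], and the only term
    of the wrong sign is the one due to heating, [2 alpha_l / k_l * (T_l(0) - T_m) * q]. The weight
    [beta = alpha_l L c kap / k_l^2] is chosen so that half of the good term [2 beta Z q] absorbs
    what Young's inequality leaves of it. *)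

Lemma filterlim_R {T : Type} (F : (T -> Prop) -> Prop) {FF : Filter F} (f : T -> R) (l : R) :
  filterlim f F (locally l) <-> (forall eps, 0 < eps -> F (fun p => Rabs (f p - l) < eps)).
Proof.
  split.
  - intros H eps He.
    exact (proj1 (filterlim_locally f l) H (mkposreal eps He)).
  - intros H. apply filterlim_locally. intros eps. exact (H eps (cond_pos eps)).
Qed.

(** Let [m] be the supremum of the [t] such that [P] holds on all of [[a, t]]. The first step gives
    [P m], and the second forbids [m < b]. At [t = a] the first step has an empty hypothesis, so it
    contains the base case. *)
Lemma real_induction (P : R -> Prop) (a b : R) :
  a <= b ->
  (forall t, a <= t <= b -> (forall r, a <= r < t -> P r) -> P t) ->
  (forall t, a <= t < b -> P t -> exists d, 0 < d /\ forall r, t <= r < t + d -> r <= b -> P r) ->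
  forall t, a <= t <= b -> P t.
Proof.
  intros Hab Hl Hr.
  set (E := fun t => a <= t <= b /\ forall r, a <= r <= t -> P r).
  assert (Ea : E a).
  { split; [lra|]. intros r Hr0. replace r with a by lra.
    apply Hl; [lra|]. intros; lra. }
  destruct (completeness E) as [m [Hm1 Hm2]].
  - exists b. intros t [Ht _]. lra.
  - exists a. exact Ea.
  - assert (Ham : a <= m) by (apply Hm1; exact Ea).
    assert (Hmb : m <= b) by (apply Hm2; intros t [Ht _]; lra).
    assert (Hlt : forall r, a <= r < m -> P r).
    { intros r Hrm. apply NNPP. intro HN.
      assert (m <= r); [|lra].
      apply Hm2. intros t [Ht Pt]. destruct (Rle_lt_dec t r); [lra|].
      exfalso. apply HN, Pt. lra. }
    assert (Pm : P m) by (apply Hl; auto).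
    destruct (Rle_lt_or_eq_dec m b Hmb) as [Hlt'|Heq].
    + exfalso. destruct (Hr m) as [d [Hd HP]]; [lra|exact Pm|].
      set (m' := Rmin b (m + d / 2)).
      assert (Hm' : m < m' /\ m' <= b /\ m' < m + d)
        by (unfold m', Rmin; destruct Rle_dec; lra).
      assert (m' <= m); [|lra].
      apply Hm1. split; [lra|]. intros r Hr0.
      destruct (Rlt_le_dec r m); [apply Hlt; lra|]. apply HP; lra.
    + intros t Ht. destruct (Rle_lt_or_eq_dec t m) as [H|H]; [lra| |].
      * apply Hlt. lra.
      * now rewrite H.
Qed.

(** Compactness of [[a, b]] without subcovers. It will be applied to properties of the form:
    eventually along a filter, an estimate holds on [[x, y]]; additivity is then the intersection of
    two eventual sets. *)
Lemma interval_additive (P : R -> R -> Prop) (a b : R) :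
  a <= b ->
  (forall x y z, a <= x <= y -> y <= z <= b -> P x y -> P y z -> P x z) ->
  (forall t, a <= t <= b -> exists d, 0 < d /\
     forall x y, a <= x -> y <= b -> t - d < x <= t -> t <= y < t + d -> P x y) ->
  P a b.
Proof.
  intros Hab Hadd Hloc.
  apply (real_induction (P a) a b); try lra.
  - intros t Ht HP. destruct (Hloc t Ht) as [d [Hd Hd']].
    destruct (Rle_lt_or_eq_dec a t) as [H|H]; [lra| |].
    + set (r := Rmax a (t - d / 2)).
      assert (a <= r /\ t - d < r /\ r < t)
        by (unfold r, Rmax; destruct Rle_dec; lra).
      apply (Hadd a r t); try lra.
      * apply HP. lra.
      * apply Hd'; lra.
    + apply Hd'; lra.
  - intros t Ht Pt. destruct (Hloc t) as [d [Hd Hd']]; [lra|].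
    exists d. split; [exact Hd|]. intros r Hr Hrb.
    apply (Hadd a t r); try lra; auto. apply Hd'; lra.
Qed.

Lemma ex_RInt_limits (f : R -> R) (a b : R) :
  a < b -> (forall x, a < x < b -> continuous f x) ->
  (exists y, filterlim f (at_right a) (locally y)) ->
  (exists y, filterlim f (at_left b) (locally y)) -> ex_RInt f a b.
Proof.
  intros Hab Hc [la Hla] [lb Hlb].
  destruct (C0_extension_lt f la lb a b Hab Hc Hla Hlb) as [g [Hg [Hgf _]]].
  apply (ex_RInt_ext g).
  - intros x. rewrite Rmin_left, Rmax_right by lra. apply Hgf.
  - apply (ex_RInt_continuous g). intros z _. apply Hg.
Qed.

(** Induction on the exceptional list: a listed point inside the interval splits it, and one outside
    is dropped. *)
Lemma piecewise_continuous_ex_RInt (f : R -> R) (a b : R) :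
  a <= b -> piecewise_continuous f a b -> ex_RInt f a b.
Proof.
  intros Hab [[l Hl] [HL HR]]. revert a b Hab Hl HL HR.
  induction l as [|z l IH]; intros a b Hab Hl HL HR.
  - destruct (Rle_lt_or_eq_dec a b Hab) as [H|H].
    + apply ex_RInt_limits; auto.
      * apply HR; lra.
      * apply HL; lra.
    + rewrite H. apply ex_RInt_point.
  - destruct (Rlt_le_dec a z) as [Haz|Haz]; [destruct (Rlt_le_dec z b) as [Hzb|Hzb]|].
    + apply (ex_RInt_Chasles f a z b); apply IH; try lra.
      * intros x Hx Hx'. apply Hl; [lra|]. intros [E|E]; [lra|contradiction].
      * intros x Hx. apply HL; lra.
      * intros x Hx. apply HR; lra.
      * intros x Hx Hx'. apply Hl; [lra|]. intros [E|E]; [lra|contradiction].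
      * intros x Hx. apply HL; lra.
      * intros x Hx. apply HR; lra.
    + apply IH; auto.
      intros x Hx Hx'. apply Hl; [lra|]. intros [E|E]; [lra|contradiction].
    + apply IH; auto.
      intros x Hx Hx'. apply Hl; [lra|]. intros [E|E]; [lra|contradiction].
Qed.

Lemma piecewise_continuous_comp (g f : R -> R) (a b : R) :
  (forall z, continuous g z) -> piecewise_continuous f a b ->
  piecewise_continuous (fun x => g (f x)) a b.
Proof.
  intros Hg [[l Hl] [HL HR]]. repeat split.
  - exists l. intros x Hx Hn. apply (continuous_comp f g); auto.
  - intros x Hx. destruct (HL x Hx) as [y Hy]. exists (g y).
    eapply filterlim_comp; [exact Hy|apply Hg].
  - intros x Hx. destruct (HR x Hx) as [y Hy]. exists (g y).
    eapply filterlim_comp; [exact Hy|apply Hg].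
Qed.

Lemma continuous_on_ex_RInt (f : R -> R) (a b : R) :
  a <= b -> continuous_on (fun x => a <= x <= b) f -> ex_RInt f a b.
Proof.
  intros Hab Hc. destruct (Rle_lt_or_eq_dec a b Hab) as [H|H].
  2: { rewrite H. apply ex_RInt_point. }
  apply ex_RInt_limits; auto.
  - intros x Hx.
    assert (H1 : locally x (fun y => a <= y <= b)).
    { apply (locally_interval _ x a b); simpl; try lra.
      intros y Hy1 Hy2. simpl in *. lra. }
    eapply filterlim_filter_le_1; [|apply (Hc x); lra].
    intros Q HQ. unfold within in HQ. generalize (filter_and _ _ HQ H1). apply filter_imp.
    intros y [P1 P2]. exact (P1 P2).
  - exists (f a). eapply filterlim_filter_le_1; [|apply (Hc a); lra].
    intros Q [e He]. exists (mkposreal _ (Rmin_pos _ _ (cond_pos e) (proj2 (Rlt_0_minus _ _) H))).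
    intros y Hy Hay. apply He.
    + eapply ball_le; [|exact Hy]. apply Rmin_l.
    + assert (Hb : Rabs (y - a) < b - a)
        by (eapply Rlt_le_trans; [exact Hy|apply Rmin_r]).
      apply Rabs_def2 in Hb. lra.
  - exists (f b). eapply filterlim_filter_le_1; [|apply (Hc b); lra].
    intros Q [e He]. exists (mkposreal _ (Rmin_pos _ _ (cond_pos e) (proj2 (Rlt_0_minus _ _) H))).
    intros y Hy Hay. apply He.
    + eapply ball_le; [|exact Hy]. apply Rmin_l.
    + assert (Hb : Rabs (y - b) < b - a)
        by (eapply Rlt_le_trans; [exact Hy|apply Rmin_r]).
      apply Rabs_def2 in Hb. lra.
Qed.

(** Extension by zero turns integrals over moving intervals into integrals over one fixed interval,
    so that only the integrands have to be compared. The end points are left out, so bounds on [f]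
    are needed only in the open interval. *)
Definition zero_ext (a b : R) (f : R -> R) (x : R) : R :=
  if Rlt_dec a x then if Rlt_dec x b then f x else 0 else 0.

Lemma zero_ext_in (a b : R) (f : R -> R) (x : R) : a < x < b -> zero_ext a b f x = f x.
Proof. intros H. unfold zero_ext. destruct Rlt_dec; [|lra]. destruct Rlt_dec; lra. Qed.

Lemma zero_ext_out (a b : R) (f : R -> R) (x : R) : x <= a \/ b <= x -> zero_ext a b f x = 0.
Proof. intros H. unfold zero_ext. destruct Rlt_dec; [|lra]. destruct Rlt_dec; lra. Qed.

Lemma zero_ext_bound (a b K : R) (f : R -> R) (x : R) : 0 <= K ->
  (forall x, a < x < b -> Rabs (f x) <= K) -> Rabs (zero_ext a b f x) <= K.
Proof.
  intros HK H. unfold zero_ext.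
  destruct Rlt_dec; [destruct Rlt_dec|]; try (now rewrite Rabs_R0); auto.
Qed.

Lemma is_RInt_zero_ext (A B a b : R) (f : R -> R) :
  A <= a <= b -> b <= B -> ex_RInt f a b ->
  is_RInt (zero_ext a b f) A B (RInt f a b).
Proof.
  intros H1 H2 Hf.
  assert (Z : forall x y, x <= y -> (y <= a \/ b <= x) ->
     is_RInt (zero_ext a b f) x y 0).
  { intros x y Hxy H.
    apply (is_RInt_ext (fun _ => 0)).
    - intros z. rewrite Rmin_left, Rmax_right by lra. intros Hz.
      symmetry. apply zero_ext_out. lra.
    - generalize (is_RInt_const x y (0 : R)).
      unfold scal; simpl; unfold mult; simpl. now rewrite Rmult_0_r. }
  replace (RInt f a b) with (plus (plus 0 (RInt f a b)) 0)
    by (unfold plus; simpl; ring).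
  apply (@is_RInt_Chasles R_NormedModule _ A b B);
    [apply (@is_RInt_Chasles R_NormedModule _ A a b)|].
  - apply Z; lra.
  - apply (is_RInt_ext f).
    + intros z. rewrite Rmin_left, Rmax_right by lra. intros Hz.
      symmetry. now apply zero_ext_in.
    + exact (RInt_correct f a b Hf).
  - apply Z; lra.
Qed.

Lemma RInt_diff_le (f g : R -> R) (a b M : R) : a <= b -> ex_RInt f a b -> ex_RInt g a b ->
  (forall x, a <= x <= b -> Rabs (f x - g x) <= M) ->
  Rabs (RInt f a b - RInt g a b) <= (b - a) * M.
Proof.
  intros Hab Hf Hg H.
  replace (RInt f a b - RInt g a b) with (RInt (fun x => minus (f x) (g x)) a b).
  - apply abs_RInt_le_const; auto. exact (ex_RInt_minus f g a b Hf Hg).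
  - exact (RInt_minus f g a b Hf Hg).
Qed.

(* Continuous growth plus a jump at every exceptional point: an error budget
   [eps * (growth l y - growth l x)] for the interval [x, y]. *)
Definition growth (l : list R) (y : R) : R :=
  y + fold_right (fun z s => sign (y - z) + s) 0 l.

Lemma growth_le (l : list R) (x y : R) : x <= y -> y - x <= growth l y - growth l x.
Proof.
  intros H. unfold growth. induction l as [|z l IH]; simpl.
  - lra.
  - assert (sign (x - z) <= sign (y - z)) by (apply sign_le; lra). lra.
Qed.

(** Across [z] the sign passes from a nonpositive value to [1], or from [-1] to a nonnegative one.
    Half a jump is therefore at least 1, which covers the case where [z] is an end point. *)
Lemma growth_jump (l : list R) (x y z : R) : In z l -> x < y -> x <= z <= y ->
  1 <= growth l y - growth l x.
Proof.
  intros Hin Hxy Hz. induction l as [|w l IH]; [contradiction|].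
  assert (Hs : sign (x - w) <= sign (y - w)) by (apply sign_le; lra).
  unfold growth in *; simpl.
  destruct Hin as [->|Hin].
  - pose proof (growth_le l x y (Rlt_le _ _ Hxy)) as Hg. unfold growth in Hg.
    destruct (Rle_lt_or_eq_dec x z) as [H|H]; [lra| |].
    + rewrite (sign_eq_m1 (x - z)) by lra.
      assert (0 <= sign (y - z)) by (rewrite <- sign_0; apply sign_le; lra). lra.
    + rewrite (sign_eq_1 (y - z)) by lra.
      assert (sign (x - z) <= 0) by (rewrite <- sign_0; apply sign_le; lra). lra.
  - specialize (IH Hin). lra.
Qed.

(** Convergence is uniform near every point of the open limit interval outside [l]. On the common
    interval [[A, B]], ordinary points use uniform closeness, while points of [l] and the two limit
    ends use the crude bound on a short interval. The error budget is additive, so the local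
    estimates add up. *)
Lemma RInt_dominated_moving {U : Type} (F : (U -> Prop) -> Prop) {FF : Filter F}
    (f : U -> R -> R) (f0 : R -> R) (a b : U -> R) (a0 b0 K : R) (l : list R) :
  a0 <= b0 ->
  filterlim a F (locally a0) -> filterlim b F (locally b0) ->
  F (fun p => a p <= b p /\ ex_RInt (f p) (a p) (b p) /\
       forall x, a p < x < b p -> Rabs (f p x) <= K) ->
  ex_RInt f0 a0 b0 -> (forall x, a0 < x < b0 -> Rabs (f0 x) <= K) ->
  (forall x, a0 < x < b0 -> ~ In x l -> forall eps, 0 < eps ->
     exists d, 0 < d /\
       F (fun p => forall y, a p <= y <= b p -> Rabs (y - x) < d -> Rabs (f p y - f0 y) <= eps)) ->
  filterlim (fun p => RInt (f p) (a p) (b p)) F (locally (RInt f0 a0 b0)).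
Proof.
  intros Hab Ha Hb HF Hf0 HK0 Hloc.
  pose proof (proj1 (filterlim_R F a a0) Ha) as Ha'.
  pose proof (proj1 (filterlim_R F b b0) Hb) as Hb'.
  apply filterlim_R; [exact FF|]. intros eps Heps.
  set (l' := a0 :: b0 :: l).
  set (A := a0 - 1). set (B := b0 + 1).
  set (K' := Rmax K 1).
  assert (HK' : 1 <= K' /\ K <= K') by (split; [apply Rmax_r|apply Rmax_l]).
  set (Th := growth l' B - growth l' A).
  assert (HTh : 0 < Th).
  { pose proof (growth_le l' A B). unfold Th. unfold A, B in *. lra. }
  (* The total budget over [[A, B]] is then [eps / 2], which leaves room for the strict
     inequality. *)
  set (e := eps / (2 * Th)).
  assert (He : 0 < e) by (unfold e; apply Rdiv_lt_0_compat; lra).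
  set (G := fun p => zero_ext (a p) (b p) (f p)).
  set (G0 := zero_ext a0 b0 f0).
  set (ok := fun p => A <= a p <= b p /\ b p <= B /\ ex_RInt (f p) (a p) (b p) /\
       forall x, a p < x < b p -> Rabs (f p x) <= K).
  assert (Fok : F ok).
  { generalize (filter_and _ _ (filter_and _ _ (Ha' 1 Rlt_0_1) (Hb' 1 Rlt_0_1)) HF).
    apply filter_imp. intros p [[H1 H2] [H3 [H4 H5]]].
    apply Rabs_def2 in H1. apply Rabs_def2 in H2.
    unfold ok, A, B. repeat split; auto; lra. }
  assert (IG0 : is_RInt G0 A B (RInt f0 a0 b0))
    by (apply is_RInt_zero_ext; auto; unfold A, B; lra).
  assert (IG : forall p, ok p -> is_RInt (G p) A B (RInt (f p) (a p) (b p)))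
    by (intros p [H1 [H2 [H3 _]]]; apply is_RInt_zero_ext; auto).
  assert (sub : forall g x y, A <= x <= y -> y <= B -> ex_RInt g A B -> ex_RInt (g : R -> R) x y).
  { intros g x y H1 H2 Hg. apply (ex_RInt_Chasles_2 g A x y); [lra|].
    apply (ex_RInt_Chasles_1 g A y B); [lra|exact Hg]. }
  assert (main : F (fun p => ok p ->
      Rabs (RInt (G p) A B - RInt G0 A B) <= e * (growth l' B - growth l' A))).
  { apply (interval_additive (fun x y => F (fun p => ok p ->
      Rabs (RInt (G p) x y - RInt G0 x y) <= e * (growth l' y - growth l' x)))).
    - unfold A, B; lra.
    - intros x y z H1 H2 P1 P2. generalize (filter_and _ _ P1 P2). apply filter_imp.
      intros p [Q1 Q2] Hp. specialize (Q1 Hp). specialize (Q2 Hp).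
      assert (EG : ex_RInt (G p) A B) by (eexists; apply (IG p Hp)).
      assert (EG0 : ex_RInt G0 A B) by (eexists; apply IG0).
      rewrite <- (RInt_Chasles (G p) x y z) by (apply sub; auto; lra).
      rewrite <- (RInt_Chasles G0 x y z) by (apply sub; auto; lra).
      unfold plus; simpl.
      replace (RInt (G p) x y + RInt (G p) y z - (RInt G0 x y + RInt G0 y z))
        with ((RInt (G p) x y - RInt G0 x y) + (RInt (G p) y z - RInt G0 y z)) by ring.
      eapply Rle_trans; [apply Rabs_triang|]. lra.
    - intros t Ht.
      assert (core : forall d M, 0 < d -> 0 <= M ->
        F (fun p => ok p -> forall x, t - d < x < t + d -> Rabs (G p x - G0 x) <= M) ->
        forall x y, A <= x -> y <= B -> t - d < x <= t -> t <= y < t + d ->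
        F (fun p => ok p -> Rabs (RInt (G p) x y - RInt G0 x y) <= (y - x) * M)).
      { intros d M Hd HM H x y H1 H2 H3 H4. revert H. apply filter_imp.
        intros p Hp Hok. apply RInt_diff_le; [lra| | |].
        - apply sub; try lra. eexists; apply (IG p Hok).
        - apply sub; try lra. eexists; apply IG0.
        - intros w Hw. apply Hp; auto; lra. }
      destruct (classic (In t l')) as [Hin|Hin].
      (* The interval is shorter than [e / (2 * K')], so the bound [2 * K'] on the difference
         integrates to at most [e], which the jump of [growth] at [t] pays for. The maximum with 1
         in [K'] makes the division safe. For [x = y] there is no jump, but nothing to pay
         either. *)
      + exists (e / (4 * K')). assert (Hd : 0 < e / (4 * K')) by (apply Rdiv_lt_0_compat; lra).
        split; [exact Hd|]. intros x y H1 H2 H3 H4.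
        assert (C : F (fun p => ok p -> Rabs (RInt (G p) x y - RInt G0 x y) <= (y - x) * (2 * K'))).
        { apply (core (e / (4 * K'))); auto; try lra.
          apply filter_forall. intros p Hp w _.
          unfold Rminus. eapply Rle_trans; [apply Rabs_triang|]. rewrite Rabs_Ropp.
          assert (Rabs (G p w) <= K').
          { apply zero_ext_bound; [lra|]. intros v Hv.
            apply Rle_trans with K; [|lra]. now apply Hp. }
          assert (Rabs (G0 w) <= K').
          { apply zero_ext_bound; [lra|]. intros v Hv.
            apply Rle_trans with K; [|lra]. now apply HK0. }
          lra. }
        revert C. apply filter_imp. intros p Hp Hok. specialize (Hp Hok).
        eapply Rle_trans; [exact Hp|].
        destruct (Rlt_le_dec x y) as [Hxy|Hxy].
        * assert (1 <= growth l' y - growth l' x) by (apply (growth_jump l' x y t); auto; lra).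
          assert ((y - x) * (2 * K') <= e).
          { replace e with (2 * (e / (4 * K')) * (2 * K')) by (field; lra).
            apply Rmult_le_compat_r; lra. }
          apply Rle_trans with (e * 1); [lra|]. apply Rmult_le_compat_l; lra.
        * replace y with x by lra. lra.
      + assert (Hd : exists d, 0 < d /\
          F (fun p => ok p -> forall x, t - d < x < t + d -> Rabs (G p x - G0 x) <= e)).
        { assert (ta : t <> a0) by (intro E; apply Hin; left; auto).
          assert (tb : t <> b0) by (intro E; apply Hin; right; left; auto).
          (* Off the closed limit interval both extensions vanish near [t] once the moving ends are
             close to their limits. *)
          destruct (Rlt_le_dec t a0) as [H|H]; [|destruct (Rlt_le_dec b0 t) as [H'|H']].
          - exists ((a0 - t) / 2). split; [lra|].
            assert (Hp : 0 < (a0 - t) / 2) by lra.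
            generalize (Ha' _ Hp). apply filter_imp. intros p Hp1 Hok w Hw.
            apply Rabs_def2 in Hp1. unfold G, G0. rewrite !zero_ext_out by lra.
            rewrite Rminus_0_r, Rabs_R0. lra.
          - exists ((t - b0) / 2). split; [lra|].
            assert (Hp : 0 < (t - b0) / 2) by lra.
            generalize (Hb' _ Hp). apply filter_imp. intros p Hp1 Hok w Hw.
            apply Rabs_def2 in Hp1. unfold G, G0. rewrite !zero_ext_out by lra.
            rewrite Rminus_0_r, Rabs_R0. lra.
          - destruct (Hloc t) with (eps := e) as [d [Hd Hd']]; auto; [lra| |].
            { intro E. apply Hin. right; right; exact E. }
            set (d1 := Rmin d (Rmin ((t - a0) / 2) ((b0 - t) / 2))).
            assert (Hd1 : 0 < d1) by (unfold d1; repeat apply Rmin_pos; lra).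
            assert (Hd1' : d1 <= d /\ d1 <= (t - a0) / 2 /\ d1 <= (b0 - t) / 2).
            { unfold d1. repeat split; [apply Rmin_l| |].
              - eapply Rle_trans; [apply Rmin_r|apply Rmin_l].
              - eapply Rle_trans; [apply Rmin_r|apply Rmin_r]. }
            exists d1. split; [exact Hd1|].
            generalize (filter_and _ _ Hd' (filter_and _ _ (Ha' d1 Hd1) (Hb' d1 Hd1))).
            apply filter_imp. intros p [P1 [P2 P3]] Hok w Hw.
            apply Rabs_def2 in P2. apply Rabs_def2 in P3.
            unfold G, G0. rewrite !zero_ext_in by lra. apply P1; [lra|].
            apply Rabs_def1; lra. }
        destruct Hd as [d [Hd1 Hd2]]. exists d. split; [exact Hd1|].
        intros x y H1 H2 H3 H4.
        generalize (core d e Hd1 (Rlt_le _ _ He) Hd2 x y H1 H2 H3 H4).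
        apply filter_imp. intros p Hp Hok. specialize (Hp Hok).
        eapply Rle_trans; [exact Hp|]. rewrite Rmult_comm.
        apply Rmult_le_compat_l; [lra|]. apply growth_le. lra. }
  generalize (filter_and _ _ Fok main). apply filter_imp. intros p [Hok Hp].
  specialize (Hp Hok).
  rewrite (is_RInt_unique _ _ _ _ (IG p Hok)), (is_RInt_unique _ _ _ _ IG0) in Hp.
  eapply Rle_lt_trans; [exact Hp|]. fold Th. unfold e.
  replace (eps / (2 * Th) * Th) with (eps / 2) by (field; lra). lra.
Qed.

(** * Calculus on an interval with weak information at the end points *)

(** Designed for the initial time, where only continuity from the right is available: if
    [f t > f a], then [f t > f r] for some [r] close to [a], against the mean value theorem on
    [[r, t]]. *)
Lemma nonincreasing_from (f df : R -> R) (a b : R) :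
  (forall t, a < t <= b -> is_derive f t (df t)) ->
  (forall t, a < t <= b -> df t <= 0) ->
  filterlim f (at_right a) (locally (f a)) ->
  forall t, a <= t <= b -> f t <= f a.
Proof.
  intros Hd Hn Hc t Ht.
  destruct (Rle_lt_or_eq_dec a t) as [H|H]; [lra| |rewrite H; lra].
  apply Rnot_lt_le. intro Hlt.
  set (e := (f t - f a)).
  assert (He : 0 < e) by (unfold e; lra).
  destruct (proj1 (filterlim_R _ _ _) Hc e He) as [d Hd'].
  set (r := Rmin (a + d / 2) t).
  pose proof (cond_pos d) as Hdp.
  assert (Hr : a < r <= t /\ r < a + d) by (unfold r, Rmin; destruct Rle_dec; lra).
  assert (Hfr : Rabs (f r - f a) < e).
  { apply Hd'; [|lra]. apply (Rabs_def1 (r - a)); lra. }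
  apply Rabs_def2 in Hfr.
  destruct (MVT_gen f r t df) as [x [Hx Ex]].
  - intros x. rewrite Rmin_left, Rmax_right by lra. intros Hx. apply Hd; lra.
  - intros x. rewrite Rmin_left, Rmax_right by lra. intros Hx.
    apply continuity_pt_filterlim. apply (ex_derive_continuous f x).
    eexists. apply Hd; lra.
  - rewrite Rmin_left, Rmax_right in Hx by lra.
    assert (df x * (t - r) <= 0).
    { assert (df x <= 0) by (apply Hn; lra). nra. }
    unfold e in *. lra.
Qed.

(** The integral of the squared deviation of [f] from its mean [I / (b - a)] is nonnegative. *)
Lemma RInt_cauchy_schwarz (f : R -> R) (a b : R) : a <= b -> ex_RInt f a b ->
  ex_RInt (fun x => f x ^ 2) a b -> RInt f a b ^ 2 <= (b - a) * RInt (fun x => f x ^ 2) a b.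
Proof.
  intros Hab Hf Hf2.
  destruct (Rle_lt_or_eq_dec a b Hab) as [H|H].
  2: { rewrite H, !RInt_point. unfold zero; simpl. lra. }
  set (I := RInt f a b). set (J := RInt (fun x => f x ^ 2) a b).
  assert (E : is_RInt (fun x => (f x - I / (b - a)) ^ 2) a b
     (J - 2 * (I / (b - a)) * I + (I / (b - a)) ^ 2 * (b - a))).
  { apply (is_RInt_ext (fun x => plus (minus (f x ^ 2) (scal (2 * (I / (b - a))) (f x)))
       ((I / (b - a)) ^ 2))).
    - intros x _. unfold plus, minus, scal, opp; simpl. unfold mult; simpl.
      unfold plus; simpl. ring.
    - replace (J - 2 * (I / (b - a)) * I + (I / (b - a)) ^ 2 * (b - a))
        with (plus (minus J (scal (2 * (I / (b - a))) I)) (scal (b - a) ((I / (b - a)) ^ 2)))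
        by (unfold plus, minus, scal, opp; simpl; unfold mult, plus; simpl; ring).
      apply @is_RInt_plus; [apply @is_RInt_minus|].
      + exact (RInt_correct _ _ _ Hf2).
      + apply @is_RInt_scal. exact (RInt_correct _ _ _ Hf).
      + apply @is_RInt_const. }
  assert (0 <= J - 2 * (I / (b - a)) * I + (I / (b - a)) ^ 2 * (b - a)).
  { rewrite <- (is_RInt_unique _ _ _ _ E). apply RInt_ge_0; auto.
    - eexists; apply E.
    - intros x _. apply pow2_ge_0. }
  replace (J - 2 * (I / (b - a)) * I + (I / (b - a)) ^ 2 * (b - a))
    with ((J * (b - a) - I ^ 2) / (b - a)) in H0 by (field; lra).
  apply (Rmult_le_compat_r (b - a)) in H0; [|lra].
  unfold Rdiv in H0. rewrite Rmult_assoc, Rinv_l in H0 by lra. lra.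
Qed.

Lemma RInt_eq_0_pos (f : R -> R) (a b : R) : continuous_on (fun x => a <= x <= b) f ->
  (forall x, a <= x <= b -> 0 <= f x) -> RInt f a b <= 0 ->
  forall x, a < x < b -> f x = 0.
Proof.
  intros Hc Hp H0 x Hx.
  destruct (Rle_lt_or_eq_dec 0 (f x)) as [H|H]; [apply Hp; lra| |auto].
  exfalso.
  assert (Hi : ex_RInt f a b) by (apply continuous_on_ex_RInt; auto; lra).
  assert (Hx' : a <= x <= b) by lra.
  destruct (proj1 (filterlim_R _ _ _) (Hc x Hx') (f x / 2)) as [d Hd]; [lra|].
  pose proof (cond_pos d) as Hdp.
  set (e := Rmin (d / 2) (Rmin (x - a) (b - x))).
  assert (He : 0 < e /\ e < d /\ a <= x - e /\ x + e <= b)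
    by (unfold e, Rmin; repeat destruct Rle_dec; lra).
  assert (sub : forall y z, a <= y <= z -> z <= b -> ex_RInt f y z).
  { intros y z H1 H2. apply (ex_RInt_Chasles_2 f a y z); [lra|].
    apply (ex_RInt_Chasles_1 f a z b); [lra|exact Hi]. }
  assert (E : RInt f a b = RInt f a (x - e) + RInt f (x - e) (x + e) + RInt f (x + e) b).
  { rewrite <- (RInt_Chasles f a (x + e) b), <- (RInt_Chasles f a (x - e) (x + e))
      by (apply sub; lra). reflexivity. }
  assert (0 <= RInt f a (x - e)).
  { apply RInt_ge_0; [lra|apply sub; lra|]. intros y Hy; apply Hp; lra. }
  assert (0 <= RInt f (x + e) b).
  { apply RInt_ge_0; [lra|apply sub; lra|]. intros y Hy; apply Hp; lra. }
  assert (RInt (fun _ => f x / 2) (x - e) (x + e) <= RInt f (x - e) (x + e)).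
  { apply RInt_le; [lra|apply ex_RInt_const|apply sub; lra|].
    intros y Hy.
    assert (Hy' : Rabs (f y - f x) < f x / 2).
    { apply Hd; [|lra]. apply (Rabs_def1 (y - x)); lra. }
    apply Rabs_def2 in Hy'. lra. }
  rewrite RInt_const in H3. unfold scal in H3; simpl in H3; unfold mult in H3; simpl in H3.
  assert (0 < (x + e - (x - e)) * (f x / 2)) by (apply Rmult_lt_0_compat; lra).
  lra.
Qed.

Lemma ex_RInt_bounded (f : R -> R) (a b : R) : a <= b -> ex_RInt f a b ->
  exists K, forall x, a <= x <= b -> Rabs (f x) <= K.
Proof.
  intros Hab Hf.
  destruct (ex_RInt_ub f a b Hf) as [u Hu].
  rewrite Rmin_left, Rmax_right in Hu by lra. exists u. exact Hu.
Qed.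

Lemma at_right_0_lt (e : R) : 0 < e -> at_right 0 (fun p => 0 < p < e).
Proof.
  intros He. exists (mkposreal e He). intros y Hy Hy0.
  change (Rabs (y - 0) < e) in Hy. apply Rabs_def2 in Hy. lra.
Qed.

(** The fundamental theorem of calculus holds on [[a + p, b - p]], and both sides converge as [p]
    tends to 0. The gradient at the boundary of a phase is only one-sided, hence no derivative is
    asked at the end points. *)
Lemma RInt_derive_interior (f df : R -> R) (a b : R) : a <= b ->
  continuous_on (fun x => a <= x <= b) f ->
  (forall x, a < x < b -> is_derive f x (df x)) ->
  continuous_on (fun x => a <= x <= b) df ->
  RInt df a b = f b - f a.
Proof.
  intros Hab Hf Hd Hdf.
  destruct (Rle_lt_or_eq_dec a b Hab) as [H|H].
  2: { rewrite H, RInt_point. unfold zero; simpl. lra. }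
  assert (Hi : ex_RInt df a b) by (apply continuous_on_ex_RInt; auto).
  destruct (ex_RInt_bounded df a b Hab Hi) as [K HK].
  assert (L1 : filterlim (fun p => a + p) (at_right 0) (locally a)).
  { apply filterlim_R; [apply _|]. intros e He. generalize (at_right_0_lt e He). apply filter_imp.
    intros p Hp. apply Rabs_def1; lra. }
  assert (L2 : filterlim (fun p => b - p) (at_right 0) (locally b)).
  { apply filterlim_R; [apply _|]. intros e He. generalize (at_right_0_lt e He). apply filter_imp.
    intros p Hp. apply Rabs_def1; lra. }
  assert (Hm : 0 < (b - a) / 2) by lra.
  assert (C1 : filterlim (fun p => RInt df (a + p) (b - p)) (at_right 0) (locally (RInt df a b))).
  { apply (RInt_dominated_moving (at_right 0) (fun _ => df) df (fun p => a + p) (fun p => b - p)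
      a b K nil); auto.
    - generalize (at_right_0_lt _ Hm). apply filter_imp. intros p Hp. repeat split; [lra| |].
      + apply (ex_RInt_Chasles_2 df a (a + p) (b - p)); [lra|].
        apply (ex_RInt_Chasles_1 df a (b - p) b); [lra|exact Hi].
      + intros x Hx. apply HK. lra.
    - intros x Hx. apply HK; lra.
    - intros x Hx _ e He. exists 1. split; [lra|]. apply filter_forall.
      intros p y _ _. rewrite Rminus_diag, Rabs_R0. lra. }
  assert (C2 : filterlim (fun p => RInt df (a + p) (b - p)) (at_right 0) (locally (f b - f a))).
  { apply filterlim_R; [apply _|]. intros e He.
    assert (Ha' : a <= a <= b) by lra. assert (Hb' : a <= b <= b) by lra.
    assert (He2 : 0 < e / 2) by lra.
    destruct (proj1 (filterlim_R _ _ _) (Hf a Ha') (e / 2) He2) as [d1 Hd1].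
    destruct (proj1 (filterlim_R _ _ _) (Hf b Hb') (e / 2) He2) as [d2 Hd2].
    generalize (filter_and _ _ (at_right_0_lt _ Hm)
      (filter_and _ _ (at_right_0_lt _ (cond_pos d1)) (at_right_0_lt _ (cond_pos d2)))).
    apply filter_imp. intros p [P1 [P2 P3]].
    assert (D1 : Rabs (f (a + p) - f a) < e / 2).
    { apply Hd1; [|lra]. apply (Rabs_def1 (a + p - a)); lra. }
    assert (D2 : Rabs (f (b - p) - f b) < e / 2).
    { apply Hd2; [|lra]. apply (Rabs_def1 (b - p - b)); lra. }
    rewrite (is_RInt_unique df (a + p) (b - p) (f (b - p) - f (a + p))).
    - apply Rabs_def2 in D1. apply Rabs_def2 in D2. apply Rabs_def1; lra.
    - apply (is_RInt_derive f df).
      + intros x. rewrite Rmin_left, Rmax_right by lra. intros Hx. apply Hd; lra.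
      + intros x. rewrite Rmin_left, Rmax_right by lra. intros Hx.
        assert (Hx' : a <= x <= b) by lra.
        apply (filterlim_R (locally x)). intros r Hr.
        assert (N : locally x (fun y => a <= y <= b)).
        { apply (locally_interval _ x a b); simpl; try lra.
          intros y Hy1 Hy2. simpl in *. lra. }
        generalize (filter_and _ _ N (proj1 (filterlim_R _ _ _) (Hdf x Hx') r Hr)).
        apply filter_imp. intros y [Q1 Q2]. exact (Q2 Q1). }
  exact (filterlim_locally_unique _ _ _ C1 C2).
Qed.

Lemma continuous_on_sub (f : R -> R) (a b a' b' : R) : a <= a' -> b' <= b ->
  continuous_on (fun x => a <= x <= b) f -> continuous_on (fun x => a' <= x <= b') f.
Proof.
  intros Ha Hb Hf x Hx. assert (Hx' : a <= x <= b) by lra.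
  eapply filterlim_filter_le_1; [|apply (Hf x Hx')].
  intros Q HQ. unfold within in *. revert HQ. apply filter_imp. intros y H1 H2. apply H1; lra.
Qed.

Lemma continuous_on_comp {U : UniformSpace} (g : R -> R) (f : U -> R) (D : U -> Prop) :
  (forall z, continuous g z) -> continuous_on D f -> continuous_on D (fun x => g (f x)).
Proof.
  intros Hg Hf x Hx. eapply filterlim_comp; [exact (Hf x Hx)|apply Hg].
Qed.

(** [f x - m] is the integral of [df] between [x] and an end where [f = m], so Cauchy-Schwarz
    applies. The pointwise form is kept because it also controls the temperature at the heated
    end. *)
Lemma poincare_sup (f df : R -> R) (a b m x : R) :
  continuous_on (fun x => a <= x <= b) f ->
  (forall x, a < x < b -> is_derive f x (df x)) ->
  continuous_on (fun x => a <= x <= b) df ->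
  f a = m \/ f b = m -> a <= x <= b ->
  (f x - m) ^ 2 <= (b - a) * RInt (fun y => df y ^ 2) a b.
Proof.
  intros Hf Hd Hdf Hm Hx.
  assert (Hsq : forall y z, a <= y <= z -> z <= b -> ex_RInt (fun y => df y ^ 2) y z).
  { intros y z H1 H2. apply continuous_on_ex_RInt; [lra|].
    apply (continuous_on_sub _ a b); try lra.
    apply (continuous_on_comp (fun z => z ^ 2)); auto.
    intros w. apply (ex_derive_continuous (fun z => z ^ 2)). auto_derive. auto. }
  assert (part : forall y z, a <= y <= z -> z <= b ->
     (f z - f y) ^ 2 <= (b - a) * RInt (fun y => df y ^ 2) a b).
  { intros y z H1 H2.
    assert (C : continuous_on (fun x => y <= x <= z) df)
      by (apply (continuous_on_sub _ a b); auto; lra).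
    rewrite <- (RInt_derive_interior f df y z); auto; try lra.
    - eapply Rle_trans; [apply RInt_cauchy_schwarz; try lra|].
      + apply continuous_on_ex_RInt; auto; lra.
      + apply Hsq; lra.
      + assert (P : forall u v, a <= u <= v -> v <= b -> 0 <= RInt (fun y => df y ^ 2) u v).
        { intros u v Hu Hv. apply RInt_ge_0; [lra|now apply Hsq|]. intros; apply pow2_ge_0. }
        assert (RInt (fun y => df y ^ 2) a b =
          RInt (fun y => df y ^ 2) a y + RInt (fun y => df y ^ 2) y z + RInt (fun y => df y ^ 2) z b).
        { rewrite <- (RInt_Chasles (fun y => df y ^ 2) a z b),
            <- (RInt_Chasles (fun y => df y ^ 2) a y z) by (apply Hsq; lra). reflexivity. }
        assert (0 <= RInt (fun y => df y ^ 2) a y) by (apply P; lra).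
        assert (0 <= RInt (fun y => df y ^ 2) y z) by (apply P; lra).
        assert (0 <= RInt (fun y => df y ^ 2) z b) by (apply P; lra).
        apply Rle_trans with ((b - a) * RInt (fun y => df y ^ 2) y z);
          [apply Rmult_le_compat_r; lra|apply Rmult_le_compat_l; lra].
    - apply (continuous_on_sub _ a b); auto; lra.
    - intros w Hw. apply Hd; lra. }
  destruct Hm as [<-|<-].
  - apply part; lra.
  - replace ((f x - f b) ^ 2) with ((f b - f x) ^ 2) by ring. apply part; lra.
Qed.

(** * Functions on a space-time strip *)

Lemma filterlim_Rplus {U : Type} (F : (U -> Prop) -> Prop) {FF : Filter F} (f g : U -> R) (l m : R) :
  filterlim f F (locally l) -> filterlim g F (locally m) ->
  filterlim (fun p => f p + g p) F (locally (l + m)).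
Proof.
  intros Hf Hg.
  exact (filterlim_comp_2 f g plus Hf Hg (filterlim_plus (V := R_NormedModule) l m)).
Qed.

Lemma filterlim_Rmult {U : Type} (F : (U -> Prop) -> Prop) {FF : Filter F} (f g : U -> R) (l m : R) :
  filterlim f F (locally l) -> filterlim g F (locally m) ->
  filterlim (fun p => f p * g p) F (locally (l * m)).
Proof.
  intros Hf Hg.
  exact (filterlim_comp_2 f g mult Hf Hg (filterlim_mult (K := R_AbsRing) l m)).
Qed.

Lemma filterlim_Ropp {U : Type} (F : (U -> Prop) -> Prop) {FF : Filter F} (f : U -> R) (l : R) :
  filterlim f F (locally l) -> filterlim (fun p => - f p) F (locally (- l)).
Proof.
  intros Hf. exact (filterlim_comp _ _ _ f opp F _ _ Hf (filterlim_opp (V := R_NormedModule) l)).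
Qed.

Lemma filterlim_Rminus {U : Type} (F : (U -> Prop) -> Prop) {FF : Filter F} (f g : U -> R) (l m : R) :
  filterlim f F (locally l) -> filterlim g F (locally m) ->
  filterlim (fun p => f p - g p) F (locally (l - m)).
Proof.
  intros Hf Hg. apply filterlim_Rplus; auto. now apply filterlim_Ropp.
Qed.

Lemma filterlim_le_const {U : Type} (F : (U -> Prop) -> Prop) {FF : ProperFilter F} (f : U -> R) (l K : R) :
  filterlim f F (locally l) -> F (fun p => f p <= K) -> l <= K.
Proof.
  intros Hf HK. apply Rnot_lt_le. intro H.
  assert (He : 0 < l - K) by lra.
  destruct (filter_ex _ (filter_and _ _ HK (proj1 (filterlim_R F f l) Hf _ He))) as [p [P1 P2]].
  apply Rabs_def2 in P2. lra.
Qed.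

Lemma continuous_on_mult {U : UniformSpace} (D : U -> Prop) (f g : U -> R) :
  continuous_on D f -> continuous_on D g -> continuous_on D (fun p => f p * g p).
Proof. intros Hf Hg p Hp. apply filterlim_Rmult; [apply _|apply Hf|apply Hg]; exact Hp. Qed.

Lemma pos_times_open (tau : Rbar) (t : R) : pos_times tau t ->
  exists d, 0 < d /\ forall r, Rabs (r - t) < d -> pos_times tau r.
Proof.
  intros [H0 H]. destruct tau as [u| |]; simpl in H; try contradiction.
  - exists (Rmin t (u - t)). split; [apply Rmin_pos; lra|].
    intros r Hr. pose proof (Rmin_l t (u - t)). pose proof (Rmin_r t (u - t)).
    apply Rabs_def2 in Hr. split; simpl; lra.
  - exists t. split; [lra|]. intros r Hr. apply Rabs_def2 in Hr. split; simpl; auto; lra.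
Qed.

Lemma nonneg_times_right (tau : Rbar) (t : R) : nonneg_times tau t ->
  exists t1, t < t1 /\ nonneg_times tau t1.
Proof.
  intros [H0 H]. destruct tau as [u| |]; simpl in H; try contradiction.
  - exists ((t + u) / 2). split; [lra|]. split; simpl; lra.
  - exists (t + 1). split; [lra|]. split; simpl; auto; lra.
Qed.

Lemma nonneg_times_le (tau : Rbar) (t r : R) : nonneg_times tau t -> 0 <= r <= t -> nonneg_times tau r.
Proof.
  intros [H0 H] Hr. split; [lra|]. eapply Rbar_le_lt_trans; [|exact H]. simpl; lra.
Qed.

Lemma pos_times_nonneg (tau : Rbar) (t : R) : pos_times tau t -> nonneg_times tau t.
Proof. intros [H0 H]. split; auto; lra. Qed.

Lemma locally_Rabs (t : R) (Q : R -> Prop) (d : R) : 0 < d ->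
  (forall r, Rabs (r - t) < d -> Q r) -> locally t Q.
Proof. intros Hd H. exists (mkposreal d Hd). exact H. Qed.

Section Region.
Context (tau : Rbar) (a b : R -> R).
Notation strip := (region (pos_times tau) a b).
Notation open_strip := (open_region (pos_times tau) a b).

Lemma strip_joint (h : R * R -> R) (x t eps : R) : continuous_on strip h ->
  pos_times tau t -> a t <= x <= b t -> 0 < eps ->
  exists d, 0 < d /\ forall y r, Rabs (y - x) < d -> Rabs (r - t) < d -> a r <= y <= b r ->
    Rabs (h (y, r) - h (x, t)) < eps.
Proof.
  intros Hh Ht Hx He.
  destruct (proj1 (filterlim_R _ _ _) (Hh (x, t) (conj Ht Hx)) eps He) as [d Hd].
  destruct (pos_times_open tau t Ht) as [d' [Hd' Hd'']].
  pose proof (cond_pos d).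
  exists (Rmin d d'). split; [apply Rmin_pos; auto|].
  intros y r Hy Hr Hyr. apply Hd.
  - split; simpl.
    + apply (Rlt_le_trans _ _ _ Hy), Rmin_l.
    + apply (Rlt_le_trans _ _ _ Hr), Rmin_l.
  - split; simpl; auto. apply Hd''. apply (Rlt_le_trans _ _ _ Hr), Rmin_r.
Qed.

Lemma strip_slice (h : R * R -> R) (t : R) : continuous_on strip h -> pos_times tau t ->
  continuous_on (fun x => a t <= x <= b t) (fun x => h (x, t)).
Proof.
  intros Hh Ht x Hx. apply filterlim_R; [apply _|]. intros e He.
  destruct (strip_joint h x t e Hh Ht Hx He) as [d [Hd Hd']].
  exists (mkposreal d Hd). intros y Hy Hyr. apply Hd'; auto.
  rewrite Rminus_diag, Rabs_R0. exact Hd.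
Qed.

(** Joint continuity bounds [h] near each point of the slice at time [t]; the local bounds are glued
    along the slice by [interval_additive]. *)
Lemma strip_bounded (h : R * R -> R) (t : R) : continuous_on strip h -> pos_times tau t ->
  a t <= b t -> continuous a t -> continuous b t ->
  exists K, locally t (fun r : R => forall y : R, a r <= y <= b r -> Rabs (h (y, r)) <= K).
Proof.
  intros Hh Ht Hab Ha Hb.
  pose proof (proj1 (filterlim_R _ _ _) Ha) as Ha'.
  pose proof (proj1 (filterlim_R _ _ _) Hb) as Hb'.
  (* Slices at nearby times may stick out of [[a t, b t]], so a margin of 1 is covered too. Near a
     point off [[a t, b t]] the nearby slices are empty, and any bound does. *)
  assert (M : exists K, locally t (fun r : R => forall y : R, a t - 1 <= y <= b t + 1 ->
     a r <= y <= b r -> Rabs (h (y, r)) <= K)).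
  { apply (interval_additive (fun u v => exists K, locally t (fun r : R => forall y : R, u <= y <= v ->
     a r <= y <= b r -> Rabs (h (y, r)) <= K))); [lra| |].
    - intros x y z _ _ [K1 H1] [K2 H2]. exists (Rmax K1 K2).
      generalize (filter_and _ _ H1 H2). apply filter_imp. intros r [Q1 Q2] w Hw Hw'.
      destruct (Rle_lt_dec w y).
      + eapply Rle_trans; [apply Q1; auto; lra|apply Rmax_l].
      + eapply Rle_trans; [apply Q2; auto; lra|apply Rmax_r].
    - intros x Hx.
      destruct (Rlt_le_dec x (a t)) as [H|H]; [|destruct (Rlt_le_dec (b t) x) as [H'|H']].
      + exists ((a t - x) / 2). split; [lra|]. intros u v _ _ Hu Hv. exists 0.
        assert (Hp : 0 < (a t - x) / 2) by lra.
        generalize (Ha' _ Hp). apply filter_imp. intros r Hr y Hy Hy'.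
        apply Rabs_def2 in Hr. lra.
      + exists ((x - b t) / 2). split; [lra|]. intros u v _ _ Hu Hv. exists 0.
        assert (Hp : 0 < (x - b t) / 2) by lra.
        generalize (Hb' _ Hp). apply filter_imp. intros r Hr y Hy Hy'.
        apply Rabs_def2 in Hr. lra.
      + destruct (strip_joint h x t 1 Hh Ht) as [d [Hd Hd']]; try lra.
        exists d. split; [exact Hd|]. intros u v _ _ Hu Hv. exists (Rabs (h (x, t)) + 1).
        apply (locally_Rabs t _ d Hd). intros r Hr y Hy Hy'.
        assert (B1 : Rabs (h (y, r) - h (x, t)) < 1).
        { apply Hd'; auto. apply Rabs_def1; lra. }
        pose proof (Rabs_triang_inv (h (y, r)) (h (x, t))). lra. }
  destruct M as [K HK]. exists K.
  generalize (filter_and _ _ HK (filter_and _ _ (Ha' 1 Rlt_0_1) (Hb' 1 Rlt_0_1))).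
  apply filter_imp. intros r [Q1 [Q2 Q3]] y Hy.
  apply Rabs_def2 in Q2. apply Rabs_def2 in Q3. apply Q1; auto; lra.
Qed.

Lemma strip_lim {U : Type} (F : (U -> Prop) -> Prop) {FF : Filter F} (h : R * R -> R)
    (X S : U -> R) (x t : R) :
  continuous_on strip h -> pos_times tau t -> a t <= x <= b t ->
  filterlim X F (locally x) -> filterlim S F (locally t) ->
  F (fun p => a (S p) <= X p <= b (S p)) ->
  filterlim (fun p => h (X p, S p)) F (locally (h (x, t))).
Proof.
  intros Hh Ht Hx HX HS HF. apply filterlim_R; [apply _|]. intros e He.
  destruct (strip_joint h x t e Hh Ht Hx He) as [d [Hd Hd']].
  generalize (filter_and _ _ HF (filter_and _ _ (proj1 (filterlim_R _ _ _) HX d Hd)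
    (proj1 (filterlim_R _ _ _) HS d Hd))).
  apply filter_imp. intros p [Q1 [Q2 Q3]]. now apply Hd'.
Qed.

(** The interval [[A p, B p]] may be shorter than the slice at time [S p]: this serves both to
    remove a truncation at a fixed time and to let margin and time vary together. *)
Lemma strip_RInt_lim {U : Type} (F : (U -> Prop) -> Prop) {FF : Filter F} (h : R * R -> R)
    (A B S : U -> R) (t : R) :
  continuous_on strip h -> pos_times tau t -> a t <= b t -> continuous a t -> continuous b t ->
  filterlim A F (locally (a t)) -> filterlim B F (locally (b t)) -> filterlim S F (locally t) ->
  F (fun p => a (S p) <= A p <= B p /\ B p <= b (S p)) ->
  filterlim (fun p => RInt (fun x => h (x, S p)) (A p) (B p)) F
    (locally (RInt (fun x => h (x, t)) (a t) (b t))).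
Proof.
  intros Hh Ht Hab Ha Hb HA HB HS HF.
  destruct (strip_bounded h t Hh Ht Hab Ha Hb) as [K HK].
  destruct (pos_times_open tau t Ht) as [d0 [Hd0 Hpos]].
  apply (RInt_dominated_moving F (fun p x => h (x, S p)) (fun x => h (x, t)) A B (a t) (b t) K nil);
    auto.
  - pose proof (HS _ HK) as HSK. unfold filtermap in HSK.
    generalize (filter_and _ _ HF (filter_and _ _ HSK (proj1 (filterlim_R _ _ _) HS d0 Hd0))).
    apply filter_imp. intros p [Q1 [Q2 Q3]]. split; [lra|split].
    + apply continuous_on_ex_RInt; [lra|].
      apply (continuous_on_sub _ (a (S p)) (b (S p))); try lra.
      apply strip_slice; auto.
    + intros x Hx. apply Q2. lra.
  - apply continuous_on_ex_RInt; auto. now apply strip_slice.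
  - intros x Hx. apply (locally_singleton _ _ HK). lra.
  - intros x Hx _ e He.
    assert (He2 : 0 < e / 2) by lra. assert (Hx' : a t <= x <= b t) by lra.
    destruct (strip_joint h x t (e / 2) Hh Ht Hx' He2) as [d [Hd Hd']].
    exists (Rmin d (Rmin (x - a t) (b t - x))).
    split; [repeat apply Rmin_pos; lra|].
    generalize (filter_and _ _ HF (proj1 (filterlim_R _ _ _) HS d Hd)).
    apply filter_imp. intros p [Q1 Q2] y Hy Hyx.
    assert (Hm : Rabs (y - x) < d /\ a t <= y <= b t).
    { pose proof (Rmin_l d (Rmin (x - a t) (b t - x))).
      pose proof (Rmin_r d (Rmin (x - a t) (b t - x))).
      pose proof (Rmin_l (x - a t) (b t - x)). pose proof (Rmin_r (x - a t) (b t - x)).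
      split; [lra|]. apply Rabs_def2 in Hyx. lra. }
    assert (B1 : Rabs (h (y, S p) - h (x, t)) < e / 2) by (apply Hd'; lra).
    assert (B2 : Rabs (h (y, t) - h (x, t)) < e / 2).
    { apply Hd'; try lra. rewrite Rminus_diag, Rabs_R0. exact Hd. }
    apply Rabs_def2 in B1. apply Rabs_def2 in B2. apply Rabs_le. lra.
Qed.

Lemma open_strip_of_strip (h : R * R -> R) : continuous_on strip h -> continuous_on open_strip h.
Proof.
  intros Hh p [Hp1 Hp2].
  assert (Hp : strip p) by (split; auto; lra).
  eapply filterlim_filter_le_1; [|apply (Hh p Hp)].
  intros Q HQ. unfold within in *. revert HQ. apply filter_imp.
  intros q HQ [H1 H2]. apply HQ. split; auto; lra.
Qed.

(** Time comes first here, the order in which the Leibniz rule for parametric integrals expects its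
    two variables. *)
Lemma open_strip_open (x t : R) : open_strip (x, t) -> continuous a t -> continuous b t ->
  locally_2d (fun r y => open_strip (y, r)) t x.
Proof.
  intros [Ht Hx] Ha Hb. simpl in *.
  destruct (pos_times_open tau t Ht) as [d0 [Hd0 Hpos]].
  set (m := Rmin ((x - a t) / 2) ((b t - x) / 2)).
  assert (Hm : 0 < m) by (apply Rmin_pos; lra).
  pose proof (Rmin_l ((x - a t) / 2) ((b t - x) / 2)) as M1. fold m in M1.
  pose proof (Rmin_r ((x - a t) / 2) ((b t - x) / 2)) as M2. fold m in M2.
  clearbody m.
  destruct (proj1 (filterlim_R _ _ _) Ha m Hm) as [d1 H1].
  destruct (proj1 (filterlim_R _ _ _) Hb m Hm) as [d2 H2].
  pose proof (cond_pos d1). pose proof (cond_pos d2).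
  assert (Hp : 0 < Rmin (Rmin d0 m) (Rmin d1 d2)) by (repeat apply Rmin_pos; auto).
  exists (mkposreal _ Hp). simpl. intros r y Hr Hy.
  pose proof (Rmin_l (Rmin d0 m) (Rmin d1 d2)). pose proof (Rmin_r (Rmin d0 m) (Rmin d1 d2)).
  pose proof (Rmin_l d0 m). pose proof (Rmin_r d0 m).
  pose proof (Rmin_l d1 d2). pose proof (Rmin_r d1 d2).
  split; simpl.
  - apply Hpos. lra.
  - assert (A1 : Rabs (a r - a t) < m) by (apply H1; change (Rabs (r - t) < d1); lra).
    assert (A2 : Rabs (b r - b t) < m) by (apply H2; change (Rabs (r - t) < d2); lra).
    apply Rabs_def2 in A1. apply Rabs_def2 in A2.
    assert (A3 : Rabs (y - x) < m) by lra. apply Rabs_def2 in A3. lra.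
Qed.

Lemma open_strip_2d (h : R * R -> R) (x t : R) : continuous_on open_strip h ->
  open_strip (x, t) -> continuous a t -> continuous b t ->
  continuity_2d_pt (fun r y => h (y, r)) t x.
Proof.
  intros Hh Hx Ha Hb eps.
  destruct (open_strip_open x t Hx Ha Hb) as [d Hd].
  destruct (proj1 (filterlim_R _ _ _) (Hh (x, t) Hx) eps (cond_pos eps)) as [d' Hd'].
  exists (mkposreal _ (Rmin_stable_in_posreal d d')). simpl. intros r y Hr Hy.
  apply Hd'.
  - split; simpl.
    + apply (Rlt_le_trans _ _ _ Hy), Rmin_r.
    + apply (Rlt_le_trans _ _ _ Hr), Rmin_r.
  - apply Hd.
    + apply (Rlt_le_trans _ _ _ Hr), Rmin_l.
    + apply (Rlt_le_trans _ _ _ Hy), Rmin_l.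
Qed.

Lemma open_strip_slice (h : R * R -> R) (x t : R) : continuous_on open_strip h ->
  open_strip (x, t) -> continuous a t -> continuous b t -> continuous (fun y => h (y, t)) x.
Proof.
  intros Hh Hx Ha Hb. apply (filterlim_R (locally x)). intros e He.
  destruct (open_strip_2d h x t Hh Hx Ha Hb (mkposreal e He)) as [d Hd].
  exists d. intros y Hy. apply Hd; [|exact Hy].
  rewrite Rminus_diag, Rabs_R0. apply cond_pos.
Qed.

End Region.

(** * Energy identity for the heat equation *)

Section Heat.
Context (alpha : R) (tau : Rbar) (a b : R -> R) (T0 : R -> R) (T Tx : R -> R -> R)
  (HT : classical_heat alpha tau a b T0 T Tx).
Notation strip := (region (pos_times tau) a b).
Notation open_strip := (open_region (pos_times tau) a b).

Lemma heat_slice (t : R) : pos_times tau t -> continuous_on (fun x => a t <= x <= b t) (fun x => T x t).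
Proof. intros Ht. exact (strip_slice tau a b _ t (heat_cont _ _ _ _ _ _ _ HT) Ht). Qed.

Lemma heat_grad_slice (t : R) : pos_times tau t ->
  continuous_on (fun x => a t <= x <= b t) (fun x => Tx x t).
Proof. intros Ht. exact (strip_slice tau a b _ t (heat_cont_grad _ _ _ _ _ _ _ HT) Ht). Qed.

Lemma heat_is_derive_x (x t : R) : open_strip (x, t) -> is_derive (fun y => T y t) x (Tx x t).
Proof.
  intros [Ht Hx]. simpl in *.
  assert (Hp : strip (x, t)) by (split; simpl; auto; lra).
  pose proof (proj1 (filterlim_R _ _ _) (heat_grad _ _ _ _ _ _ _ HT x t Hp)) as HG.
  apply is_derive_Reals. intros e He.
  destruct (HG e He) as [d Hd].
  assert (Hm : 0 < Rmin d (Rmin (x - a t) (b t - x))).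
  { repeat apply Rmin_pos; try lra. apply cond_pos. }
  exists (mkposreal _ Hm). simpl. intros h Hh0 Hh.
  pose proof (Rmin_l d (Rmin (x - a t) (b t - x))).
  pose proof (Rmin_r d (Rmin (x - a t) (b t - x))).
  pose proof (Rmin_l (x - a t) (b t - x)). pose proof (Rmin_r (x - a t) (b t - x)).
  assert (Q : Rabs ((T (x + h) t - T x t) / (x + h - x) - Tx x t) < e).
  { apply Hd.
    - change (Rabs (x + h - x) < d). replace (x + h - x) with h by ring. lra.
    - intro E. lra.
    - assert (Rabs h < Rmin (x - a t) (b t - x)) by lra.
      assert (H4 : Rabs h < x - a t) by lra. assert (H5 : Rabs h < b t - x) by lra.
      apply Rabs_def2 in H4. apply Rabs_def2 in H5. lra. }
  replace (x + h - x) with h in Q by ring. exact Q.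
Qed.

Lemma open_strip_slice_locally (x t : R) : open_strip (x, t) -> locally x (fun y => open_strip (y, t)).
Proof.
  intros [Ht Hx]. simpl in *. apply (locally_interval _ x (a t) (b t)); simpl; try lra.
  intros y H1 H2. split; simpl in *; auto; lra.
Qed.

Lemma heat_is_derive_xx (x t : R) : open_strip (x, t) ->
  is_derive (fun y => Tx y t) x (Derive_n (fun y => T y t) 2 x).
Proof.
  intros Hx. destruct (heat_eq _ _ _ _ _ _ _ HT x t Hx) as [_ [H2 _]].
  apply (is_derive_ext_loc (Derive (fun y => T y t))).
  - generalize (open_strip_slice_locally x t Hx). apply filter_imp. intros y Hy.
    apply is_derive_unique. now apply heat_is_derive_x.
  - apply Derive_correct. exact H2.
Qed.

Context (phi phi1 phi2 : R -> R)
  (Hphi : forall z, is_derive phi z (phi1 z)) (Hphi1 : forall z, is_derive phi1 z (phi2 z))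
  (Hphi2 : forall z, continuous phi2 z).

Lemma phi_continuous (z : R) : continuous phi z.
Proof. apply (ex_derive_continuous phi). eexists. apply Hphi. Qed.

Lemma phi1_continuous (z : R) : continuous phi1 z.
Proof. apply (ex_derive_continuous phi1). eexists. apply Hphi1. Qed.

Let hphi := fun p : R * R => phi (T (fst p) (snd p)).
Let hflux := fun p : R * R => phi1 (T (fst p) (snd p)) * Tx (fst p) (snd p).
Let hdiss := fun p : R * R => phi2 (T (fst p) (snd p)) * Tx (fst p) (snd p) ^ 2.

Lemma hphi_cont : continuous_on strip hphi.
Proof. apply (continuous_on_comp phi); [apply phi_continuous|apply (heat_cont _ _ _ _ _ _ _ HT)]. Qed.

Lemma hflux_cont : continuous_on strip hflux.
Proof.
  apply continuous_on_mult; [|apply (heat_cont_grad _ _ _ _ _ _ _ HT)].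
  apply (continuous_on_comp phi1); [apply phi1_continuous|apply (heat_cont _ _ _ _ _ _ _ HT)].
Qed.

Lemma hdiss_cont : continuous_on strip hdiss.
Proof.
  apply continuous_on_mult.
  - apply (continuous_on_comp phi2); [apply Hphi2|apply (heat_cont _ _ _ _ _ _ _ HT)].
  - apply (continuous_on_comp (fun z => z ^ 2)); [|apply (heat_cont_grad _ _ _ _ _ _ _ HT)].
    intros w. apply (ex_derive_continuous (fun z => z ^ 2)). auto_derive. auto.
Qed.

Lemma phi_T_derive_t (x t : R) : open_strip (x, t) ->
  is_derive (fun r => phi (T x r)) t (phi1 (T x t) * Derive (fun r => T x r) t).
Proof.
  intros Hx. destruct (heat_eq _ _ _ _ _ _ _ HT x t Hx) as [H1 _].
  rewrite Rmult_comm.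
  apply (is_derive_comp phi (fun r => T x r)); [apply Hphi|].
  now apply Derive_correct.
Qed.

(** The space derivative of [phi1(T) T_x] is [phi2(T) T_x^2 + phi1(T) T_xx], and
    [alpha phi1(T) T_xx] is the time derivative of [phi(T)]. The ends [y], [z] stay strictly inside
    the phase, since [T_xx] is continuous only there. *)
Lemma RInt_phi_T_t (t y z : R) : pos_times tau t -> continuous a t -> continuous b t ->
  a t < y -> y <= z -> z < b t ->
  RInt (fun x => Derive (fun r => phi (T x r)) t) y z =
  alpha * (hflux (z, t) - hflux (y, t)) - alpha * RInt (fun x => hdiss (x, t)) y z.
Proof.
  intros Ht Ha Hb Hy Hyz Hz.
  assert (Hin : forall x, y <= x <= z -> open_strip (x, t)) by (intros x Hx; split; simpl; auto; lra).
  set (G := fun x => phi1 (T x t) * Derive_n (fun w => T w t) 2 x).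
  assert (CG : forall x, y <= x <= z -> continuous G x).
  { intros x Hx.
    apply (open_strip_slice tau a b
      (fun p => phi1 (T (fst p) (snd p)) * Derive_n (fun w => T w (snd p)) 2 (fst p))); auto.
    apply continuous_on_mult; [|apply (heat_cont_xx _ _ _ _ _ _ _ HT)].
    apply (continuous_on_comp phi1); [apply phi1_continuous|].
    apply open_strip_of_strip, (heat_cont _ _ _ _ _ _ _ HT). }
  assert (CD : forall x, y <= x <= z -> continuous (fun x => hdiss (x, t)) x).
  { intros x Hx. apply (open_strip_slice tau a b); auto.
    apply open_strip_of_strip, hdiss_cont. }
  assert (I1 : is_RInt (fun x => plus (hdiss (x, t)) (G x)) y z
            (minus (hflux (z, t)) (hflux (y, t)))).
  { apply (is_RInt_derive (fun x => hflux (x, t))).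
    - intros x. rewrite Rmin_left, Rmax_right by lra. intros Hx.
      replace (plus (hdiss (x, t)) (G x))
        with (plus (mult (Tx x t * phi2 (T x t)) (Tx x t))
               (mult (phi1 (T x t)) (Derive_n (fun w => T w t) 2 x))).
      + apply (is_derive_mult (fun x => phi1 (T x t)) (fun x => Tx x t)).
        * apply (is_derive_comp phi1 (fun x => T x t)); [apply Hphi1|].
          apply heat_is_derive_x; auto.
        * apply heat_is_derive_xx; auto.
        * intros; apply Rmult_comm.
      + unfold hdiss, G, plus, mult; simpl. ring.
    - intros x. rewrite Rmin_left, Rmax_right by lra. intros Hx.
      apply @continuous_plus; [apply CD|apply CG]; auto. }
  assert (I2 : is_RInt (fun x => hdiss (x, t)) y z (RInt (fun x => hdiss (x, t)) y z)).
  { apply @RInt_correct, @ex_RInt_continuous. intros x.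
    rewrite Rmin_left, Rmax_right by lra. apply CD. }
  apply is_RInt_unique.
  apply (is_RInt_ext (fun x => scal alpha (minus (plus (hdiss (x, t)) (G x)) (hdiss (x, t))))).
  - intros x. rewrite Rmin_left, Rmax_right by lra. intros Hx.
    assert (Ho : open_strip (x, t)) by (apply Hin; lra).
    pose proof (is_derive_unique _ _ _ (phi_T_derive_t x t Ho)) as E.
    destruct (heat_eq _ _ _ _ _ _ _ HT x t Ho) as [_ [_ E2]]. rewrite E2 in E.
    transitivity (phi1 (T x t) * (alpha * Derive_n (fun y => T y t) 2 x)); [|now rewrite <- E].
    unfold G, scal, minus, plus, opp; simpl; unfold mult; simpl. ring.
  - replace (alpha * (hflux (z, t) - hflux (y, t)) - alpha * RInt (fun x => hdiss (x, t)) y z)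
      with (scal alpha (minus (minus (hflux (z, t)) (hflux (y, t))) (RInt (fun x => hdiss (x, t)) y z)))
      by (unfold scal, minus, plus, opp; simpl; unfold mult; simpl; ring).
    apply @is_RInt_scal, @is_RInt_minus; auto.
Qed.

(** The time derivative of the energy over [[a t + d, b t - d]], already integrated by parts: only
    [T] and [T_x] are left, and both are continuous up to the boundary, so [d] can tend to 0. *)
Let rate (d t : R) :=
  Derive b t * hphi (b t - d, t) - Derive a t * hphi (a t + d, t)
  + alpha * (hflux (b t - d, t) - hflux (a t + d, t))
  - alpha * RInt (fun x => hdiss (x, t)) (a t + d) (b t - d).

(** The margin [d] keeps the interval of integration, at all nearby times, inside the open region,
    where the Leibniz rule with moving ends applies. *)
Lemma truncated_energy_derive (d t : R) : pos_times tau t -> 0 < d -> a t + d < b t - d ->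
  locally t (ex_derive a) -> locally t (ex_derive b) ->
  is_derive (fun r => RInt (fun x => phi (T x r)) (a r + d) (b r - d)) t (rate d t).
Proof.
  intros Ht Hd Hab Hla Hlb.
  pose proof (locally_singleton _ _ Hla) as Hda. pose proof (locally_singleton _ _ Hlb) as Hdb.
  assert (Ha : continuous a t) by (apply (ex_derive_continuous a t Hda)).
  assert (Hb : continuous b t) by (apply (ex_derive_continuous b t Hdb)).
  assert (Hin : forall x, a t + d <= x <= b t - d -> open_strip (x, t))
    by (intros x Hx; split; simpl; auto; lra).
  (* Half of the margin remains as room: the Leibniz rule wants the integrand on a neighbourhood of
     each end. *)
  assert (Hd2 : 0 < d / 2) by lra.
  assert (Hloc : locally t (fun r : R => forall x : R, a t + d - d / 2 <= x <= b t - d + d / 2 ->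
     open_strip (x, r))).
  { destruct (pos_times_open tau t Ht) as [d0 [Hd0 Hpos]].
    generalize (filter_and _ _ (locally_Rabs t _ d0 Hd0 Hpos)
      (filter_and _ _ (proj1 (filterlim_R _ _ _) Ha _ Hd2) (proj1 (filterlim_R _ _ _) Hb _ Hd2))).
    apply filter_imp. intros r [Q1 [Q2 Q3]] x Hx.
    apply Rabs_def2 in Q2. apply Rabs_def2 in Q3. split; simpl; auto; lra. }
  assert (Hex : forall y z, a t + d - d / 2 <= y -> y <= z -> z <= b t - d + d / 2 ->
     locally t (fun r : R => ex_RInt (fun x => phi (T x r)) y z)).
  { intros y z Hy Hyz Hz. revert Hloc. apply filter_imp. intros r Hr.
    destruct (Hr y) as [P1 P2]; [lra|]. destruct (Hr z) as [P3 P4]; [lra|]. simpl in *.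
    apply continuous_on_ex_RInt; [lra|].
    apply (continuous_on_sub _ (a r) (b r)); try lra.
    exact (strip_slice tau a b _ r hphi_cont P1). }
  assert (C2 : forall x r, open_strip (x, r) -> continuous a r -> continuous b r ->
     continuity_2d_pt (fun u v => Derive (fun w => phi (T v w)) u) r x).
  { intros x r Hx Har Hbr.
    apply (continuity_2d_pt_ext_loc
      (fun u v => phi1 (T v u) * Derive (fun w => T v w) u)).
    - destruct (open_strip_open tau a b x r Hx Har Hbr) as [e He].
      exists e. intros u v Hu Hv. symmetry. apply is_derive_unique, phi_T_derive_t. now apply He.
    - apply (open_strip_2d tau a b
        (fun p => phi1 (T (fst p) (snd p)) * Derive (fun w => T (fst p) w) (snd p))); auto.
      apply continuous_on_mult; [|apply (heat_cont_t _ _ _ _ _ _ _ HT)].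
      apply (continuous_on_comp phi1); [apply phi1_continuous|].
      apply open_strip_of_strip, (heat_cont _ _ _ _ _ _ _ HT). }
  assert (C3 : forall x, open_strip (x, t) -> locally_2d (fun r y =>
     continuity_2d_pt (fun u v => Derive (fun w => phi (T v w)) u) r y) t x).
  { intros x Hx. destruct (open_strip_open tau a b x t Hx Ha Hb) as [e He].
    destruct (filter_and _ _ Hla Hlb) as [e' He'].
    exists (mkposreal _ (Rmin_stable_in_posreal e e')). simpl. intros r y Hr Hy.
    assert (Hr1 : Rabs (r - t) < e) by (apply (Rlt_le_trans _ _ _ Hr), Rmin_l).
    assert (Hy1 : Rabs (y - x) < e) by (apply (Rlt_le_trans _ _ _ Hy), Rmin_l).
    assert (Hr2 : Rabs (r - t) < e') by (apply (Rlt_le_trans _ _ _ Hr), Rmin_r).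
    destruct (He' r Hr2) as [A1 A2].
    apply C2; [now apply He| |].
    - now apply (ex_derive_continuous a r).
    - now apply (ex_derive_continuous b r). }
  replace (rate d t) with
    (RInt (fun x => Derive (fun r => phi (T x r)) t) (a t + d) (b t - d)
     + - phi (T (a t + d) t) * Derive a t + phi (T (b t - d) t) * Derive b t).
  2: { rewrite RInt_phi_T_t by (auto; lra). unfold rate, hphi; simpl. ring. }
  apply (is_derive_RInt_param_bound_comp (fun r x => phi (T x r)) (fun r => a r + d) (fun r => b r - d)).
  all: cbv beta.
  - apply Hex; lra.
  - exists (mkposreal _ Hd2). simpl. apply Hex; lra.
  - exists (mkposreal _ Hd2). simpl. apply Hex; lra.
  - apply Derive_correct in Hda.
    evar_last; [apply @is_derive_plus; [exact Hda|apply @is_derive_const]|apply Rplus_0_r].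
  - apply Derive_correct in Hdb.
    evar_last; [apply @is_derive_minus; [exact Hdb|apply @is_derive_const]|apply Rminus_0_r].
  - exists (mkposreal _ Hd2). simpl. revert Hloc. apply filter_imp. intros r Hr x Hx.
    rewrite Rmin_left, Rmax_right in Hx by lra.
    eexists. apply phi_T_derive_t, Hr. lra.
  - intros x. rewrite Rmin_left, Rmax_right by lra. intros Hx. apply C2; auto.
  - apply C3, Hin; lra.
  - apply C3, Hin; lra.
  - apply continuity_pt_filterlim.
    apply (open_strip_slice tau a b hphi); auto; [apply open_strip_of_strip, hphi_cont|apply Hin; lra].
  - apply continuity_pt_filterlim.
    apply (open_strip_slice tau a b hphi); auto; [apply open_strip_of_strip, hphi_cont|apply Hin; lra].
Qed.
(** The limit is joint in margin and time because the mean value theorem will evaluate [rate] at an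
    unknown time near [t] that depends on the margin. *)
Lemma rate_lim (t : R) : pos_times tau t -> a t < b t ->
  locally t (ex_derive a) -> locally t (ex_derive b) ->
  continuous (Derive a) t -> continuous (Derive b) t ->
  filterlim (fun p : R * R => rate (fst p) (snd p)) (filter_prod (at_right 0) (locally t))
    (locally (Derive b t * hphi (b t, t) - Derive a t * hphi (a t, t)
      + alpha * (hflux (b t, t) - hflux (a t, t))
      - alpha * RInt (fun x => hdiss (x, t)) (a t) (b t))).
Proof.
  intros Ht Hab Hla Hlb HDa HDb.
  assert (Ha : continuous a t) by (apply (ex_derive_continuous a t (locally_singleton _ _ Hla))).
  assert (Hb : continuous b t) by (apply (ex_derive_continuous b t (locally_singleton _ _ Hlb))).
  set (F := filter_prod (at_right 0) (locally t)).
  assert (Ld : filterlim (fun p : R * R => fst p) F (locally 0)).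
  { eapply filterlim_filter_le_2; [|apply filterlim_fst]. apply filter_le_within. }
  assert (Lt : filterlim (fun p : R * R => snd p) F (locally t)) by apply filterlim_snd.
  assert (LA0 : filterlim (fun p : R * R => a (snd p)) F (locally (a t)))
    by (eapply filterlim_comp; [exact Lt|exact Ha]).
  assert (LB0 : filterlim (fun p : R * R => b (snd p)) F (locally (b t)))
    by (eapply filterlim_comp; [exact Lt|exact Hb]).
  assert (LA : filterlim (fun p : R * R => a (snd p) + fst p) F (locally (a t))).
  { rewrite <- (Rplus_0_r (a t)). apply filterlim_Rplus; auto. apply _. }
  assert (LB : filterlim (fun p : R * R => b (snd p) - fst p) F (locally (b t))).
  { rewrite <- (Rminus_0_r (b t)). apply filterlim_Rminus; auto. apply _. }
  assert (Hm : 0 < (b t - a t) / 8) by lra.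
  assert (HF : F (fun p : R * R => a (snd p) <= a (snd p) + fst p <= b (snd p) - fst p /\
     b (snd p) - fst p <= b (snd p))).
  { exists (fun d => 0 < d < (b t - a t) / 8)
      (fun r => Rabs (a r - a t) < (b t - a t) / 8 /\ Rabs (b r - b t) < (b t - a t) / 8).
    - now apply at_right_0_lt.
    - apply filter_and; [exact (proj1 (filterlim_R _ _ _) Ha _ Hm)|
        exact (proj1 (filterlim_R _ _ _) Hb _ Hm)].
    - intros d r Hd [H1 H2]. apply Rabs_def2 in H1. apply Rabs_def2 in H2. simpl. lra. }
  assert (HFa : F (fun p : R * R => a (snd p) <= a (snd p) + fst p <= b (snd p)))
    by (revert HF; apply filter_imp; intros p; lra).
  assert (HFb : F (fun p : R * R => a (snd p) <= b (snd p) - fst p <= b (snd p)))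
    by (revert HF; apply filter_imp; intros p; lra).
  assert (Pa : a t <= a t <= b t) by lra. assert (Pb : a t <= b t <= b t) by lra.
  assert (Cst : filterlim (fun _ : R * R => alpha) F (locally alpha)) by apply filterlim_const.
  unfold rate.
  apply filterlim_Rminus; [apply _|apply filterlim_Rplus; [apply _|apply filterlim_Rminus; [apply _| |]|]|].
  - apply filterlim_Rmult; [apply _| |].
    + eapply filterlim_comp; [exact Lt|exact HDb].
    + now apply (strip_lim tau a b F hphi _ _ (b t) t hphi_cont).
  - apply filterlim_Rmult; [apply _| |].
    + eapply filterlim_comp; [exact Lt|exact HDa].
    + now apply (strip_lim tau a b F hphi _ _ (a t) t hphi_cont).
  - apply filterlim_Rmult; [apply _|exact Cst|]. apply filterlim_Rminus; [apply _| |].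
    + now apply (strip_lim tau a b F hflux _ _ (b t) t hflux_cont).
    + now apply (strip_lim tau a b F hflux _ _ (a t) t hflux_cont).
  - apply filterlim_Rmult; [apply _|exact Cst|].
    apply (strip_RInt_lim tau a b F hdiss); auto; [apply hdiss_cont|lra].
Qed.

(** For a fixed small [h], the mean value theorem puts the difference quotient of every truncated
    energy within [e / 2] of [g], uniformly in the margin. Letting the margin tend to 0 with [h]
    fixed transfers the bound to the full energy. *)
Lemma heat_energy (t : R) : pos_times tau t -> a t < b t ->
  locally t (ex_derive a) -> locally t (ex_derive b) ->
  continuous (Derive a) t -> continuous (Derive b) t ->
  is_derive (fun r => RInt (fun x => phi (T x r)) (a r) (b r)) t
    (Derive b t * phi (T (b t) t) - Derive a t * phi (T (a t) t)
      + alpha * (phi1 (T (b t) t) * Tx (b t) t - phi1 (T (a t) t) * Tx (a t) t)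
      - alpha * RInt (fun x => phi2 (T x t) * Tx x t ^ 2) (a t) (b t)).
Proof.
  intros Ht Hab Hla Hlb HDa HDb.
  pose proof (rate_lim t Ht Hab Hla Hlb HDa HDb) as HR.
  set (g := Derive b t * hphi (b t, t) - Derive a t * hphi (a t, t)
      + alpha * (hflux (b t, t) - hflux (a t, t))
      - alpha * RInt (fun x => hdiss (x, t)) (a t) (b t)) in HR.
  match goal with |- is_derive _ _ ?G => change G with g end. clearbody g.
  assert (Ha : continuous a t) by (apply (ex_derive_continuous a t (locally_singleton _ _ Hla))).
  assert (Hb : continuous b t) by (apply (ex_derive_continuous b t (locally_singleton _ _ Hlb))).
  apply is_derive_Reals. intros e He.
  assert (He2 : 0 < e / 2) by lra.
  destruct (proj1 (filterlim_R _ _ _) HR _ He2) as [Q1 Q2 HQ1 HQ2 HQ].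
  set (m := (b t - a t) / 8).
  assert (Hm : 0 < m) by (unfold m; lra).
  destruct (pos_times_open tau t Ht) as [d0 [Hd0 Hpos]].
  destruct (filter_and _ _ (filter_and _ _ HQ2 (locally_Rabs t _ d0 Hd0 Hpos))
    (filter_and _ _ (filter_and _ _ (locally_locally _ _ Hla) (locally_locally _ _ Hlb))
      (filter_and _ _ (proj1 (filterlim_R _ _ _) Ha m Hm) (proj1 (filterlim_R _ _ _) Hb m Hm))))
    as [d Hd].
  assert (Hd' : forall r, Rabs (r - t) < d -> Q2 r /\ pos_times tau r /\
     locally r (ex_derive a) /\ locally r (ex_derive b) /\ a r + 4 * m < b r).
  { intros r Hr. destruct (Hd r Hr) as [[R1 R2] [[R3 R4] [R5 R6]]].
    apply Rabs_def2 in R5. apply Rabs_def2 in R6. unfold m in *. repeat split; auto; try apply R2; lra. }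
  exists d. intros h Hh0 Hh.
  set (I := fun d r => RInt (fun x => phi (T x r)) (a r + d) (b r - d)).
  assert (trunc : at_right 0 (fun p => Rabs ((I p (t + h) - I p t) / h - g) <= e / 2)).
  { generalize (filter_and _ _ HQ1 (at_right_0_lt m Hm)). apply filter_imp.
    intros p [P1 P2].
    assert (Hder : forall r, Rmin t (t + h) <= r <= Rmax t (t + h) -> Rabs (r - t) < d).
    { intros r Hr. apply Rabs_def2 in Hh. destruct (Rle_lt_dec 0 h).
      - rewrite Rmin_left, Rmax_right in Hr by lra. apply Rabs_def1; lra.
      - rewrite Rmin_right, Rmax_left in Hr by lra. apply Rabs_def1; lra. }
    assert (HI : forall r, Rmin t (t + h) <= r <= Rmax t (t + h) -> is_derive (I p) r (rate p r)).
    { intros r Hr. destruct (Hd' r (Hder r Hr)) as [_ [R1 [R2 [R3 R4]]]].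
      apply truncated_energy_derive; auto; lra. }
    destruct (MVT_gen (I p) t (t + h) (rate p)) as [c [Hc Ec]].
    - intros r Hr. apply HI. lra.
    - intros r Hr. apply continuity_pt_filterlim. apply (ex_derive_continuous (I p) r).
      eexists. apply HI, Hr.
    - rewrite Ec. replace (rate p c * (t + h - t) / h) with (rate p c) by (field; auto).
      apply Rlt_le. apply (HQ p c P1). now apply Hd', Hder. }
  assert (lim : forall r, Rabs (r - t) < d -> filterlim (fun p => I p r) (at_right 0)
     (locally (RInt (fun x => phi (T x r)) (a r) (b r)))).
  { intros r Hr. destruct (Hd' r Hr) as [_ [R1 [R2 [R3 R4]]]].
    apply (strip_RInt_lim tau a b (at_right 0) hphi (fun p => a r + p) (fun p => b r - p) (fun _ => r));
      auto; try lra.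
    - apply hphi_cont.
    - apply (ex_derive_continuous a r (locally_singleton _ _ R2)).
    - apply (ex_derive_continuous b r (locally_singleton _ _ R3)).
    - apply filterlim_R; [apply _|]. intros z Hz. generalize (at_right_0_lt z Hz).
      apply filter_imp. intros p Hp. apply Rabs_def1; lra.
    - apply filterlim_R; [apply _|]. intros z Hz. generalize (at_right_0_lt z Hz).
      apply filter_imp. intros p Hp. apply Rabs_def1; lra.
    - apply filterlim_const.
    - generalize (at_right_0_lt m Hm). apply filter_imp. intros p Hp. lra. }
  apply Rle_lt_trans with (e / 2); [|lra].
  apply (filterlim_le_const (at_right 0) (fun p => Rabs ((I p (t + h) - I p t) / h - g)));
    [|exact trunc].
  assert (L1 : filterlim (fun p => I p (t + h)) (at_right 0)
     (locally (RInt (fun x => phi (T x (t + h))) (a (t + h)) (b (t + h))))).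
  { apply lim. replace (t + h - t) with h by ring. exact Hh. }
  assert (L2 : filterlim (fun p => I p t) (at_right 0)
     (locally (RInt (fun x => phi (T x t)) (a t) (b t)))).
  { apply lim. rewrite Rminus_diag, Rabs_R0. apply cond_pos. }
  eapply filterlim_comp; [|apply (continuous_Rabs)].
  apply filterlim_Rminus; [apply _| |apply filterlim_const].
  apply filterlim_Rmult; [apply _| |apply filterlim_const].
  apply filterlim_Rminus; auto. apply _.
Qed.

End Heat.

(** * Initial time and maximum principle *)

(** From exponent 2 on the power is differentiable at 0 too, since the quotient there is 0 or
    [h * h ^ n]. Exponents 3 and 2 yield the two derivatives of the cubed positive part. *)
Lemma is_derive_pos_part_pow (n : nat) (z : R) :
  is_derive (fun z => Rmax 0 z ^ S (S n)) z (INR (S (S n)) * Rmax 0 z ^ S n).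
Proof.
  destruct (Rtotal_order z 0) as [H|[H|H]].
  - rewrite Rmax_left by lra. replace (INR (S (S n)) * 0 ^ S n) with 0 by (simpl; ring).
    apply (is_derive_ext_loc (fun _ => 0)).
    + apply (locally_interval _ z m_infty 0); simpl; auto. intros y _ Hy.
      rewrite Rmax_left by lra. simpl; ring.
    + apply @is_derive_const.
  - subst z. rewrite Rmax_left by lra. replace (INR (S (S n)) * 0 ^ S n) with 0 by (simpl; ring).
    apply is_derive_Reals. intros e He.
    assert (Hm : 0 < Rmin e 1) by (apply Rmin_pos; lra).
    exists (mkposreal _ Hm). simpl pos. intros h Hh0 Hh.
    pose proof (Rmin_l e 1). pose proof (Rmin_r e 1).
    rewrite Rplus_0_l, (Rmax_left 0 0) by lra.
    replace ((Rmax 0 h ^ S (S n) - 0 ^ S (S n)) / h - 0) with (Rmax 0 h ^ S (S n) / h)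
      by (simpl; field; auto).
    unfold Rmax. destruct Rle_dec as [H1|H1].
    + replace (h ^ S (S n) / h) with (h * h ^ n) by (simpl; field; auto).
      rewrite Rabs_mult, <- RPow_abs. rewrite Rabs_pos_eq in * by lra.
      assert (h ^ n <= 1) by (rewrite <- (pow1 n); apply pow_incr; lra).
      assert (0 <= h ^ n) by (apply pow_le; lra). nra.
    + replace (0 ^ S (S n) / h) with 0 by (simpl; field; auto). rewrite Rabs_R0. lra.
  - rewrite Rmax_right by lra.
    apply (is_derive_ext_loc (fun z => z ^ S (S n))).
    + apply (locally_interval _ z 0 p_infty); simpl; auto. intros y Hy _.
      rewrite Rmax_right by lra. reflexivity.
    + evar_last; [apply (is_derive_pow (fun z => z)), is_derive_id|].
      change one with 1. rewrite Rmult_1_r. reflexivity.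
Qed.

Lemma continuous_pos_part (z : R) : continuous (Rmax 0) z.
Proof.
  apply (filterlim_R (locally z)). intros e He. apply (locally_Rabs z _ e He). intros y Hy.
  unfold Rmax. repeat destruct Rle_dec; apply Rabs_def2 in Hy; apply Rabs_def1; lra.
Qed.

Section HeatInitial.
Context (alpha : R) (tau : Rbar) (a b : R -> R) (T0 : R -> R) (T Tx : R -> R -> R)
  (HT : classical_heat alpha tau a b T0 T Tx)
  (Hab0 : a 0 <= b 0) (HT0 : piecewise_continuous T0 (a 0) (b 0)).

(** For [t > 0] this is continuity on the strip; at [t = 0] a joint limit is known only at the
    points where [T0] is continuous. *)
Lemma heat_joint (x t e : R) : nonneg_times tau t -> a t <= x <= b t ->
  (t = 0 -> continuous T0 x) -> 0 < e ->
  exists d, 0 < d /\ forall y r, nonneg_times tau r -> Rabs (y - x) < d -> Rabs (r - t) < d ->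
    a r <= y <= b r -> Rabs (T y r - T x t) < e.
Proof.
  intros Ht Hx Hc He. destruct (Rle_lt_or_eq_dec 0 t (proj1 Ht)) as [H|H].
  - assert (Hp : pos_times tau t) by (split; [exact H|apply Ht]).
    destruct (strip_joint tau a b _ x t e (heat_cont _ _ _ _ _ _ _ HT) Hp Hx He) as [d [Hd Hd']].
    exists (Rmin d t). split; [now apply Rmin_pos|]. intros y r Hr H1 H2 H3.
    apply Hd'; auto.
    + apply (Rlt_le_trans _ _ _ H1), Rmin_l.
    + apply (Rlt_le_trans _ _ _ H2), Rmin_l.
  - subst t. rewrite (heat_init _ _ _ _ _ _ _ HT x Hx).
    assert (Hw : filterlim T0 (within (fun y => a 0 <= y <= b 0) (locally x)) (locally (T0 x))).
    { eapply filterlim_filter_le_1; [apply filter_le_within|]. now apply Hc. }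
    destruct (proj1 (filterlim_R _ _ _) (heat_init_cont _ _ _ _ _ _ _ HT x Hx Hw) e He) as [d Hd].
    exists d. split; [apply cond_pos|]. intros y r Hr H1 H2 H3.
    apply (Hd (y, r)); [split; [exact H1|exact H2]|split; auto].
Qed.

Lemma heat_joint_comp (phi : R -> R) (x t e : R) : (forall z, continuous phi z) ->
  nonneg_times tau t -> a t <= x <= b t -> (t = 0 -> continuous T0 x) -> 0 < e ->
  exists d, 0 < d /\ forall y r, nonneg_times tau r -> Rabs (y - x) < d -> Rabs (r - t) < d ->
    a r <= y <= b r -> Rabs (phi (T y r) - phi (T x t)) < e.
Proof.
  intros Hphi Ht Hx Hc He.
  destruct (proj1 (filterlim_R _ _ _) (Hphi (T x t)) e He) as [d1 Hd1].
  destruct (heat_joint x t d1 Ht Hx Hc (cond_pos d1)) as [d [Hd Hd']].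
  exists d. split; auto. intros y r H1 H2 H3 H4. apply Hd1. now apply Hd'.
Qed.

Lemma heat_ex_RInt (phi : R -> R) (t : R) : (forall z, continuous phi z) ->
  nonneg_times tau t -> a t <= b t -> ex_RInt (fun x => phi (T x t)) (a t) (b t).
Proof.
  intros Hphi Ht Hab. destruct (Rle_lt_or_eq_dec 0 t (proj1 Ht)) as [H|H].
  - apply continuous_on_ex_RInt; auto. apply (continuous_on_comp phi); auto.
    apply (heat_slice _ _ _ _ _ _ _ HT). split; [exact H|apply Ht].
  - subst t. apply (ex_RInt_ext (fun x => phi (T0 x))).
    + intros x. rewrite Rmin_left, Rmax_right by lra. intros Hx.
      rewrite (heat_init _ _ _ _ _ _ _ HT); auto; lra.
    + apply piecewise_continuous_ex_RInt; auto. now apply piecewise_continuous_comp.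
Qed.

Lemma heat_RInt_continuous (phi : R -> R) (t : R) (D : R -> Prop) : (forall z, continuous phi z) ->
  nonneg_times tau t -> a t <= b t -> (forall r, D r -> 0 <= r /\ a r <= b r) ->
  filterlim a (within D (locally t)) (locally (a t)) ->
  filterlim b (within D (locally t)) (locally (b t)) ->
  filterlim (fun r => RInt (fun x => phi (T x r)) (a r) (b r)) (within D (locally t))
    (locally (RInt (fun x => phi (T x t)) (a t) (b t))).
Proof.
  intros Hphi Ht Hab HD Ha Hb.
  destruct (nonneg_times_right tau t Ht) as [t1 [Ht1 Hn1]].
  destruct (heat_bounded _ _ _ _ _ _ _ HT t1 Hn1) as [K HK].
  set (K0 := Rmax 0 K).
  destruct (ex_RInt_bounded phi (- K0) K0) as [M HM].
  { pose proof (Rmax_l 0 K). unfold K0. lra. }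
  { apply (ex_RInt_continuous phi). auto. }
  assert (HB : forall x r, 0 <= r <= t1 -> a r <= x <= b r -> Rabs (phi (T x r)) <= M).
  { intros x r H1 H2. apply HM. pose proof (HK x r H1 H2). pose proof (Rmax_r 0 K). fold K0 in H0.
    apply Rabs_le_between. lra. }
  assert (near : forall d, 0 < d -> within D (locally t) (fun r => D r /\ Rabs (r - t) < d)).
  { intros d Hd. exists (mkposreal d Hd). intros r Hr HDr. split; [exact HDr|exact Hr]. }
  assert (Hd1 : 0 < t1 - t) by lra.
  assert (Hnn : forall r, D r -> Rabs (r - t) < t1 - t -> 0 <= r <= t1 /\ a r <= b r /\ nonneg_times tau r).
  { intros r H1 H2. destruct (HD r H1) as [H3 H4]. apply Rabs_def2 in H2.
    repeat split; try lra. apply (nonneg_times_le tau t1 r Hn1). lra. }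
  assert (HP : exists l, forall x, a 0 < x < b 0 -> ~ In x l -> continuous T0 x) by apply HT0.
  destruct HP as [l Hl].
  apply (RInt_dominated_moving _ (fun r x => phi (T x r)) (fun x => phi (T x t)) a b (a t) (b t) M l); auto.
  - generalize (near _ Hd1). apply filter_imp. intros r [H1 H2].
    destruct (Hnn r H1 H2) as [H3 [H4 H5]]. split; [exact H4|split].
    + now apply heat_ex_RInt.
    + intros x Hx. apply HB; lra.
  - now apply heat_ex_RInt.
  - intros x Hx. apply HB; [|lra]. destruct Ht; lra.
  - intros x Hx Hxl e He. assert (He2 : 0 < e / 2) by lra.
    destruct (heat_joint_comp phi x t (e / 2) Hphi Ht) as [d [Hd Hd']]; auto; [lra| |].
    { intros ->. now apply Hl. }
    exists (Rmin d (Rmin (x - a t) (b t - x))).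
    split; [repeat apply Rmin_pos; lra|].
    generalize (filter_and _ _ (near d Hd) (near _ Hd1)).
    apply filter_imp. intros r [[Q1 Q2] [_ Q3]] y Hy Hyx.
    destruct (Hnn r Q1 Q3) as [R1 [R2 R3]].
    assert (Hm : Rabs (y - x) < d /\ a t <= y <= b t).
    { pose proof (Rmin_l d (Rmin (x - a t) (b t - x))).
      pose proof (Rmin_r d (Rmin (x - a t) (b t - x))).
      pose proof (Rmin_l (x - a t) (b t - x)). pose proof (Rmin_r (x - a t) (b t - x)).
      split; [lra|]. apply Rabs_def2 in Hyx. lra. }
    assert (B1 : Rabs (phi (T y r) - phi (T x t)) < e / 2) by (apply Hd'; try lra; auto).
    assert (B2 : Rabs (phi (T y t) - phi (T x t)) < e / 2).
    { apply Hd'; try lra; auto. rewrite Rminus_diag, Rabs_R0. exact Hd. }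
    apply Rabs_def2 in B1. apply Rabs_def2 in B2. apply Rabs_le. lra.
Qed.

Lemma heat_RInt_right_0 (phi : R -> R) (t1 : R) : (forall z, continuous phi z) ->
  nonneg_times tau t1 -> 0 < t1 -> (forall r, 0 <= r <= t1 -> a r <= b r) ->
  filterlim a (within (nonneg_times tau) (locally 0)) (locally (a 0)) ->
  filterlim b (within (nonneg_times tau) (locally 0)) (locally (b 0)) ->
  filterlim (fun r => RInt (fun x => phi (T x r)) (a r) (b r)) (at_right 0)
    (locally (RInt (fun x => phi (T x 0)) (a 0) (b 0))).
Proof.
  intros Hphi Ht1 H0 Hab Ha Hb.
  set (D := fun r => 0 <= r <= t1).
  assert (Hsub : filter_le (within D (locally 0)) (within (nonneg_times tau) (locally 0))).
  { intros Q HQ. unfold within in *. revert HQ. apply filter_imp. intros r HQ HD.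
    apply HQ. now apply (nonneg_times_le tau t1). }
  assert (Hle : filter_le (at_right 0) (within D (locally 0))).
  { intros Q HQ. unfold at_right, within in *.
    generalize (filter_and _ _ HQ (at_right_0_lt t1 H0)).
    apply filter_imp. intros r [Q1 Q2] Hr. apply Q1. specialize (Q2 Hr). split; lra. }
  eapply filterlim_filter_le_1; [exact Hle|].
  apply heat_RInt_continuous; auto.
  - now apply (nonneg_times_le tau t1); auto; lra.
  - intros r Hr. split; [apply Hr|now apply Hab].
  - eapply filterlim_filter_le_1; [exact Hsub|exact Ha].
  - eapply filterlim_filter_le_1; [exact Hsub|exact Hb].
Qed.

(* Weak maximum principle, from the energy of the cubed positive part of [sg * (T - m)]. *)
Lemma heat_sign (sg m t1 : R) : 0 < alpha -> sg ^ 2 = 1 -> pos_times tau t1 ->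
  filterlim a (within (nonneg_times tau) (locally 0)) (locally (a 0)) ->
  filterlim b (within (nonneg_times tau) (locally 0)) (locally (b 0)) ->
  (forall t, 0 <= t <= t1 -> a t < b t) ->
  (forall t, 0 < t <= t1 -> locally t (ex_derive a) /\ locally t (ex_derive b) /\
     continuous (Derive a) t /\ continuous (Derive b) t) ->
  (forall x, a 0 <= x <= b 0 -> sg * (T0 x - m) <= 0) ->
  (forall t, 0 < t <= t1 -> T (b t) t = m \/ (Derive b t = 0 /\ sg * Tx (b t) t <= 0)) ->
  (forall t, 0 < t <= t1 -> T (a t) t = m \/ (Derive a t = 0 /\ 0 <= sg * Tx (a t) t)) ->
  forall x, a t1 < x < b t1 -> sg * (T x t1 - m) <= 0.
Proof.
  intros Hal Hsg Ht1 Ha Hb Hab Hreg H0 HBb HBa.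
  (* The cube is the lowest integer power of the positive part with a continuous second derivative,
     as the energy identity requires; moreover [phi2 >= 0], so the dissipation has the right
     sign. *)
  set (phi := fun z => Rmax 0 (sg * (z - m)) ^ 3).
  set (phi1 := fun z => sg * (3 * Rmax 0 (sg * (z - m)) ^ 2)).
  set (phi2 := fun z => 6 * Rmax 0 (sg * (z - m))).
  assert (Hlin : forall z, is_derive (fun z => sg * (z - m)) z sg)
    by (intros z; auto_derive; auto; ring).
  assert (D1 : forall z, is_derive phi z (phi1 z)).
  { intros z. evar_last.
    - apply (is_derive_comp (fun z => Rmax 0 z ^ 3) (fun z => sg * (z - m))); [|apply Hlin].
      apply (is_derive_pos_part_pow 1).
    - unfold phi1, scal; simpl. unfold mult; simpl. ring. }
  assert (D2 : forall z, is_derive phi1 z (phi2 z)).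
  { intros z. evar_last.
    - apply (is_derive_scal (fun z => 3 * Rmax 0 (sg * (z - m)) ^ 2)).
      apply (is_derive_scal (fun z => Rmax 0 (sg * (z - m)) ^ 2)).
      apply (is_derive_comp (fun z => Rmax 0 z ^ 2) (fun z => sg * (z - m))); [|apply Hlin].
      apply (is_derive_pos_part_pow 0).
    - unfold phi2, scal; simpl. unfold mult; simpl.
      transitivity (6 * sg ^ 2 * Rmax 0 (sg * (z - m))); [simpl; ring|rewrite Hsg; ring]. }
  assert (C2 : forall z, continuous phi2 z).
  { intros z. apply (continuous_scal_r 6 (fun z => Rmax 0 (sg * (z - m)))).
    apply (continuous_comp (fun z => sg * (z - m)) (Rmax 0)); [|apply continuous_pos_part].
    apply (ex_derive_continuous (fun z => sg * (z - m))). eexists; apply Hlin. }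
  assert (C0 : forall z, continuous phi z)
    by (intros z; apply (ex_derive_continuous phi); eexists; apply D1).
  assert (P0 : forall z, 0 <= phi z) by (intros z; apply pow_le, Rmax_l).
  assert (Pm : phi m = 0)
    by (unfold phi; rewrite Rmax_left by (rewrite Rminus_diag; lra); simpl; ring).
  assert (P1m : phi1 m = 0)
    by (unfold phi1; rewrite Rmax_left by (rewrite Rminus_diag; lra); simpl; ring).
  assert (Hn1 : nonneg_times tau t1) by now apply pos_times_nonneg.
  destruct Ht1 as [Ht1 Ht1'].
  set (I := fun t => RInt (fun x => phi (T x t)) (a t) (b t)).
  assert (I0 : I 0 = 0).
  { unfold I. rewrite (RInt_ext _ (fun _ => 0)).
    - rewrite RInt_const. apply Rmult_0_r.
    - intros x. rewrite Rmin_left, Rmax_right by lra. intros Hx.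
      rewrite (heat_init _ _ _ _ _ _ _ HT) by lra. unfold phi.
      rewrite Rmax_left by (apply H0; lra). simpl; ring. }
  assert (Hpos : forall t, 0 < t <= t1 -> pos_times tau t).
  { intros t Ht. split; [lra|]. apply (nonneg_times_le tau t1 t Hn1). lra. }
  assert (I1 : I t1 <= I 0).
  { apply (nonincreasing_from I (fun t => Derive b t * phi (T (b t) t) - Derive a t * phi (T (a t) t)
      + alpha * (phi1 (T (b t) t) * Tx (b t) t - phi1 (T (a t) t) * Tx (a t) t)
      - alpha * RInt (fun x => phi2 (T x t) * Tx x t ^ 2) (a t) (b t)) 0 t1); try lra.
    - intros t Ht. destruct (Hreg t Ht) as [R1 [R2 [R3 R4]]].
      apply (heat_energy alpha tau a b T0 T Tx HT phi phi1 phi2); auto.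
      apply Hab; lra.
    - intros t Ht.
      assert (Hd : 0 <= RInt (fun x => phi2 (T x t) * Tx x t ^ 2) (a t) (b t)).
      { assert (Hab' : a t < b t) by (apply Hab; lra).
        apply RInt_ge_0; [lra| |].
        - apply continuous_on_ex_RInt; [lra|].
          apply (continuous_on_mult _ (fun x => phi2 (T x t)) (fun x => Tx x t ^ 2)).
          + apply (continuous_on_comp phi2); auto. apply (heat_slice _ _ _ _ _ _ _ HT); auto.
          + apply (continuous_on_comp (fun z => z ^ 2)).
            * intros w. apply (ex_derive_continuous (fun z => z ^ 2)). auto_derive. auto.
            * apply (heat_grad_slice _ _ _ _ _ _ _ HT); auto.
        - intros x _. apply Rmult_le_pos; [|apply pow2_ge_0].
          unfold phi2. pose proof (Rmax_l 0 (sg * (T x t - m))). lra. }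
      (* An end is either at the value [m], where [phi] and [phi1] vanish, or at rest with a flux of
         the favourable sign. *)
      assert (E1 : Derive b t * phi (T (b t) t) = 0 /\ phi1 (T (b t) t) * Tx (b t) t <= 0).
      { destruct (HBb t Ht) as [->|[-> H1]].
        - rewrite Pm, P1m. split; lra.
        - split; [ring|]. unfold phi1.
          pose proof (pow2_ge_0 (Rmax 0 (sg * (T (b t) t - m)))). nra. }
      assert (E2 : Derive a t * phi (T (a t) t) = 0 /\ 0 <= phi1 (T (a t) t) * Tx (a t) t).
      { destruct (HBa t Ht) as [->|[-> H1]].
        - rewrite Pm, P1m. split; lra.
        - split; [ring|]. unfold phi1.
          pose proof (pow2_ge_0 (Rmax 0 (sg * (T (a t) t - m)))). nra. }
      destruct E1 as [E1 E1']. destruct E2 as [E2 E2']. rewrite E1, E2. nra.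
    - apply (heat_RInt_right_0 phi t1); auto. intros r Hr. left. now apply Hab. }
  intros x Hx.
  assert (Z : phi (T x t1) = 0).
  { apply (RInt_eq_0_pos (fun x => phi (T x t1)) (a t1) (b t1)); auto.
    - apply (continuous_on_comp phi); auto. apply (heat_slice _ _ _ _ _ _ _ HT). now apply Hpos; lra.
    - unfold I in I1. fold (I 0) in I1. lra. }
  apply Rnot_lt_le. intro Hlt. unfold phi in Z. rewrite Rmax_right in Z by lra.
  assert (0 < (sg * (T x t1 - m)) ^ 3) by (apply pow_lt; exact Hlt). lra.
Qed.
End HeatInitial.

(** * The closed loop *)

(** The difference quotient has the sign of [(f y - f x) * (y - x)], and nearby interior points [y]
    exist on at least one side of [x]. So [x] may be an end point, as the interface is for both
    phases. *)
Lemma is_derive_on_nonpos (a b : R) (f : R -> R) (x l : R) : a < b -> a <= x <= b ->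
  is_derive_on a b f x l -> (forall y, a < y < b -> (f y - f x) * (y - x) <= 0) -> l <= 0.
Proof.
  intros Hab Hx Hl Hs. apply Rnot_lt_le. intro H.
  assert (FF : Filter (within (fun y => a <= y <= b) (locally' x))).
  { apply within_filter, within_filter, locally_filter. }
  destruct (proj1 (filterlim_R _ _ _) Hl l H) as [d Hd].
  pose proof (cond_pos d) as Hdp.
  assert (Hy : exists y, a < y < b /\ y <> x /\ Rabs (y - x) < d).
  { destruct (Rlt_le_dec x b) as [H1|H1].
    - exists (x + Rmin (d / 2) ((b - x) / 2)).
      assert (0 < Rmin (d / 2) ((b - x) / 2)) by (apply Rmin_pos; lra).
      pose proof (Rmin_l (d / 2) ((b - x) / 2)). pose proof (Rmin_r (d / 2) ((b - x) / 2)).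
      repeat split; try lra. apply Rabs_def1; lra.
    - exists (x - Rmin (d / 2) ((x - a) / 2)).
      assert (0 < Rmin (d / 2) ((x - a) / 2)) by (apply Rmin_pos; lra).
      pose proof (Rmin_l (d / 2) ((x - a) / 2)). pose proof (Rmin_r (d / 2) ((x - a) / 2)).
      repeat split; try lra. apply Rabs_def1; lra. }
  destruct Hy as [y [H1 [H2 H3]]].
  assert (Q : Rabs ((f y - f x) / (y - x) - l) < l) by (apply Hd; auto; lra).
  apply Rabs_def2 in Q. specialize (Hs y H1).
  replace ((f y - f x) * (y - x)) with ((f y - f x) / (y - x) * (y - x) ^ 2) in Hs
    by (field; lra).
  assert (0 < (y - x) ^ 2) by (apply pow2_gt_0; lra).
  assert (0 < (f y - f x) / (y - x)) by lra. nra.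
Qed.

Lemma gamma_pos (P : plant) : 0 < gamma P.
Proof. apply Rmult_lt_0_compat; [apply rho_l_pos|apply latent_pos]. Qed.

Lemma alpha_l_pos (P : plant) : 0 < alpha_l P.
Proof.
  apply Rdiv_lt_0_compat; [apply k_l_pos|].
  apply Rmult_lt_0_compat; [apply rho_l_pos|apply heat_l_pos].
Qed.

Lemma alpha_s_pos (P : plant) : 0 < alpha_s P.
Proof.
  apply Rdiv_lt_0_compat; [apply k_s_pos|].
  apply Rmult_lt_0_compat; [apply rho_s_pos|apply heat_s_pos].
Qed.

(** * The Lyapunov inequality and its Poincare estimates *)

(** Here [u0] is [T_l(0) - T_m], [Du] and [Dv] are the integrals of the squared gradients, [Iu] and
    [Iv] those of the squared temperature deviations. The heating term costs [al * Du] and half of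
    [2 * beta * Z * q]; the remainder, at least [al * Du + as_ * Dv + beta * Z * q], must dominate
    [d * (Iu + beta * Z ^ 2 + Iv)]. The two entries of [d] are the rates obtained in the two cases
    for [Y]. *)
Lemma lyapunov_rate (al as_ kl L c kap N Y Z q u0 Du Dv Iu Iv : R) :
  0 < al -> 0 < as_ -> 0 < kl -> 0 < L -> 0 < c -> 0 < kap -> 0 <= N ->
  q = c * (kap * Z - Y) -> 0 <= Y -> 0 < q ->
  u0 ^ 2 <= L * Du -> Iu <= L ^ 2 * Du -> Iv <= L ^ 2 * Dv -> 0 <= Iu -> 0 <= Iv ->
  Y ^ 2 <= N * (Iu + Iv) ->
  let beta := al * L * c * kap / kl ^ 2 in
  let mu := Rmin al as_ / L ^ 2 in
  let d := Rmin (mu / (1 + beta * (4 * N / kap ^ 2))) (c * kap / 2) in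
  2 * al / kl * u0 * q - 2 * al * Du - 2 * beta * Z * q - 2 * as_ * Dv
    <= - d * (Iu + beta * Z ^ 2 + Iv).
Proof.
  intros Hal Has Hkl HL Hc Hk HN Eq HY Hq Hu0 HIu HIv HIu0 HIv0 HYN beta mu d.
  assert (L2 : 0 < L ^ 2) by (apply pow_lt; auto).
  assert (K2 : 0 < kl ^ 2) by (apply pow_lt; auto).
  assert (Hb : 0 < beta).
  { unfold beta. apply Rdiv_lt_0_compat; auto. repeat apply Rmult_lt_0_compat; auto. }
  assert (Hmu : 0 < mu) by (unfold mu; apply Rdiv_lt_0_compat; auto; apply Rmin_pos; auto).
  set (N' := 4 * N / kap ^ 2) in *.
  assert (HN' : 0 <= N').
  { unfold N'. apply Rmult_le_pos; [lra|]. left. apply Rinv_0_lt_compat, pow_lt; auto. }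
  assert (Hbn : 0 <= beta * N') by (apply Rmult_le_pos; lra).
  assert (Hmn : mu / (1 + beta * N') * (1 + beta * N') = mu) by (field; lra).
  assert (Hmn0 : 0 < mu / (1 + beta * N')) by (apply Rdiv_lt_0_compat; lra).
  assert (Hd1 : d <= mu / (1 + beta * N')) by apply Rmin_l.
  assert (Hd2 : d <= c * kap / 2) by apply Rmin_r.
  assert (Hd0 : 0 < d).
  { apply Rmin_pos; auto. apply Rdiv_lt_0_compat; [apply Rmult_lt_0_compat; auto|lra]. }
  assert (Hdm : d <= mu) by nra.
  assert (HZ : 0 < Z).
  { assert (0 < kap * Z - Y) by (apply (Rmult_lt_reg_l c); lra). nra. }
  (* Young's inequality from [(u0 - L * (q / kl)) ^ 2 >= 0], combined with [u0 ^ 2 <= L * Du]. *)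
  assert (h1 : 2 * al / kl * u0 * q <= al * Du + al * L * (q / kl) ^ 2).
  { replace (2 * al / kl * u0 * q) with (al * (2 * u0 * (q / kl))) by (field; lra).
    replace (al * Du + al * L * (q / kl) ^ 2) with (al * (Du + L * (q / kl) ^ 2)) by ring.
    apply Rmult_le_compat_l; [lra|]. apply (Rmult_le_reg_l L); auto.
    pose proof (pow2_ge_0 (u0 - L * (q / kl))). lra. }
  (* This fixes [beta]: after division by [al * L / kl ^ 2] the claim is [q * q <= c * kap * Z * q],
     true because [Y >= 0] gives [q <= c * kap * Z]. *)
  assert (h2 : al * L * (q / kl) ^ 2 <= beta * Z * q).
  { replace (al * L * (q / kl) ^ 2) with (al * L / kl ^ 2 * (q * q)) by (field; lra).
    replace (beta * Z * q) with (al * L / kl ^ 2 * (c * kap * Z * q)) by (unfold beta; field; lra).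
    apply Rmult_le_compat_l.
    - left. apply Rdiv_lt_0_compat; auto. apply Rmult_lt_0_compat; auto.
    - apply Rmult_le_compat_r; [lra|]. rewrite Eq. nra. }
  assert (mI : forall k I D, 0 < k -> Rmin al as_ <= k -> 0 <= I -> I <= L ^ 2 * D -> mu * I <= k * D).
  { intros k I D Hk0 Hk1 HI HD. apply Rle_trans with (k / L ^ 2 * I).
    - apply Rmult_le_compat_r; auto. unfold mu. apply Rmult_le_compat_r; auto.
      left. apply Rinv_0_lt_compat; auto.
    - apply Rle_trans with (k / L ^ 2 * (L ^ 2 * D)).
      + apply Rmult_le_compat_l; auto. left. apply Rdiv_lt_0_compat; auto.
      + right. field. lra. }
  pose proof (mI al Iu Du Hal (Rmin_l _ _) HIu0 HIu) as h3.
  pose proof (mI as_ Iv Dv Has (Rmin_r _ _) HIv0 HIv) as h4.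
  assert (HDv : 0 <= Dv) by (apply (Rmult_le_reg_l (L ^ 2)); auto; lra).
  clearbody d beta.
  assert (Hbq : 0 <= beta * Z * q) by (apply Rmult_le_pos; [apply Rmult_le_pos|]; lra).
  assert (main : d * (Iu + beta * Z ^ 2 + Iv) <= mu * (Iu + Iv) + beta * Z * q).
  (* In the first case [q >= c * kap / 2 * Z]. In the second [Z ^ 2 <= N' * (Iu + Iv)], and dividing
     [mu] by [1 + beta * N'] lets the two integrals pay for [beta * Z ^ 2] as well. *)
  { destruct (Rle_lt_dec Y (kap * Z / 2)) as [HYZ|HYZ].
    - assert (d * (Iu + Iv) <= mu * (Iu + Iv)) by (apply Rmult_le_compat_r; lra).
      assert (c * kap / 2 * Z <= q).
      { rewrite Eq. replace (c * kap / 2 * Z) with (c * (kap * Z / 2)) by field.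
        apply Rmult_le_compat_l; lra. }
      assert (d * Z <= c * kap / 2 * Z) by (apply Rmult_le_compat_r; lra).
      assert (beta * Z * (d * Z) <= beta * Z * q).
      { apply Rmult_le_compat_l; [apply Rmult_le_pos|]; lra. }
      lra.
    - assert (HZN : Z ^ 2 <= N' * (Iu + Iv)).
      { assert (Hk2 : 0 < kap ^ 2) by (apply pow_lt; auto).
        apply (Rmult_le_reg_l (kap ^ 2)); auto.
        replace (kap ^ 2 * (N' * (Iu + Iv))) with (4 * (N * (Iu + Iv)))
          by (unfold N'; field; lra).
        assert (0 < kap * Z) by (apply Rmult_lt_0_compat; auto).
        assert ((kap * Z) ^ 2 <= (2 * Y) ^ 2) by (apply pow_incr; lra).
        replace (kap ^ 2 * Z ^ 2) with ((kap * Z) ^ 2) by ring.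
        replace ((2 * Y) ^ 2) with (4 * Y ^ 2) in H0 by ring. lra. }
      assert (beta * Z ^ 2 <= beta * (N' * (Iu + Iv))) by (apply Rmult_le_compat_l; lra).
      apply Rle_trans with (mu * (Iu + Iv)); [|lra].
      apply Rle_trans with (d * ((1 + beta * N') * (Iu + Iv))).
      + apply Rmult_le_compat_l; lra.
      + rewrite <- Hmn at 1. rewrite <- Rmult_assoc. apply Rmult_le_compat_r; [lra|].
        apply Rmult_le_compat_r; lra. }
  assert (0 <= as_ * Dv) by (apply Rmult_le_pos; lra).
  lra.
Qed.

Lemma sum3_sq (x y z : R) : (x + y + z) ^ 2 <= 3 * (x ^ 2 + y ^ 2 + z ^ 2).
Proof. pose proof (pow2_ge_0 (x - y)). pose proof (pow2_ge_0 (x - z)). pose proof (pow2_ge_0 (y - z)). lra. Qed.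

(** A bound [l] replaces the actual length of the phase, so that the resulting constants do not
    depend on time. *)
Lemma heat_poincare (alpha : R) (tau : Rbar) (a b T0 : R -> R) (T Tx : R -> R -> R) (m l t : R) :
  classical_heat alpha tau a b T0 T Tx -> pos_times tau t -> a t < b t -> b t - a t <= l ->
  T (a t) t = m \/ T (b t) t = m ->
  let D := RInt (fun x => Tx x t ^ 2) (a t) (b t) in
  0 <= D /\ (forall x, a t <= x <= b t -> (T x t - m) ^ 2 <= l * D) /\
  RInt (fun x => (T x t - m) ^ 2) (a t) (b t) <= l ^ 2 * D.
Proof.
  intros HT Ht Hab Hl Hm D.
  assert (Csq : forall w, continuous (fun z => z ^ 2) w).
  { intros w. apply (ex_derive_continuous (fun z => z ^ 2)). auto_derive. auto. }
  pose proof (heat_slice _ _ _ _ _ _ _ HT t Ht) as C1.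
  pose proof (heat_grad_slice _ _ _ _ _ _ _ HT t Ht) as C2.
  assert (HD : 0 <= D).
  { apply RInt_ge_0; [lra| |intros; apply pow2_ge_0].
    apply continuous_on_ex_RInt; [lra|]. now apply (continuous_on_comp (fun z => z ^ 2)). }
  assert (Hsup : forall x, a t <= x <= b t -> (T x t - m) ^ 2 <= l * D).
  { intros x Hx. apply Rle_trans with ((b t - a t) * D); [|now apply Rmult_le_compat_r].
    apply (poincare_sup (fun x => T x t) (fun x => Tx x t)); auto.
    intros y Hy. apply (heat_is_derive_x _ _ _ _ _ _ _ HT). split; auto. }
  split; [exact HD|]. split; [exact Hsup|].
  apply Rle_trans with (RInt (fun _ => l * D) (a t) (b t)).
  - apply RInt_le; [lra| |apply ex_RInt_const|intros x Hx; apply Hsup; lra].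
    apply continuous_on_ex_RInt; [lra|].
    apply (continuous_on_comp (fun z => (z - m) ^ 2)); auto.
    intros w. apply (ex_derive_continuous (fun z => (z - m) ^ 2)). auto_derive. auto.
  - rewrite RInt_const. unfold scal; simpl; unfold mult; simpl.
    replace (l * (l * 1) * D) with (l * (l * D)) by ring.
    apply Rmult_le_compat_r; [apply Rmult_le_pos; lra|lra].
Qed.

(** * Quantities of the closed loop and their continuity *)

Section ClosedLoop.
Context (P : plant) (c s_r el es ef : R) (Tl0 Ts0 : R -> R) (s0 : R) (tau : Rbar)
  (Tl Tlx Ts Tsx : R -> R -> R) (s : R -> R)
  (c_pos : 0 < c) (s_r_lt : s_r < len P)
  (Hel : -1 < el) (Hef : -1 <= ef) (Hlf : ef <= el) (Hfs : es <= ef)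
  (A1 : assumption_A1 P Tl0 Ts0 s0) (A2 : assumption_A2 P Tl0 Ts0 s0)
  (Hq0 : 0 < control P c s_r el es ef Tl0 Ts0 s0) (Htau : Rbar_lt 0 tau)
  (Hsol : closed_loop_solution P c s_r el es ef Tl0 Ts0 s0 tau Tl Tlx Ts Tsx s).

Let m := T_m P.
Let kl := k_l P.
Let ks := k_s P.
Let al := alpha_l P.
Let as_ := alpha_s P.
Let g := gamma P.
Let HL : classical_heat (alpha_l P) tau (fun _ => 0) s Tl0 Tl Tlx := cl_liquid _ _ _ _ _ _ _ _ _ _ _ _ _ _ _ Hsol.
Let HS := cl_solid _ _ _ _ _ _ _ _ _ _ _ _ _ _ _ Hsol.

Definition input (t : R) : R := control P c s_r el es ef (fun x => Tl x t) (fun x => Ts x t) (s t).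
Definition liquid (phi : R -> R) (t : R) : R := RInt (fun x => phi (Tl x t)) 0 (s t).
Definition solid (phi : R -> R) (t : R) : R := RInt (fun x => phi (Ts x t)) (s t) (len P).
(** Since [k / alpha] is density times heat capacity, this is the heat content of both phases
    relative to the melting temperature plus the latent heat of the displacement [s t - s_r].
    Without perturbations the control law is [- c * energy t]. *)
Definition energy (t : R) : R :=
  k_l P / alpha_l P * liquid (fun z => z - T_m P) t + k_s P / alpha_s P * solid (fun z => z - T_m P) t
  + gamma P * (s t - s_r).

Lemma s_init : s 0 = s0.
Proof. apply Hsol. Qed.

Lemma zero_nonneg : nonneg_times tau 0.
Proof. split; [lra|exact Htau]. Qed.

Lemma s_init_bounds : 0 < s 0 < len P.
Proof. rewrite s_init. apply A1. Qed.

Lemma liquid_pw : piecewise_continuous Tl0 0 (s 0).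
Proof. rewrite s_init. apply A1. Qed.

Lemma solid_pw : piecewise_continuous Ts0 (s 0) (len P).
Proof. rewrite s_init. apply A1. Qed.

Lemma liquid_le_0 : 0 <= s 0. Proof. pose proof s_init_bounds. lra. Qed.
Lemma solid_le_0 : s 0 <= len P. Proof. pose proof s_init_bounds. lra. Qed.

(** The bounds are closed: a vanished phase must be reachable by a limit before it can be
    excluded. *)
Definition admissible (t : R) : Prop := nonneg_times tau t /\ 0 <= s t <= len P.

Lemma s_within (t : R) (D : R -> Prop) : nonneg_times tau t -> (forall r, D r -> nonneg_times tau r) ->
  filterlim s (within D (locally t)) (locally (s t)).
Proof.
  intros Ht HD. eapply filterlim_filter_le_1; [|apply (cl_cont _ _ _ _ _ _ _ _ _ _ _ _ _ _ _ Hsol t Ht)].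
  intros Q HQ. unfold within in *. revert HQ. apply filter_imp. intros r HQ HDr. apply HQ, HD, HDr.
Qed.

Lemma liquid_cont (phi : R -> R) (t : R) : (forall z, continuous phi z) -> admissible t ->
  filterlim (liquid phi) (within admissible (locally t)) (locally (liquid phi t)).
Proof.
  intros Hphi [Ht Hs].
  apply (heat_RInt_continuous _ tau (fun _ => 0) s Tl0 Tl Tlx HL liquid_le_0 liquid_pw phi t admissible);
    auto; try lra.
  - intros r [[H1 _] H2]. split; lra.
  - apply filterlim_const.
  - apply s_within; auto. intros r Hr; apply Hr.
Qed.

Lemma solid_cont (phi : R -> R) (t : R) : (forall z, continuous phi z) -> admissible t ->
  filterlim (solid phi) (within admissible (locally t)) (locally (solid phi t)).
Proof.
  intros Hphi [Ht Hs].
  apply (heat_RInt_continuous _ tau s (fun _ => len P) Ts0 Ts Tsx HS solid_le_0 solid_pw phi t admissible);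
    auto; try lra.
  - intros r [[H1 _] H2]. split; lra.
  - apply s_within; auto. intros r Hr; apply Hr.
  - apply filterlim_const.
Qed.

Lemma shift_continuous (w z : R) : continuous (fun z => z - w) z.
Proof. apply (ex_derive_continuous (fun z => z - w)). auto_derive. auto. Qed.

Lemma input_eq (t : R) : input t =
  - c * (kl / al * (1 + el) * liquid (fun z => z - m) t + ks / as_ * (1 + es) * solid (fun z => z - m) t
    + g * (1 + ef) * (s t - s_r)).
Proof. reflexivity. Qed.

Lemma input_cont (t : R) : admissible t ->
  filterlim input (within admissible (locally t)) (locally (input t)).
Proof.
  intros Ha. set (F := within admissible (locally t)).
  assert (FF : Filter F) by apply _.
  assert (K : forall k : R, filterlim (fun _ : R => k) F (locally k)) by (intros k; apply filterlim_const).
  assert (Hs : filterlim s F (locally (s t))) by (apply s_within; [apply Ha|intros r Hr; apply Hr]).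
  pose proof (liquid_cont (fun z => z - m) t (shift_continuous m) Ha) as C1.
  pose proof (solid_cont (fun z => z - m) t (shift_continuous m) Ha) as C2.
  rewrite input_eq. unfold input, control.
  apply filterlim_Rmult; auto. apply filterlim_Rplus; auto; [apply filterlim_Rplus; auto|];
    apply filterlim_Rmult; auto.
  apply filterlim_Rminus; auto.
Qed.

Lemma energy_cont (t : R) : admissible t ->
  filterlim energy (within admissible (locally t)) (locally (energy t)).
Proof.
  intros Ha. set (F := within admissible (locally t)).
  assert (FF : Filter F) by apply _.
  assert (K : forall k : R, filterlim (fun _ : R => k) F (locally k)) by (intros k; apply filterlim_const).
  assert (Hs : filterlim s F (locally (s t))) by (apply s_within; [apply Ha|intros r Hr; apply Hr]).
  pose proof (liquid_cont (fun z => z - m) t (shift_continuous m) Ha) as C1.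
  pose proof (solid_cont (fun z => z - m) t (shift_continuous m) Ha) as C2.
  unfold energy.
  apply filterlim_Rplus; auto; [apply filterlim_Rplus; auto|]; apply filterlim_Rmult; auto.
  apply filterlim_Rminus; auto.
Qed.

Lemma s_ex_derive_loc (t : R) : pos_times tau t -> locally t (ex_derive s).
Proof.
  intros Ht. destruct (pos_times_open tau t Ht) as [d [Hd Hpos]].
  apply (locally_Rabs t _ d Hd). intros r Hr.
  apply (cl_stefan _ _ _ _ _ _ _ _ _ _ _ _ _ _ _ Hsol), Hpos, Hr.
Qed.

Lemma s_continuous (t : R) : pos_times tau t -> continuous s t.
Proof.
  intros Ht. apply (ex_derive_continuous s t), (locally_singleton _ _ (s_ex_derive_loc t Ht)).
Qed.

Lemma s_derive_eq (t : R) : pos_times tau t ->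
  Derive s t = (- kl * Tlx (s t) t + ks * Tsx (s t) t) / g.
Proof.
  intros Ht. pose proof (gamma_pos P). unfold kl, ks, g.
  rewrite <- (proj2 (cl_stefan _ _ _ _ _ _ _ _ _ _ _ _ _ _ _ Hsol t Ht)). field. lra.
Qed.

(** The energy identity asks for a continuous interface speed. The Stefan condition provides it,
    expressing the speed by gradients that are continuous up to the interface. *)
Lemma s_derive_cont (t : R) : pos_times tau t -> 0 < s t < len P -> continuous (Derive s) t.
Proof.
  intros Ht Hs. pose proof (s_continuous t Ht) as Hc.
  destruct (pos_times_open tau t Ht) as [d [Hd Hpos]].
  assert (Hin : locally t (fun r => 0 < s r < len P)).
  { apply (Hc (fun z => 0 < z < len P)).
    apply (locally_interval _ (s t) 0 (len P)); simpl; tauto. }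
  unfold continuous. rewrite (s_derive_eq t Ht).
  apply (filterlim_ext_loc (fun r => (- kl * Tlx (s r) r + ks * Tsx (s r) r) / g)).
  - apply (locally_Rabs t _ d Hd). intros r Hr. symmetry. now apply s_derive_eq, Hpos.
  - assert (K : forall k : R, filterlim (fun _ : R => k) (locally t) (locally k))
      by (intros k; apply filterlim_const).
    apply filterlim_Rmult; [apply _| |apply K].
    apply filterlim_Rplus; [apply _| |]; (apply filterlim_Rmult; [apply _|apply K|]).
    + apply (strip_lim tau (fun _ => 0) s (locally t) (fun p => Tlx (fst p) (snd p)) s (fun r => r)); auto.
      * apply (heat_cont_grad _ _ _ _ _ _ _ HL).
      * lra.
      * apply filterlim_id.
      * revert Hin. apply filter_imp. intros r Hr. lra.
    + apply (strip_lim tau s (fun _ => len P) (locally t) (fun p => Tsx (fst p) (snd p)) s (fun r => r)); auto.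
      * apply (heat_cont_grad _ _ _ _ _ _ _ HS).
      * lra.
      * apply filterlim_id.
      * revert Hin. apply filter_imp. intros r Hr. lra.
Qed.

(** * Time derivatives of the phase integrals, of the energy and of the input *)

(** [phi m = 0] removes the term with the interface speed, and the flux at [x = 0] is the heat input
    divided by [kl]. *)
Lemma liquid_derive (phi phi1 phi2 : R -> R) (t : R) :
  (forall z, is_derive phi z (phi1 z)) -> (forall z, is_derive phi1 z (phi2 z)) ->
  (forall z, continuous phi2 z) -> phi m = 0 -> pos_times tau t -> 0 < s t < len P ->
  is_derive (liquid phi) t (al * (phi1 m * Tlx (s t) t + phi1 (Tl 0 t) * input t / kl)
    - al * RInt (fun x => phi2 (Tl x t) * Tlx x t ^ 2) 0 (s t)).
Proof.
  intros D1 D2 C2 Hm Ht Hs.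
  assert (K : forall k : R, locally t (ex_derive (fun _ : R => k))).
  { intros k. apply filter_forall. intros r. auto_derive. auto. }
  assert (KD : forall k : R, continuous (Derive (fun _ : R => k)) t).
  { intros k. apply (continuous_ext (fun _ => 0)); [|apply continuous_const].
    intros r. symmetry. apply Derive_const. }
  evar_last.
  - apply (heat_energy _ tau (fun _ => 0) s Tl0 Tl Tlx HL phi phi1 phi2 D1 D2 C2 t); auto; try apply Hs.
    + now apply s_ex_derive_loc.
    + now apply s_derive_cont.
  - rewrite (cl_melt_l _ _ _ _ _ _ _ _ _ _ _ _ _ _ _ Hsol t Ht), Derive_const.
    rewrite (cl_heat_input _ _ _ _ _ _ _ _ _ _ _ _ _ _ _ Hsol t Ht).
    fold m. rewrite Hm. fold al. unfold input, kl. pose proof (k_l_pos P). field. lra.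
Qed.

Lemma solid_derive (phi phi1 phi2 : R -> R) (t : R) :
  (forall z, is_derive phi z (phi1 z)) -> (forall z, is_derive phi1 z (phi2 z)) ->
  (forall z, continuous phi2 z) -> phi m = 0 -> pos_times tau t -> 0 < s t < len P ->
  is_derive (solid phi) t (- as_ * phi1 m * Tsx (s t) t
    - as_ * RInt (fun x => phi2 (Ts x t) * Tsx x t ^ 2) (s t) (len P)).
Proof.
  intros D1 D2 C2 Hm Ht Hs.
  assert (K : forall k : R, locally t (ex_derive (fun _ : R => k))).
  { intros k. apply filter_forall. intros r. auto_derive. auto. }
  assert (KD : forall k : R, continuous (Derive (fun _ : R => k)) t).
  { intros k. apply (continuous_ext (fun _ => 0)); [|apply continuous_const].
    intros r. symmetry. apply Derive_const. }
  evar_last.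
  - apply (heat_energy _ tau s (fun _ => len P) Ts0 Ts Tsx HS phi phi1 phi2 D1 D2 C2 t); auto; try apply Hs.
    + now apply s_ex_derive_loc.
    + now apply s_derive_cont.
  - rewrite (cl_melt_s _ _ _ _ _ _ _ _ _ _ _ _ _ _ _ Hsol t Ht), Derive_const.
    rewrite (cl_insulated _ _ _ _ _ _ _ _ _ _ _ _ _ _ _ Hsol t Ht).
    fold m. rewrite Hm. fold as_. ring.
Qed.

Lemma liquid_shift_derive (t : R) : pos_times tau t -> 0 < s t < len P ->
  is_derive (liquid (fun z => z - m)) t (al / kl * (kl * Tlx (s t) t + input t)).
Proof.
  intros Ht Hs. evar_last.
  - apply (liquid_derive _ (fun _ => 1) (fun _ => 0)); auto.
    + intros z. auto_derive; auto.
    + intros z. apply @is_derive_const.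
    + intros z. apply continuous_const.
    + apply Rminus_diag.
  - rewrite (RInt_ext _ (fun _ => 0)) by (intros; apply Rmult_0_l). rewrite RInt_const.
    unfold scal; simpl; unfold mult; simpl. unfold kl. pose proof (k_l_pos P). field. lra.
Qed.

Lemma solid_shift_derive (t : R) : pos_times tau t -> 0 < s t < len P ->
  is_derive (solid (fun z => z - m)) t (- as_ * Tsx (s t) t).
Proof.
  intros Ht Hs. evar_last.
  - apply (solid_derive _ (fun _ => 1) (fun _ => 0)); auto.
    + intros z. auto_derive; auto.
    + intros z. apply @is_derive_const.
    + intros z. apply continuous_const.
    + apply Rminus_diag.
  - rewrite (RInt_ext _ (fun _ => 0)) by (intros; apply Rmult_0_l). rewrite RInt_const.
    unfold scal; simpl; unfold mult; simpl. ring.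
Qed.

Lemma s_is_derive (t : R) : pos_times tau t ->
  is_derive s t ((- kl * Tlx (s t) t + ks * Tsx (s t) t) / g).
Proof.
  intros Ht. rewrite <- s_derive_eq by auto.
  apply Derive_correct, (locally_singleton _ _ (s_ex_derive_loc t Ht)).
Qed.

(** In units of heat the liquid gains [kl * Tlx + q] and the solid [- ks * Tsx]; by the Stefan
    condition the latent term contributes [- kl * Tlx + ks * Tsx], so both interface fluxes
    cancel. *)
Lemma energy_derive (t : R) : pos_times tau t -> 0 < s t < len P -> is_derive energy t (input t).
Proof.
  intros Ht Hs. unfold energy. evar_last.
  - apply @is_derive_plus; [apply @is_derive_plus; apply is_derive_scal|apply is_derive_scal].
    + now apply liquid_shift_derive.
    + now apply solid_shift_derive.
    + apply @is_derive_minus; [now apply s_is_derive|apply @is_derive_const].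
  - unfold minus, plus, opp, zero; simpl. unfold kl, ks, g, al, as_.
    pose proof (k_l_pos P). pose proof (alpha_l_pos P). pose proof (alpha_s_pos P).
    pose proof (gamma_pos P). field. lra.
Qed.

(** With the weights [1 + el], [1 + es], [1 + ef] the interface fluxes cancel only partly; the
    coefficients left over are [el - ef] and [ef - es], whose signs are fixed by the ordering of the
    perturbations. *)
Lemma input_derive (t : R) : pos_times tau t -> 0 < s t < len P ->
  is_derive input t (- c * ((1 + el) * input t + (el - ef) * kl * Tlx (s t) t
     + (ef - es) * ks * Tsx (s t) t)).
Proof.
  intros Ht Hs. evar_last.
  - apply (is_derive_ext (fun t => - c * (kl / al * (1 + el) * liquid (fun z => z - m) t
      + ks / as_ * (1 + es) * solid (fun z => z - m) t + g * (1 + ef) * (s t - s_r)))).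
    + intros r. symmetry. apply input_eq.
    + apply is_derive_scal.
      apply @is_derive_plus; [apply @is_derive_plus; apply is_derive_scal|apply is_derive_scal].
      * now apply liquid_shift_derive.
      * now apply solid_shift_derive.
      * apply @is_derive_minus; [now apply s_is_derive|apply @is_derive_const].
  - unfold minus, plus, opp, zero; simpl. unfold kl, ks, g, al, as_.
    pose proof (k_l_pos P). pose proof (alpha_l_pos P). pose proof (alpha_s_pos P).
    pose proof (gamma_pos P). field. lra.
Qed.

(** * Signs of the profiles and of the interface gradients *)

(** The heated end is a Neumann end whose flux is favourable when the input is nonnegative, hence
    the hypothesis on [input]. For the solid the corresponding end is insulated. *)
Lemma liquid_sign (t1 : R) : pos_times tau t1 -> (forall r, 0 <= r <= t1 -> 0 < s r < len P) ->
  (forall r, 0 < r <= t1 -> 0 <= input r) -> forall x, 0 < x < s t1 -> m <= Tl x t1.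
Proof.
  intros Ht Hs Hq x Hx.
  assert (Hpos : forall t, 0 < t <= t1 -> pos_times tau t).
  { intros t Ht'. split; [lra|]. apply (nonneg_times_le tau t1 t (pos_times_nonneg _ _ Ht)). lra. }
  assert (H : -1 * (Tl x t1 - m) <= 0).
  { apply (heat_sign _ tau (fun _ => 0) s Tl0 Tl Tlx HL liquid_le_0 liquid_pw (-1) m t1); auto.
    - apply alpha_l_pos.
    - ring.
    - apply filterlim_const.
    - apply s_within; auto. apply zero_nonneg.
    - intros t Ht'. apply Hs, Ht'.
    - intros t Ht'. assert (Hst : 0 < s t < len P) by (apply Hs; lra). repeat split.
      + apply filter_forall. intros r. auto_derive. auto.
      + now apply s_ex_derive_loc, Hpos.
      + apply (continuous_ext (fun _ => 0)); [|apply continuous_const].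
        intros r. symmetry. apply Derive_const.
      + apply s_derive_cont; auto.
    - rewrite s_init. intros y Hy. destruct A1 as [_ [_ [_ [Hl [Hs' [_ [_ [B1 _]]]]]]]].
      specialize (B1 y Hy). unfold m. lra.
    - intros t Ht'. left. apply (cl_melt_l _ _ _ _ _ _ _ _ _ _ _ _ _ _ _ Hsol), Hpos, Ht'.
    - intros t Ht'. right. split; [apply Derive_const|].
      rewrite (cl_heat_input _ _ _ _ _ _ _ _ _ _ _ _ _ _ _ Hsol) by auto.
      specialize (Hq t Ht'). fold (input t). pose proof (k_l_pos P).
      replace (-1 * (- input t / k_l P)) with (input t / k_l P) by (field; lra).
      apply Rmult_le_pos; [lra|]. left. now apply Rinv_0_lt_compat. }
  lra.
Qed.

Lemma solid_sign (t1 : R) : pos_times tau t1 -> (forall r, 0 <= r <= t1 -> 0 < s r < len P) ->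
  forall x, s t1 < x < len P -> Ts x t1 <= m.
Proof.
  intros Ht Hs x Hx.
  assert (Hpos : forall t, 0 < t <= t1 -> pos_times tau t).
  { intros t Ht'. split; [lra|]. apply (nonneg_times_le tau t1 t (pos_times_nonneg _ _ Ht)). lra. }
  assert (H : 1 * (Ts x t1 - m) <= 0).
  { apply (heat_sign _ tau s (fun _ => len P) Ts0 Ts Tsx HS solid_le_0 solid_pw 1 m t1); auto.
    - apply alpha_s_pos.
    - ring.
    - apply s_within; auto. apply zero_nonneg.
    - apply filterlim_const.
    - intros t Ht'. apply Hs, Ht'.
    - intros t Ht'. assert (Hst : 0 < s t < len P) by (apply Hs; lra). repeat split.
      + now apply s_ex_derive_loc, Hpos.
      + apply filter_forall. intros r. auto_derive. auto.
      + apply s_derive_cont; auto.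
      + apply (continuous_ext (fun _ => 0)); [|apply continuous_const].
        intros r. symmetry. apply Derive_const.
    - rewrite s_init. intros y Hy. destruct A1 as [_ [_ [_ [Hl [Hs' [_ [_ [_ B2]]]]]]]].
      specialize (B2 y Hy). unfold m. lra.
    - intros t Ht'. right. split; [apply Derive_const|].
      rewrite (cl_insulated _ _ _ _ _ _ _ _ _ _ _ _ _ _ _ Hsol) by auto. lra.
    - intros t Ht'. left. apply (cl_melt_s _ _ _ _ _ _ _ _ _ _ _ _ _ _ _ Hsol), Hpos, Ht'. }
  lra.
Qed.

Lemma interface_gradients (t1 : R) : pos_times tau t1 -> (forall r, 0 <= r <= t1 -> 0 < s r < len P) ->
  (forall r, 0 < r <= t1 -> 0 <= input r) -> Tlx (s t1) t1 <= 0 /\ Tsx (s t1) t1 <= 0.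
Proof.
  intros Ht Hs Hq.
  assert (Hst : 0 < s t1 < len P) by (apply Hs; destruct Ht; lra). split.
  - apply (is_derive_on_nonpos 0 (s t1) (fun y => Tl y t1) (s t1)); try lra.
    + apply (heat_grad _ _ _ _ _ _ _ HL). split; simpl; auto; lra.
    + intros y Hy. pose proof (liquid_sign t1 Ht Hs Hq y Hy).
      rewrite (cl_melt_l _ _ _ _ _ _ _ _ _ _ _ _ _ _ _ Hsol t1 Ht). fold m. nra.
  - apply (is_derive_on_nonpos (s t1) (len P) (fun y => Ts y t1) (s t1)); try lra.
    + apply (heat_grad _ _ _ _ _ _ _ HS). split; simpl; auto; lra.
    + intros y Hy. pose proof (solid_sign t1 Ht Hs y Hy).
      rewrite (cl_melt_s _ _ _ _ _ _ _ _ _ _ _ _ _ _ _ Hsol t1 Ht). fold m. nra.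
Qed.

Lemma input_0 : 0 < input 0.
Proof.
  unfold input, control in *.
  rewrite s_init, (RInt_ext (fun x => Tl x 0 - T_m P) (fun x => Tl0 x - T_m P)),
    (RInt_ext (fun x => Ts x 0 - T_m P) (fun x => Ts0 x - T_m P)).
  - exact Hq0.
  - pose proof s_init_bounds as H0. rewrite s_init in H0.
    intros x. rewrite Rmin_left, Rmax_right by lra. intros Hx.
    rewrite (heat_init _ _ _ _ _ _ _ HS); auto. rewrite s_init. lra.
  - pose proof s_init_bounds as H0. rewrite s_init in H0.
    intros x. rewrite Rmin_left, Rmax_right by lra. intros Hx.
    rewrite (heat_init _ _ _ _ _ _ _ HL); auto. rewrite s_init. lra.
Qed.

Lemma energy_0 : energy 0 = gamma P * (s_infty P Tl0 Ts0 s0 - s_r).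
Proof.
  unfold energy, liquid, solid, s_infty.
  rewrite s_init, (RInt_ext (fun x => Tl x 0 - T_m P) (fun x => Tl0 x - T_m P)),
    (RInt_ext (fun x => Ts x 0 - T_m P) (fun x => Ts0 x - T_m P)).
  - pose proof (alpha_l_pos P). pose proof (alpha_s_pos P). pose proof (gamma_pos P). field. lra.
  - pose proof s_init_bounds as H0. rewrite s_init in H0.
    intros x. rewrite Rmin_left, Rmax_right by lra. intros Hx.
    rewrite (heat_init _ _ _ _ _ _ _ HS); auto. rewrite s_init. lra.
  - pose proof s_init_bounds as H0. rewrite s_init in H0.
    intros x. rewrite Rmin_left, Rmax_right by lra. intros Hx.
    rewrite (heat_init _ _ _ _ _ _ _ HL); auto. rewrite s_init. lra.
Qed.

(** * Invariance of the bounds on input and interface *)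

Definition good (t : R) : Prop := 0 < s t < len P /\ 0 < input t.

Lemma admissible_right_0 (t1 : R) : nonneg_times tau t1 -> 0 < t1 ->
  (forall r, 0 <= r <= t1 -> 0 < s r < len P) ->
  filter_le (at_right 0) (within admissible (locally 0)).
Proof.
  intros Ht1 H0 Hs Q HQ. unfold at_right, within in *.
  generalize (filter_and _ _ HQ (at_right_0_lt t1 H0)).
  apply filter_imp. intros r [Q1 Q2] Hr. specialize (Q2 Hr). apply Q1. split.
  - apply (nonneg_times_le tau t1); auto; lra.
  - assert (0 < s r < len P) by (apply Hs; lra). lra.
Qed.

Lemma zero_admissible : admissible 0.
Proof. split; [apply zero_nonneg|]. pose proof s_init_bounds. lra. Qed.

(* The signs of the interface gradients and [el >= ef >= es] give [input' >= - c (1 + el) input]. *)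
Lemma good_bounds (t : R) : nonneg_times tau t -> (forall r, 0 <= r <= t -> good r) ->
  input 0 * exp (- (c * (1 + el)) * t) <= input t /\ energy 0 <= energy t.
Proof.
  intros Ht Hg. destruct (Rle_lt_or_eq_dec 0 t (proj1 Ht)) as [H|<-].
  2: { rewrite Rmult_0_r, exp_0. lra. }
  assert (Hs : forall r, 0 <= r <= t -> 0 < s r < len P) by (intros r Hr; apply (Hg r Hr)).
  assert (Hpos : forall r, 0 < r <= t -> pos_times tau r).
  { intros r Hr. split; [lra|]. apply (nonneg_times_le tau t r Ht). lra. }
  pose proof (admissible_right_0 t Ht H Hs) as Hle.
  split.
  - set (f := fun r => - (input r * exp (c * (1 + el) * r))).
    assert (Hf : f t <= f 0).
    { apply (nonincreasing_from f (fun r => - ((- c * ((1 + el) * input r + (el - ef) * kl * Tlx (s r) r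
         + (ef - es) * ks * Tsx (s r) r)) * exp (c * (1 + el) * r)
         + input r * (c * (1 + el) * exp (c * (1 + el) * r)))) 0 t); [| | |lra].
      - intros r Hr. apply @is_derive_opp.
        apply (is_derive_mult input (fun r => exp (c * (1 + el) * r)));
          [apply input_derive; [now apply Hpos|apply Hs; lra]| |apply Rmult_comm].
        auto_derive; auto. ring.
      - intros r Hr. destruct (interface_gradients r) as [G1 G2].
        + now apply Hpos.
        + intros r' Hr'. apply Hs. lra.
        + intros r' Hr'. left. apply (Hg r'). lra.
        + assert (X1 : 0 <= (el - ef) * kl * (- Tlx (s r) r)).
          { apply Rmult_le_pos; [apply Rmult_le_pos|]; try lra. left. apply k_l_pos. }
          assert (X2 : 0 <= (ef - es) * ks * (- Tsx (s r) r)).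
          { apply Rmult_le_pos; [apply Rmult_le_pos|]; try lra. left. apply k_s_pos. }
          assert (X3 : 0 < exp (c * (1 + el) * r)) by apply exp_pos.
          replace (- ((- c * ((1 + el) * input r + (el - ef) * kl * Tlx (s r) r
             + (ef - es) * ks * Tsx (s r) r)) * exp (c * (1 + el) * r)
             + input r * (c * (1 + el) * exp (c * (1 + el) * r))))
            with (- (c * ((el - ef) * kl * (- Tlx (s r) r) + (ef - es) * ks * (- Tsx (s r) r))
               * exp (c * (1 + el) * r))) by ring.
          assert (0 <= c * ((el - ef) * kl * (- Tlx (s r) r) + (ef - es) * ks * (- Tsx (s r) r))
               * exp (c * (1 + el) * r)).
          { apply Rmult_le_pos; [apply Rmult_le_pos|]; lra. }
          lra.
      - unfold f. apply filterlim_Ropp; [apply _|]. apply filterlim_Rmult; [apply _| |].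
        + eapply filterlim_filter_le_1; [exact Hle|]. apply input_cont, zero_admissible.
        + eapply filterlim_filter_le_1; [apply filter_le_within|].
          apply (ex_derive_continuous (fun r => exp (c * (1 + el) * r))). auto_derive. auto. }
    unfold f in Hf. rewrite Rmult_0_r, exp_0 in Hf.
    replace (- (c * (1 + el)) * t) with (- (c * (1 + el) * t)) by ring. rewrite exp_Ropp.
    assert (X3 : 0 < exp (c * (1 + el) * t)) by apply exp_pos.
    apply (Rmult_le_reg_r (exp (c * (1 + el) * t))); auto.
    rewrite Rmult_assoc, Rinv_l by lra. lra.
  - assert (Hf : (fun r => - energy r) t <= (fun r => - energy r) 0).
    { apply (nonincreasing_from (fun r => - energy r) (fun r => - input r) 0 t); [| | |lra].
      - intros r Hr. apply @is_derive_opp. apply energy_derive; [now apply Hpos|apply Hs; lra].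
      - intros r Hr. assert (0 < input r) by (apply (Hg r); lra). lra.
      - apply filterlim_Ropp; [apply _|].
        eapply filterlim_filter_le_1; [exact Hle|]. apply energy_cont, zero_admissible. }
    simpl in Hf. lra.
Qed.

(** Real induction. The two bounds valid on [[0, t)] pass to the limit, and the explicit exponential
    keeps [input] from reaching 0 at time [t]; the strict bounds on [s t] are recovered afterwards.
    To the right of [t] all conditions are open. *)
Lemma good_always (t1 : R) : nonneg_times tau t1 -> forall t, 0 <= t <= t1 -> good t.
Proof.
  intros Ht1. pose proof Ht1 as [Ht1' _]. apply real_induction; [exact Ht1'| |].
  - intros t Ht Hg.
    assert (Hn : nonneg_times tau t) by (apply (nonneg_times_le tau t1); auto).
    destruct (Rle_lt_or_eq_dec 0 t (proj1 Ht)) as [H|<-].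
    2: { split; [apply s_init_bounds|apply input_0]. }
    assert (Hnr : forall r, 0 <= r <= t -> nonneg_times tau r)
      by (intros r Hr; apply (nonneg_times_le tau t); auto).
    assert (Hleft : at_left t (fun r => 0 < r < t)).
    { apply (locally_Rabs t _ t H). intros r Hr Hrt. apply Rabs_def2 in Hr. lra. }
    assert (Hsub : filter_le (at_left t) (within (fun r => 0 <= r < t) (locally t))).
    { intros Q HQ. unfold at_left, within in *. generalize (filter_and _ _ HQ Hleft).
      apply filter_imp. intros r [Q1 Q2] Hr. apply Q1. specialize (Q2 Hr). lra. }
    assert (Ls : filterlim s (at_left t) (locally (s t))).
    { eapply filterlim_filter_le_1; [exact Hsub|]. apply s_within; auto.
      intros r Hr. apply Hnr. lra. }
    assert (Hsr : forall r, 0 <= r < t -> 0 < s r < len P) by (intros r Hr; apply (Hg r Hr)).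
    assert (S1 : s t <= len P).
    { apply (filterlim_le_const (at_left t) s); auto.
      revert Hleft. apply filter_imp. intros r Hr. left. apply Hsr. lra. }
    assert (S2 : 0 <= s t).
    { apply Ropp_le_cancel. rewrite Ropp_0.
      apply (filterlim_le_const (at_left t) (fun r => - s r)); [apply filterlim_Ropp; auto; apply _|].
      revert Hleft. apply filter_imp. intros r Hr. assert (0 < s r < len P) by (apply Hsr; lra). lra. }
    assert (Hadm : admissible t) by (split; auto).
    assert (Hsub2 : filter_le (at_left t) (within admissible (locally t))).
    { intros Q HQ. unfold at_left, within in *. generalize (filter_and _ _ HQ Hleft).
      apply filter_imp. intros r [Q1 Q2] Hr. apply Q1. specialize (Q2 Hr). split.
      - apply Hnr. lra.
      - assert (0 < s r < len P) by (apply Hsr; lra). lra. }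
    assert (Hb : forall r, 0 <= r < t ->
       input 0 * exp (- (c * (1 + el)) * r) <= input r /\ energy 0 <= energy r).
    { intros r Hr. apply good_bounds; [apply Hnr; lra|]. intros r' Hr'. apply Hg. lra. }
    assert (B1 : input 0 * exp (- (c * (1 + el)) * t) <= input t).
    { assert (X : input 0 * exp (- (c * (1 + el)) * t) - input t <= 0); [|lra].
      apply (filterlim_le_const (at_left t)
        (fun r => input 0 * exp (- (c * (1 + el)) * r) - input r)).
      - apply filterlim_Rminus; [apply _| |].
        + eapply filterlim_filter_le_1; [apply filter_le_within|].
          apply (ex_derive_continuous (fun r => input 0 * exp (- (c * (1 + el)) * r))).
          auto_derive. auto.
        + eapply filterlim_filter_le_1; [exact Hsub2|]. now apply input_cont.
      - revert Hleft. apply filter_imp. intros r Hr. assert (Hr' : 0 <= r < t) by lra.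
        destruct (Hb r Hr'). lra. }
    assert (B2 : energy 0 <= energy t).
    { assert (X : energy 0 - energy t <= 0); [|lra].
      apply (filterlim_le_const (at_left t) (fun r => energy 0 - energy r)).
      - apply filterlim_Rminus; [apply _|apply filterlim_const|].
        eapply filterlim_filter_le_1; [exact Hsub2|]. now apply energy_cont.
      - revert Hleft. apply filter_imp. intros r Hr. assert (Hr' : 0 <= r < t) by lra.
        destruct (Hb r Hr'). lra. }
    assert (Q1 : 0 < input t).
    { apply Rlt_le_trans with (2 := B1). apply Rmult_lt_0_compat; [apply input_0|apply exp_pos]. }
    split; [|exact Q1].
    (* At time [t] the profiles still have their signs, as limits of profiles with these signs. *)
    assert (U0 : 0 <= liquid (fun z => z - m) t).
    { apply Ropp_le_cancel. rewrite Ropp_0.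
      apply (filterlim_le_const (at_left t) (fun r => - liquid (fun z => z - m) r)).
      - apply filterlim_Ropp; [apply _|]. eapply filterlim_filter_le_1; [exact Hsub2|].
        apply liquid_cont; auto. apply shift_continuous.
      - revert Hleft. apply filter_imp. intros r Hr.
        assert (0 <= liquid (fun z => z - m) r); [|lra].
        assert (Hr1 : 0 < s r < len P) by (apply Hsr; lra).
        apply RInt_ge_0; [lra| |].
        + apply (heat_ex_RInt _ tau (fun _ => 0) s Tl0 Tl Tlx HL liquid_le_0 liquid_pw (fun z => z - m)).
          * apply shift_continuous.
          * apply Hnr; lra.
          * lra.
        + intros x Hx. assert (m <= Tl x r); [|lra].
          apply (liquid_sign r); auto.
          * split; [lra|]. apply Hnr; lra.
          * intros r' Hr'. apply Hsr; lra.
          * intros r' Hr'. left. apply (Hg r'). lra. }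
    assert (V0 : solid (fun z => z - m) t <= 0).
    { apply (filterlim_le_const (at_left t) (solid (fun z => z - m))).
      - eapply filterlim_filter_le_1; [exact Hsub2|].
        apply solid_cont; auto. apply shift_continuous.
      - revert Hleft. apply filter_imp. intros r Hr.
        assert (Hr1 : 0 < s r < len P) by (apply Hsr; lra).
        assert (Z : RInt (fun _ => 0) (s r) (len P) = 0) by (rewrite RInt_const; apply Rmult_0_r).
        rewrite <- Z. apply RInt_le; [lra| |apply ex_RInt_const|].
        + apply (heat_ex_RInt _ tau s (fun _ => len P) Ts0 Ts Tsx HS solid_le_0 solid_pw (fun z => z - m)).
          * apply shift_continuous.
          * apply Hnr; lra.
          * lra.
        + intros x Hx. assert (Ts x r <= m); [|lra].
          apply (solid_sign r); auto.
          * split; [lra|]. apply Hnr; lra.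
          * intros r' Hr'. apply Hsr; lra. }
    pose proof (gamma_pos P) as Hg0.
    assert (Kl : 0 < kl / al) by (apply Rdiv_lt_0_compat; [apply k_l_pos|apply alpha_l_pos]).
    assert (Ks : 0 < ks / as_) by (apply Rdiv_lt_0_compat; [apply k_s_pos|apply alpha_s_pos]).
    split.
    (* Without liquid [energy t <= - gamma P * s_r], which is below [energy 0 = gamma P * (s_infty P
       Tl0 Ts0 s0 - s_r)] because (A2) makes [s_infty] positive. *)
    + destruct S2 as [S2|S2]; [exact S2|exfalso].
      rewrite energy_0 in B2. unfold energy in B2. rewrite <- S2 in B2.
      assert (U1 : liquid (fun z => z - m) t = 0).
      { unfold liquid. rewrite <- S2. apply (RInt_point (V := R_CompleteNormedModule)). }
      change (gamma P * (s_infty P Tl0 Ts0 s0 - s_r) <=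
        kl / al * liquid (fun z => z - m) t + ks / as_ * solid (fun z => z - m) t
         + gamma P * (0 - s_r)) in B2.
      rewrite U1 in B2. destruct A2 as [A2' _].
      assert (0 < gamma P * s_infty P Tl0 Ts0 s0) by (apply Rmult_lt_0_compat; auto).
      assert (ks / as_ * solid (fun z => z - m) t <= 0) by nra. lra.
    (* Without solid the two terms left inside the control law are nonnegative, as [s_r < len P], so
       that [input t <= 0]. *)
    + destruct S1 as [S1|S1]; [exact S1|exfalso].
      rewrite input_eq in Q1.
      assert (V1 : solid (fun z => z - m) t = 0).
      { unfold solid. rewrite S1. apply (RInt_point (V := R_CompleteNormedModule)). }
      rewrite V1, S1 in Q1.
      assert (0 <= kl / al * (1 + el) * liquid (fun z => z - m) t).
      { apply Rmult_le_pos; [apply Rmult_le_pos|]; lra. }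
      assert (0 <= g * (1 + ef) * (len P - s_r)).
      { apply Rmult_le_pos; [apply Rmult_le_pos|]; try lra. unfold g; lra. }
      nra.
  - intros t Ht [Hs Hq].
    assert (Hn : nonneg_times tau t) by (apply (nonneg_times_le tau t1); auto; lra).
    assert (Hadm : admissible t) by (split; auto; lra).
    destruct (proj1 (filterlim_R _ _ _) (input_cont t Hadm) _ Hq) as [d1 Hd1].
    assert (Hm : 0 < Rmin (s t) (len P - s t)) by (apply Rmin_pos; lra).
    destruct (proj1 (filterlim_R _ _ _) (s_within t (nonneg_times tau) Hn (fun r Hr => Hr)) _ Hm) as [d2 Hd2].
    pose proof (Rmin_l (s t) (len P - s t)). pose proof (Rmin_r (s t) (len P - s t)).
    exists (Rmin d1 d2). split; [apply Rmin_pos; apply cond_pos|].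
    intros r Hr Hr1. pose proof (Rmin_l d1 d2). pose proof (Rmin_r d1 d2).
    assert (Hnr : nonneg_times tau r) by (apply (nonneg_times_le tau t1); auto; lra).
    (* [input] is continuous only along admissible times, so the interface has to be confined
       first. *)
    assert (S1 : Rabs (s r - s t) < Rmin (s t) (len P - s t)).
    { apply Hd2; auto. apply (Rabs_def1 (r - t)); lra. }
    apply Rabs_def2 in S1.
    assert (Hsr : 0 < s r < len P) by lra.
    assert (Q1 : Rabs (input r - input t) < input t).
    { apply Hd1; [apply (Rabs_def1 (r - t)); lra|]. split; auto; lra. }
    apply Rabs_def2 in Q1. split; [exact Hsr|lra].
Qed.

(** * The Lyapunov function and its exponential decay *)

Lemma sq_shift_derive (w z : R) : is_derive (fun z => (z - w) ^ 2) z (2 * (z - w)).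
Proof. auto_derive; auto. ring. Qed.

Lemma sq_shift_continuous (w z : R) : continuous (fun z => (z - w) ^ 2) z.
Proof. apply (ex_derive_continuous (fun z => (z - w) ^ 2)). eexists. apply sq_shift_derive. Qed.

Lemma liquid_sq_derive (t : R) : pos_times tau t -> 0 < s t < len P ->
  is_derive (liquid (fun z => (z - m) ^ 2)) t
    (2 * al / kl * (Tl 0 t - m) * input t - 2 * al * RInt (fun x => Tlx x t ^ 2) 0 (s t)).
Proof.
  intros Ht Hs. evar_last.
  - apply (liquid_derive _ (fun z => 2 * (z - m)) (fun _ => 2)); auto.
    + intros z. apply sq_shift_derive.
    + intros z. auto_derive; auto. ring.
    + intros z. apply continuous_const.
    + ring.
  - replace (RInt (fun x => 2 * Tlx x t ^ 2) 0 (s t)) with (2 * RInt (fun x => Tlx x t ^ 2) 0 (s t)).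
    + unfold kl. pose proof (k_l_pos P). field. lra.
    + symmetry. apply (RInt_scal (fun x => Tlx x t ^ 2) 0 (s t) 2).
      apply continuous_on_ex_RInt; [lra|].
      apply (continuous_on_comp (fun z => z ^ 2)); [|now apply (heat_grad_slice _ _ _ _ _ _ _ HL)].
      intros w. apply (ex_derive_continuous (fun z => z ^ 2)). auto_derive. auto.
Qed.

Lemma solid_sq_derive (t : R) : pos_times tau t -> 0 < s t < len P ->
  is_derive (solid (fun z => (z - m) ^ 2)) t (- 2 * as_ * RInt (fun x => Tsx x t ^ 2) (s t) (len P)).
Proof.
  intros Ht Hs. evar_last.
  - apply (solid_derive _ (fun z => 2 * (z - m)) (fun _ => 2)); auto.
    + intros z. apply sq_shift_derive.
    + intros z. auto_derive; auto. ring.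
    + intros z. apply continuous_const.
    + ring.
  - replace (RInt (fun x => 2 * Tsx x t ^ 2) (s t) (len P)) with (2 * RInt (fun x => Tsx x t ^ 2) (s t) (len P)).
    + ring.
    + symmetry. apply (RInt_scal (fun x => Tsx x t ^ 2) (s t) (len P) 2).
      apply continuous_on_ex_RInt; [lra|].
      apply (continuous_on_comp (fun z => z ^ 2)); [|now apply (heat_grad_slice _ _ _ _ _ _ _ HS)].
      intros w. apply (ex_derive_continuous (fun z => z ^ 2)). auto_derive. auto.
Qed.

Lemma liquid_mean_sq (t : R) : admissible t ->
  0 <= liquid (fun z => (z - m) ^ 2) t /\
  liquid (fun z => z - m) t ^ 2 <= len P * liquid (fun z => (z - m) ^ 2) t.
Proof.
  intros [Ht Hs].
  pose proof (heat_ex_RInt _ tau (fun _ => 0) s Tl0 Tl Tlx HL liquid_le_0 liquid_pw) as Hex.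
  assert (E1 : ex_RInt (fun x => Tl x t - m) 0 (s t))
    by (apply (Hex (fun z => z - m)); auto; [apply shift_continuous|lra]).
  assert (E2 : ex_RInt (fun x => (Tl x t - m) ^ 2) 0 (s t))
    by (apply (Hex (fun z => (z - m) ^ 2)); auto; [apply sq_shift_continuous|lra]).
  assert (H0 : 0 <= liquid (fun z => (z - m) ^ 2) t)
    by (apply RInt_ge_0; auto; [lra|intros; apply pow2_ge_0]).
  split; [exact H0|].
  eapply Rle_trans; [apply RInt_cauchy_schwarz; auto; lra|].
  apply Rmult_le_compat_r; [exact H0|lra].
Qed.

Lemma solid_mean_sq (t : R) : admissible t ->
  0 <= solid (fun z => (z - m) ^ 2) t /\
  solid (fun z => z - m) t ^ 2 <= len P * solid (fun z => (z - m) ^ 2) t.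
Proof.
  intros [Ht Hs].
  pose proof (heat_ex_RInt _ tau s (fun _ => len P) Ts0 Ts Tsx HS solid_le_0 solid_pw) as Hex.
  assert (E1 : ex_RInt (fun x => Ts x t - m) (s t) (len P))
    by (apply (Hex (fun z => z - m)); auto; [apply shift_continuous|lra]).
  assert (E2 : ex_RInt (fun x => (Ts x t - m) ^ 2) (s t) (len P))
    by (apply (Hex (fun z => (z - m) ^ 2)); auto; [apply sq_shift_continuous|lra]).
  assert (H0 : 0 <= solid (fun z => (z - m) ^ 2) t)
    by (apply RInt_ge_0; auto; [lra|intros; apply pow2_ge_0]).
  split; [exact H0|].
  eapply Rle_trans; [apply RInt_cauchy_schwarz; auto; lra|].
  apply Rmult_le_compat_r; [exact H0|lra].
Qed.

Definition lyapunov (beta t : R) : R :=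
  liquid (fun z => (z - m) ^ 2) t + beta * energy t ^ 2 + solid (fun z => (z - m) ^ 2) t.

Let Cl := kl / al.
Let Cs := ks / as_.

Lemma Cl_pos : 0 < Cl.
Proof. apply Rdiv_lt_0_compat; [apply k_l_pos|apply alpha_l_pos]. Qed.

Lemma Cs_pos : 0 < Cs.
Proof. apply Rdiv_lt_0_compat; [apply k_s_pos|apply alpha_s_pos]. Qed.

Lemma energy_eq (t : R) : energy t =
  Cl * liquid (fun z => z - m) t + Cs * solid (fun z => z - m) t + g * (s t - s_r).
Proof. reflexivity. Qed.

Let Phi (t : R) := Psi P s_r (fun x => Tl x t) (fun x => Ts x t) (s t).

Lemma Psi_eq (t : R) : Phi t =
  liquid (fun z => (z - m) ^ 2) t + solid (fun z => (z - m) ^ 2) t + (s t - s_r) ^ 2.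
Proof. reflexivity. Qed.

Lemma mean_terms_sq (t : R) : admissible t ->
  (Cl * liquid (fun z => z - m) t) ^ 2 + (Cs * solid (fun z => z - m) t) ^ 2 <=
  len P * (Cl ^ 2 + Cs ^ 2) * (liquid (fun z => (z - m) ^ 2) t + solid (fun z => (z - m) ^ 2) t).
Proof.
  intros Ha. destruct (liquid_mean_sq t Ha) as [U0 U1]. destruct (solid_mean_sq t Ha) as [V0 V1].
  pose proof (pow2_ge_0 Cl). pose proof (pow2_ge_0 Cs). pose proof (len_pos P).
  rewrite !Rpow_mult_distr.
  apply (Rmult_le_compat_l (Cl ^ 2)) in U1; auto. apply (Rmult_le_compat_l (Cs ^ 2)) in V1; auto.
  assert (0 <= len P * Cs ^ 2 * liquid (fun z => (z - m) ^ 2) t)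
    by (apply Rmult_le_pos; [apply Rmult_le_pos|]; auto; lra).
  assert (0 <= len P * Cl ^ 2 * solid (fun z => (z - m) ^ 2) t)
    by (apply Rmult_le_pos; [apply Rmult_le_pos|]; auto; lra).
  lra.
Qed.

(** [energy] is a sum of three terms, hence the factor 3; Cauchy-Schwarz bounds the two temperature
    terms by the squared deviations. *)
Lemma lyapunov_le_Psi (beta t : R) : 0 < beta -> admissible t ->
  lyapunov beta t <= (1 + 3 * beta * (g ^ 2 + len P * (Cl ^ 2 + Cs ^ 2))) * Phi t.
Proof.
  intros Hb Ha. destruct (liquid_mean_sq t Ha) as [U0 _]. destruct (solid_mean_sq t Ha) as [V0 _].
  pose proof (mean_terms_sq t Ha) as HM.
  pose proof (sum3_sq (Cl * liquid (fun z => z - m) t) (Cs * solid (fun z => z - m) t)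
    (g * (s t - s_r))) as H3.
  rewrite <- energy_eq in H3. rewrite Psi_eq. unfold lyapunov.
  set (I := liquid (fun z => (z - m) ^ 2) t) in *. set (J := solid (fun z => (z - m) ^ 2) t) in *.
  pose proof (pow2_ge_0 (s t - s_r)) as He. pose proof (pow2_ge_0 g) as Hg.
  assert (HC : 0 <= len P * (Cl ^ 2 + Cs ^ 2)).
  { pose proof (pow2_ge_0 Cl). pose proof (pow2_ge_0 Cs). pose proof (len_pos P).
    apply Rmult_le_pos; lra. }
  rewrite (Rpow_mult_distr g) in H3.
  set (C := len P * (Cl ^ 2 + Cs ^ 2)) in *.
  assert (E3 : energy t ^ 2 <= 3 * (g ^ 2 + C) * (I + J + (s t - s_r) ^ 2)).
  { assert (0 <= g ^ 2 * (I + J)) by (apply Rmult_le_pos; lra).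
    assert (0 <= C * (s t - s_r) ^ 2) by (apply Rmult_le_pos; lra). lra. }
  apply (Rmult_le_compat_l beta) in E3; lra.
Qed.

(** The same splitting, solved for [g * (s t - s_r)]: the interface error is recovered from [energy]
    and the mean temperatures. The term [/ beta] appears because [lyapunov] weighs [energy ^ 2] with
    [beta]. *)
Lemma Psi_le_lyapunov (beta t : R) : 0 < beta -> admissible t ->
  Phi t <= (1 + 3 / g ^ 2 * (/ beta + len P * (Cl ^ 2 + Cs ^ 2))) * lyapunov beta t.
Proof.
  intros Hb Ha. destruct (liquid_mean_sq t Ha) as [U0 _]. destruct (solid_mean_sq t Ha) as [V0 _].
  pose proof (mean_terms_sq t Ha) as HM.
  pose proof (sum3_sq (energy t) (- (Cl * liquid (fun z => z - m) t)) (- (Cs * solid (fun z => z - m) t)))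
    as H3.
  replace (energy t + - (Cl * liquid (fun z => z - m) t) + - (Cs * solid (fun z => z - m) t))
    with (g * (s t - s_r)) in H3 by (rewrite energy_eq; ring).
  rewrite <- !Rsqr_pow2, <- !Rsqr_neg, !Rsqr_pow2, (Rpow_mult_distr g) in H3.
  rewrite Psi_eq. unfold lyapunov.
  set (I := liquid (fun z => (z - m) ^ 2) t) in *. set (J := solid (fun z => (z - m) ^ 2) t) in *.
  pose proof (pow2_ge_0 (energy t)) as HE.
  assert (Hg1 : 0 < g) by apply gamma_pos.
  assert (Hg : 0 < g ^ 2) by now apply pow_lt.
  assert (HC : 0 <= len P * (Cl ^ 2 + Cs ^ 2)).
  { pose proof (pow2_ge_0 Cl). pose proof (pow2_ge_0 Cs). pose proof (len_pos P).
    apply Rmult_le_pos; lra. }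
  set (C := len P * (Cl ^ 2 + Cs ^ 2)) in *.
  set (W := I + beta * energy t ^ 2 + J).
  assert (HbE : 0 <= beta * energy t ^ 2) by (apply Rmult_le_pos; lra).
  assert (Hib : 0 < / beta) by (now apply Rinv_0_lt_compat).
  assert (E3 : g ^ 2 * (s t - s_r) ^ 2 <= 3 * ((/ beta + C) * W)).
  { assert (0 <= / beta * (I + J)) by (apply Rmult_le_pos; lra).
    assert (0 <= C * (beta * energy t ^ 2)) by (apply Rmult_le_pos; lra).
    replace ((/ beta + C) * W) with (/ beta * (I + J) + energy t ^ 2 + C * (I + J)
      + C * (beta * energy t ^ 2)) by (unfold W; field; lra).
    lra. }
  assert (E4 : (s t - s_r) ^ 2 <= 3 / g ^ 2 * ((/ beta + C) * W)).
  { apply (Rmult_le_reg_l (g ^ 2)); auto.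
    replace (g ^ 2 * (3 / g ^ 2 * ((/ beta + C) * W))) with (3 * ((/ beta + C) * W)) by (field; lra).
    exact E3. }
  unfold W in *. lra.
Qed.

(** The constant [N] with [Y ^ 2 <= N * (Iu + Iv)] for the [Y] of the decay estimate: 2 comes from
    the square of a sum of two terms, [len P] from Cauchy-Schwarz. *)
Definition cross_bound : R := 2 * len P * (((el - ef) * Cl) ^ 2 + ((ef - es) * Cs) ^ 2).

Lemma lyapunov_decay (t1 : R) : -1 < ef -> nonneg_times tau t1 ->
  let beta := al * len P * c * (1 + ef) / kl ^ 2 in
  let mu := Rmin al as_ / len P ^ 2 in
  let d := Rmin (mu / (1 + beta * (4 * cross_bound / (1 + ef) ^ 2))) (c * (1 + ef) / 2) in
  lyapunov beta t1 <= lyapunov beta 0 * exp (- d * t1).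
Proof.
  intros Hef1 Ht1 beta mu d.
  pose proof (good_always t1 Ht1) as Hg.
  destruct (Rle_lt_or_eq_dec 0 t1 (proj1 Ht1)) as [H|<-].
  2: { rewrite Rmult_0_r, exp_0. lra. }
  assert (Hs : forall r, 0 <= r <= t1 -> 0 < s r < len P) by (intros r Hr; apply (Hg r Hr)).
  assert (Hpos : forall r, 0 < r <= t1 -> pos_times tau r).
  { intros r Hr. split; [lra|]. apply (nonneg_times_le tau t1 r Ht1). lra. }
  pose proof (admissible_right_0 t1 Ht1 H Hs) as Hle.
  set (W' := fun r => 2 * al / kl * (Tl 0 r - m) * input r
     - 2 * al * RInt (fun x => Tlx x r ^ 2) 0 (s r) - 2 * beta * (- energy r) * input r
     - 2 * as_ * RInt (fun x => Tsx x r ^ 2) (s r) (len P)).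
  assert (DW : forall r, 0 < r <= t1 -> is_derive (lyapunov beta) r (W' r)).
  { intros r Hr. assert (Hr' : 0 <= r <= t1) by lra.
    unfold lyapunov. evar_last.
    - apply @is_derive_plus; [apply @is_derive_plus|].
      + apply liquid_sq_derive; auto.
      + apply is_derive_scal. apply is_derive_pow. apply energy_derive; auto.
      + apply solid_sq_derive; auto.
    - unfold W', plus; simpl. ring. }
  assert (Hrate : forall r, 0 < r <= t1 -> W' r <= - d * lyapunov beta r).
  { intros r Hr. assert (Hr' : 0 <= r <= t1) by lra.
    assert (Ha : admissible r).
    { split; [apply (nonneg_times_le tau t1); auto|]. specialize (Hs r Hr'). lra. }
    destruct (liquid_mean_sq r Ha) as [U0 U1]. destruct (solid_mean_sq r Ha) as [V0 V1].
    pose proof (Hs r Hr') as Hsr.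
    destruct (heat_poincare _ tau (fun _ => 0) s Tl0 Tl Tlx m (len P) r HL (Hpos r Hr)) as [D0 [D1 D2]];
      try lra.
    { right. apply (cl_melt_l _ _ _ _ _ _ _ _ _ _ _ _ _ _ _ Hsol); auto. }
    destruct (heat_poincare _ tau s (fun _ => len P) Ts0 Ts Tsx m (len P) r HS (Hpos r Hr)) as [E0 [E1 E2]];
      try lra.
    { left. apply (cl_melt_s _ _ _ _ _ _ _ _ _ _ _ _ _ _ _ Hsol); auto. }
    assert (Hqr : forall r', 0 < r' <= r -> 0 <= input r').
    { intros r' Hr0. left. apply (Hg r'). lra. }
    assert (Hsr' : forall r', 0 <= r' <= r -> 0 < s r' < len P) by (intros r' Hr0; apply Hs; lra).
    assert (P1 : 0 <= liquid (fun z => z - m) r).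
    { apply RInt_ge_0; [lra| |].
      - apply (heat_ex_RInt _ tau (fun _ => 0) s Tl0 Tl Tlx HL liquid_le_0 liquid_pw (fun z => z - m));
          [apply shift_continuous|apply Ha|lra].
      - intros x Hx. pose proof (liquid_sign r (Hpos r Hr) Hsr' Hqr x Hx). lra. }
    assert (P2 : solid (fun z => z - m) r <= 0).
    { assert (Z : RInt (fun _ => 0) (s r) (len P) = 0) by (rewrite RInt_const; apply Rmult_0_r).
      rewrite <- Z. apply RInt_le; [lra| |apply ex_RInt_const|].
      - apply (heat_ex_RInt _ tau s (fun _ => len P) Ts0 Ts Tsx HS solid_le_0 solid_pw (fun z => z - m));
          [apply shift_continuous|apply Ha|lra].
      - intros x Hx. pose proof (solid_sign r (Hpos r Hr) Hsr' x Hx). lra. }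
    pose proof Cl_pos as HCl. pose proof Cs_pos as HCs. pose proof (len_pos P) as HLp.
    (* With this [Y] the control law reads [- c * ((1 + ef) * energy r + Y)]. The ordering of the
       perturbations and the signs of the two mean temperatures make [Y] nonnegative. *)
    set (Y := (el - ef) * Cl * liquid (fun z => z - m) r - (ef - es) * Cs * solid (fun z => z - m) r).
    replace (lyapunov beta r) with (liquid (fun z => (z - m) ^ 2) r + beta * (- energy r) ^ 2
      + solid (fun z => (z - m) ^ 2) r) by (unfold lyapunov; ring).
    apply (lyapunov_rate al as_ kl (len P) c (1 + ef) cross_bound Y (- energy r) (input r)); auto.
    - apply alpha_l_pos.
    - apply alpha_s_pos.
    - apply k_l_pos.
    - lra.
    - unfold cross_bound. apply Rmult_le_pos; [lra|].
      apply Rplus_le_le_0_compat; apply pow2_ge_0.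
    - rewrite input_eq, energy_eq. unfold Y, Cl, Cs. ring.
    - unfold Y. assert (0 <= (el - ef) * Cl * liquid (fun z => z - m) r)
        by (apply Rmult_le_pos; [apply Rmult_le_pos|]; lra).
      assert (0 <= (ef - es) * Cs * (- solid (fun z => z - m) r))
        by (apply Rmult_le_pos; [apply Rmult_le_pos|]; lra). lra.
    - apply (Hg r Hr').
    - apply D1. lra.
    - unfold Y, cross_bound.
      set (x1 := (el - ef) * Cl). set (x2 := (ef - es) * Cs).
      pose proof (pow2_ge_0 x1) as S1. pose proof (pow2_ge_0 x2) as S2.
      apply (Rmult_le_compat_l (x1 ^ 2)) in U1; auto. apply (Rmult_le_compat_l (x2 ^ 2)) in V1; auto.
      pose proof (pow2_ge_0 (x1 * liquid (fun z => z - m) r + x2 * solid (fun z => z - m) r)) as S3.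
      assert (0 <= len P * x2 ^ 2 * liquid (fun z => (z - m) ^ 2) r)
        by (apply Rmult_le_pos; [apply Rmult_le_pos|]; auto; lra).
      assert (0 <= len P * x1 ^ 2 * solid (fun z => (z - m) ^ 2) r)
        by (apply Rmult_le_pos; [apply Rmult_le_pos|]; auto; lra).
      lra. }
  set (f := fun r => lyapunov beta r * exp (d * r)).
  assert (Hf : f t1 <= f 0).
  { apply (nonincreasing_from f (fun r => W' r * exp (d * r) + lyapunov beta r * (d * exp (d * r))) 0 t1);
      [| | |lra].
    - intros r Hr. apply (is_derive_mult (lyapunov beta) (fun r => exp (d * r)));
        [now apply DW| |apply Rmult_comm].
      auto_derive; auto. ring.
    - intros r Hr. specialize (Hrate r Hr). pose proof (exp_pos (d * r)).
      replace (W' r * exp (d * r) + lyapunov beta r * (d * exp (d * r)))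
        with ((W' r + d * lyapunov beta r) * exp (d * r)) by ring.
      assert (W' r + d * lyapunov beta r <= 0) by lra. nra.
    - unfold f. apply filterlim_Rmult; [apply _| |].
      + eapply filterlim_filter_le_1; [exact Hle|]. pose proof zero_admissible as Z.
        assert (FF : Filter (within admissible (locally 0))) by apply _.
        pose proof (energy_cont 0 Z) as CE.
        unfold lyapunov. apply filterlim_Rplus; auto; [apply filterlim_Rplus; auto|].
        * apply liquid_cont; auto. apply sq_shift_continuous.
        * apply filterlim_Rmult; auto; [apply filterlim_const|].
          assert (Csq : continuous (fun z => z ^ 2) (energy 0))
            by (apply (ex_derive_continuous (fun z => z ^ 2)); auto_derive; auto).
          exact (filterlim_comp _ _ _ energy (fun z => z ^ 2) _ _ _ CE Csq).
        * apply solid_cont; auto. apply sq_shift_continuous.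
      + eapply filterlim_filter_le_1; [apply filter_le_within|].
        apply (ex_derive_continuous (fun r => exp (d * r))). auto_derive. auto. }
  unfold f in Hf. rewrite Rmult_0_r, exp_0 in Hf.
  replace (- d * t1) with (- (d * t1)) by ring. rewrite exp_Ropp.
  assert (X3 : 0 < exp (d * t1)) by apply exp_pos.
  apply (Rmult_le_reg_r (exp (d * t1))); auto.
  rewrite Rmult_assoc, Rinv_l by lra. lra.
Qed.

End ClosedLoop.

Theorem theorem2 (P : plant) (c s_r : R) (c_pos : 0 < c) (s_r_lt : s_r < len P) :
  exists Rad : R, 0 < Rad /\
  forall eps_l eps_s eps_f : R,
    -1 < eps_l -> -1 <= eps_s -> -1 <= eps_f ->
    eps_l >= eps_f -> eps_f >= eps_s ->
    Rabs ((eps_f - eps_l) / (1 + eps_l)) < Rad ->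
  exists M d : R, 0 < M /\ 0 < d /\
  forall (Tl0 Ts0 : R -> R) (s0 : R),
    assumption_A1 P Tl0 Ts0 s0 ->
    assumption_A2 P Tl0 Ts0 s0 ->
    0 < control P c s_r eps_l eps_s eps_f Tl0 Ts0 s0 ->
  forall (tau : Rbar) (Tl Tlx Ts Tsx : R -> R -> R) (s : R -> R),
    Rbar_lt 0 tau ->
    closed_loop_solution P c s_r eps_l eps_s eps_f Tl0 Ts0 s0 tau Tl Tlx Ts Tsx s ->
    (forall t, pos_times tau t ->
       (forall x, 0 < x < s t -> T_m P <= Tl x t) /\
       (forall x, s t < x < len P -> Ts x t <= T_m P) /\
       0 < s t < len P) /\
    (forall t, nonneg_times tau t ->
       Psi P s_r (fun x => Tl x t) (fun x => Ts x t) (s t)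
       <= M * Psi P s_r (fun x => Tl x 0) (fun x => Ts x 0) (s 0) * exp (- d * t)).
Proof.
  (* [Rad = 1] says exactly that [eps_f > -1]. *)
  exists 1. split; [lra|].
  intros el es ef Hel Hes Hef Hlf Hfs Hrad.
  assert (Hef1 : -1 < ef).
  { apply Rabs_def2 in Hrad as [_ Hrad].
    apply (Rmult_lt_compat_r (1 + el)) in Hrad; [|lra].
    replace ((ef - el) / (1 + el) * (1 + el)) with (ef - el) in Hrad by (field; lra). lra. }
  pose proof (alpha_l_pos P) as Hal. pose proof (alpha_s_pos P) as Has.
  pose proof (k_l_pos P) as Hkl. pose proof (len_pos P) as HL. pose proof (gamma_pos P) as Hg.
  set (beta := alpha_l P * len P * c * (1 + ef) / k_l P ^ 2).
  assert (Hb : 0 < beta).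
  { apply Rdiv_lt_0_compat; [|now apply pow_lt]. apply Rmult_lt_0_compat; [|lra].
    apply Rmult_lt_0_compat; [apply Rmult_lt_0_compat|]; lra. }
  set (mu := Rmin (alpha_l P) (alpha_s P) / len P ^ 2).
  assert (Hmu : 0 < mu) by (apply Rdiv_lt_0_compat; [now apply Rmin_pos|now apply pow_lt]).
  set (d := Rmin (mu / (1 + beta * (4 * cross_bound P el es ef / (1 + ef) ^ 2))) (c * (1 + ef) / 2)).
  set (Q := (k_l P / alpha_l P) ^ 2 + (k_s P / alpha_s P) ^ 2).
  assert (HQ : 0 <= len P * Q).
  { apply Rmult_le_pos; [lra|]. apply Rplus_le_le_0_compat; apply pow2_ge_0. }
  set (M1 := 1 + 3 * beta * (gamma P ^ 2 + len P * Q)).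
  set (M2 := 1 + 3 / gamma P ^ 2 * (/ beta + len P * Q)).
  assert (HM1 : 0 < M1).
  { assert (0 <= 3 * beta * (gamma P ^ 2 + len P * Q)); [|unfold M1; lra].
    pose proof (pow2_ge_0 (gamma P)). apply Rmult_le_pos; lra. }
  assert (HM2 : 0 < M2).
  { assert (0 < 3 / gamma P ^ 2) by (apply Rdiv_lt_0_compat; [lra|now apply pow_lt]).
    pose proof (Rinv_0_lt_compat beta Hb).
    assert (0 <= 3 / gamma P ^ 2 * (/ beta + len P * Q)) by (apply Rmult_le_pos; lra).
    unfold M2; lra. }
  (* [M2] bounds [Psi] by the Lyapunov function at time [t], and [M1] bounds the latter by [Psi] at
     time 0. Both constants and [d] are fixed before the initial data and the horizon. *)
  exists (M2 * M1), d. split; [now apply Rmult_lt_0_compat|]. split.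
  { apply Rmin_pos; [|apply Rdiv_lt_0_compat; [apply Rmult_lt_0_compat|]; lra].
    apply Rdiv_lt_0_compat; auto.
    assert (0 <= beta * (4 * cross_bound P el es ef / (1 + ef) ^ 2)); [|lra].
    apply Rmult_le_pos; [lra|]. apply Rdiv_le_0_compat; [|apply pow_lt; lra].
    unfold cross_bound. apply Rmult_le_pos; [lra|]. apply Rmult_le_pos; [lra|].
    apply Rplus_le_le_0_compat; apply pow2_ge_0. }
  intros Tl0 Ts0 s0 A1 A2 Hq0 tau Tl Tlx Ts Tsx s Htau Hsol.
  assert (Hlf' : ef <= el) by lra. assert (Hfs' : es <= ef) by lra.
  pose proof (good_always P c s_r el es ef Tl0 Ts0 s0 tau Tl Tlx Ts Tsx s
    c_pos s_r_lt Hel Hef Hlf' Hfs' A1 A2 Hq0 Htau Hsol) as Hgood.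
  split; intros t Ht.
  - pose proof (Hgood t (pos_times_nonneg tau t Ht)) as Hgt.
    assert (Hs : forall r, 0 <= r <= t -> 0 < s r < len P) by (intros r Hr; apply (Hgt r Hr)).
    split; [|split].
    + apply (liquid_sign P c s_r el es ef Tl0 Ts0 s0 tau Tl Tlx Ts Tsx s A1 Htau Hsol t Ht Hs).
      intros r Hr. left. apply (Hgt r). lra.
    + exact (solid_sign P c s_r el es ef Tl0 Ts0 s0 tau Tl Tlx Ts Tsx s A1 Htau Hsol t Ht Hs).
    + apply Hs. destruct Ht; lra.
  - pose proof (Hgood t Ht) as Hgt.
    assert (Hadm : forall r, 0 <= r <= t -> admissible P tau s r).
    { intros r Hr. split; [now apply (nonneg_times_le tau t)|].
      destruct (Hgt r Hr) as [Hsr _]. lra. }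
    assert (Ht0 : 0 <= t) by apply Ht.
    pose proof (Psi_le_lyapunov P c s_r el es ef Tl0 Ts0 s0 tau Tl Tlx Ts Tsx s A1 Hsol beta t Hb
      (Hadm t (conj Ht0 (Rle_refl t)))) as I1.
    pose proof (lyapunov_le_Psi P c s_r el es ef Tl0 Ts0 s0 tau Tl Tlx Ts Tsx s A1 Hsol beta 0 Hb
      (Hadm 0 (conj (Rle_refl 0) Ht0))) as I2.
    pose proof (lyapunov_decay P c s_r el es ef Tl0 Ts0 s0 tau Tl Tlx Ts Tsx s
      c_pos s_r_lt Hel Hef Hlf' Hfs' A1 A2 Hq0 Htau Hsol t Hef1 Ht) as I3.
    cbv zeta in I3. fold beta mu d in I3. fold Q M2 in I1. fold Q M1 in I2.
    pose proof (exp_pos (- d * t)) as He.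
    eapply Rle_trans; [exact I1|].
    rewrite (Rmult_assoc M2), (Rmult_assoc M2). apply Rmult_le_compat_l; [lra|].
    eapply Rle_trans; [exact I3|]. apply Rmult_le_compat_r; lra.
Qed.
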